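(* Let $K$ be an algebraically closed field of characteristic $2$ and let $A = \Lambda_3(\lambda)$ for some $\lambda\in K\setminus\{0,1\}$. Then: (i) $\dim_K HH^0(A)=6$. (ii) $\dim_K HH^1(A)=4$. (iii) $\dim_K HH^2(A)=4$.
   Context: For a finite-dimensional $K$-algebra $A$, $HH^n(A)=\mathrm{Ext}^n_{A^e}(A,A)$ with $A^e=A^{\mathrm{op}}\otimes_K A$ is the $n$-th Hochschild cohomology space. Paths are composed from left to right ($\alpha\beta$ means first $\alpha$, then $\beta$). For $\lambda\in K\setminus\{0,1\}$, $\Lambda_3(\lambda)$ is the bound quiver algebra $KQ/I$, where $Q$ has vertices $1,2$ and arrows $\alpha:1\to1$, $\sigma:1\to2$, $\gamma:2\to1$, $\beta:2\to2$, and $I$ is given by the relations $\alpha^2=\sigma\gamma+\alpha^3$, $\lambda\beta^2=\gamma\sigma$, $\gamma\alpha=\beta\gamma$, $\alpha\sigma=\sigma\beta$, $\alpha^4=0$. *)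

(* Defs.v *)
From HB Require Import structures.
From mathcomp Require Import all_boot all_order all_algebra.
From mathcomp Require Import finmap monalg boolp.

Set Implicit Arguments.
Unset Strict Implicit.
Unset Printing Implicit Defensive.

Import GRing.Theory.

Local Open Scope ring_scope.
Local Open Scope quotient_scope.

(* The free K-module on T is {malg K[T]}, with basis << t >>, t : T;
   [malg_lift phi] is the linear map sending << t >> to phi t.               *)
Section MalgLift.
Variables (K : nzRingType) (T : choiceType).
Implicit Types (g : {malg K[T]}).

Lemma malg_ind_basis (P : {malg K[T]} -> Prop) :
  P 0 -> (forall c t g, P g -> P (c *: << t >> + g)) -> forall g, P g.
Proof.
move=> P0 PD g; rewrite [g]monalgE.
elim: (msupp g : seq T) => [|t s IHs]; first by rewrite big_nil.
rewrite big_cons; have -> : << g@_t *g t >> = g@_t *: << t >> :> {malg K[T]}.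
  by apply/malgP=> u; rewrite mcoeffZ !mcoeffU mulrnAr mulr1.
exact: PD.
Qed.

Variables (V : lmodType K) (phi : T -> V).

Definition malg_lift g : V := \sum_(t <- msupp g) g@_t *: phi t.

Lemma malg_liftEw g (D : {fset T}) : (msupp g `<=` D)%fset ->
  malg_lift g = \sum_(t <- D) g@_t *: phi t.
Proof.
move=> sgD; rewrite /malg_lift (big_fset_incl _ sgD) // => t _ gt.
by rewrite mcoeff_outdom // scale0r.
Qed.

Lemma malg_lift_is_linear : linear malg_lift.
Proof.
move=> c f g; pose D := (msupp (c *: f + g) `|` (msupp f `|` msupp g))%fset.
rewrite (@malg_liftEw (c *: f + g) D) ?fsubsetUl //.
rewrite (@malg_liftEw f D) ?(@malg_liftEw g D).
- rewrite scaler_sumr -big_split /=; apply: eq_bigr => t _.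
  by rewrite mcoeffD mcoeffZ scalerDl scalerA.
- by rewrite /D fsetUA fsubsetUr.
- by rewrite /D (fsetUC (msupp f)) fsetUA fsubsetUr.
Qed.

HB.instance Definition _ :=
  GRing.isLinear.Build K {malg K[T]} V *:%R malg_lift malg_lift_is_linear.

Lemma malg_liftU t : malg_lift << t >> = phi t.
Proof.
rewrite (@malg_liftEw _ [fset t]%fset) ?msuppU_le // big_seq_fset1.
by rewrite mcoeffUU scale1r.
Qed.

End MalgLift.

Lemma malg_lift_comb (K : comNzRingType) (T : choiceType) (V : lmodType K)
    (phi psi : T -> V) c (g : {malg K[T]}) :
  malg_lift (fun t => c *: phi t + psi t) g
  = c *: malg_lift phi g + malg_lift psi g.
Proof.
rewrite /malg_lift scaler_sumr -big_split; apply: eq_bigr => t _ /=.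
by rewrite scalerDr !scalerA mulrC.
Qed.

(* A small category with finitely many objects, given by its set of morphisms:
   [comp p q] is "p, then q" ([None] when p and q are not composable) and
   [ids] lists the identities.  The axioms [comp1m] and [compm1] say that p is
   composable with exactly one identity on each side, with result p.          *)
Record category := Category {
  mor : choiceType;
  comp : mor -> mor -> option mor;
  ids : seq mor;
  compA : forall p q r, obind (comp p) (comp q r) = obind (comp^~ r) (comp p q);
  comp1m : forall p, pmap (comp^~ p) ids = [:: p];
  compm1 : forall p, pmap (comp p) ids = [:: p];
  mor_inhabited : inhabited mor
}.

(* The category algebra K[C]: << p >> * << q >> is << p then q >> if p and q are
   composable and 0 otherwise. *)
Definition cat_alg (K : comNzRingType) (C : category) := {malg K[mor C]}.

(* Locked, as is the product: unification is very slow when it unfolds finitely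
   supported functions. *)
HB.lock Definition cat_elt (K : comNzRingType) (C : category) (p : mor C) :
  cat_alg K C := << p >>.
Arguments cat_elt K {C} p.

Definition cat_obasis (K : comNzRingType) (C : category) (o : option (mor C)) :
  cat_alg K C := oapp (cat_elt K) 0 o.

HB.lock Definition cat_mul (K : comNzRingType) (C : category) (f g : cat_alg K C) :
  cat_alg K C :=
  malg_lift (fun p => malg_lift (fun q => cat_obasis K (comp p q)) g) f.

Section CategoryAlgebra.
Variables (K : comNzRingType) (C : category).
Local Notation KC := (cat_alg K C).
Local Notation cat_elt := (@cat_elt K C).
Local Notation cat_obasis := (@cat_obasis K C).
Local Notation cat_mul := (@cat_mul K C).
Implicit Types (p q r : mor C) (f g h : KC).

HB.instance Definition _ := GRing.Lmodule.on KC.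

Lemma cat_ind (P : KC -> Prop) :
  P 0 -> (forall c p f, P f -> P (c *: cat_elt p + f)) -> forall f, P f.
Proof. by rewrite cat_elt.unlock; apply: malg_ind_basis. Qed.

Lemma cat_elt_coef p q : mcoeff q (cat_elt p) = (p == q)%:R.
Proof. by rewrite cat_elt.unlock mcoeffU. Qed.

Lemma cat_lift_basis (V : lmodType K) (phi : mor C -> V) p :
  malg_lift phi (cat_elt p) = phi p.
Proof. by rewrite cat_elt.unlock malg_liftU. Qed.

Definition cat_one : KC := \sum_(e <- ids C) cat_elt e.
Lemma cat_obasis_Some p : cat_obasis (Some p) = cat_elt p.
Proof. by []. Qed.

Lemma cat_obasis_None : cat_obasis None = 0.
Proof. by []. Qed.

Lemma cat_mulE p q : cat_mul (cat_elt p) (cat_elt q) = cat_obasis (comp p q).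
Proof. by rewrite cat_mul.unlock !cat_lift_basis. Qed.

Lemma cat_mul_linl c f f' g :
  cat_mul (c *: f + f') g = c *: cat_mul f g + cat_mul f' g.
Proof. rewrite cat_mul.unlock; exact: linearP. Qed.

Lemma cat_mul_linr c f g g' :
  cat_mul f (c *: g + g') = c *: cat_mul f g + cat_mul f g'.
Proof.
rewrite cat_mul.unlock -malg_lift_comb; apply: eq_bigr => p _; congr (_ *: _).
exact: linearP.
Qed.

Lemma cat_mulDl : left_distributive cat_mul +%R.
Proof. by move=> f f' g; have := cat_mul_linl 1 f f' g; rewrite !scale1r. Qed.

Lemma cat_mulDr : right_distributive cat_mul +%R.
Proof. by move=> f g g'; have := cat_mul_linr 1 f g g'; rewrite !scale1r. Qed.

Lemma cat_mul0l g : cat_mul 0 g = 0.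
Proof. by have := cat_mul_linl (-1) 0 0 g; rewrite scaler0 addr0 scaleN1r addNr. Qed.

Lemma cat_mul0r f : cat_mul f 0 = 0.
Proof. by have := cat_mul_linr (-1) f 0 0; rewrite scaler0 addr0 scaleN1r addNr. Qed.

Lemma cat_mulA : associative cat_mul.
Proof.
move=> f g h.
elim/cat_ind: f => [|c p f IHf]; first by rewrite !cat_mul0l.
rewrite !cat_mul_linl IHf; apply: (congr1 (fun x => c *: x + _)) => {f IHf c}.
elim/cat_ind: g => [|c q g IHg].
  by rewrite !(cat_mul0l, cat_mul0r).
rewrite !(cat_mul_linl, cat_mul_linr) IHg; apply: (congr1 (fun x => c *: x + _)) => {g IHg c}.
elim/cat_ind: h => [|c r h IHh]; first by rewrite !cat_mul0r.
rewrite !cat_mul_linr IHh; apply: (congr1 (fun x => c *: x + _)) => {h IHh c}.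
rewrite !cat_mulE.
have /(congr1 cat_obasis) := compA p q r.
by case: (comp q r) => [qr|]; case: (comp p q) => [pq|] /=;
  rewrite ?cat_mulE ?cat_mul0l ?cat_mul0r.
Qed.

Lemma cat_sum_pmap (F : mor C -> option (mor C)) s :
  \sum_(e <- s) cat_obasis (F e) = \sum_(p <- pmap F s) cat_elt p.
Proof.
elim: s => [|e s IHs] /=; first by rewrite !big_nil.
by rewrite big_cons IHs; case: (F e) => [p|] /=; rewrite ?big_cons ?add0r.
Qed.

Lemma cat_mul_suml s (F : mor C -> KC) g :
  cat_mul (\sum_(e <- s) F e) g = \sum_(e <- s) cat_mul (F e) g.
Proof. by elim/big_ind2: _ => // [|f1 g1 f2 g2 <- <-]; rewrite ?cat_mul0l ?cat_mulDl. Qed.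

Lemma cat_mul_sumr s (F : mor C -> KC) f :
  cat_mul f (\sum_(e <- s) F e) = \sum_(e <- s) cat_mul f (F e).
Proof. by elim/big_ind2: _ => // [|f1 g1 f2 g2 <- <-]; rewrite ?cat_mul0r ?cat_mulDr. Qed.

Lemma cat_mul1l : left_id cat_one cat_mul.
Proof.
elim/cat_ind=> [|c p f IHf]; first by rewrite cat_mul0r.
rewrite cat_mul_linr IHf cat_mul_suml.
under eq_bigr do rewrite cat_mulE.
by rewrite (cat_sum_pmap (fun e => comp e p)) comp1m big_seq1.
Qed.

Lemma cat_mul1r : right_id cat_one cat_mul.
Proof.
elim/cat_ind=> [|c p f IHf]; first by rewrite cat_mul0l.
rewrite cat_mul_linl IHf cat_mul_sumr.
under eq_bigr do rewrite cat_mulE.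
by rewrite (cat_sum_pmap (fun e => comp p e)) compm1 big_seq1.
Qed.

Lemma cat_one_neq0 : cat_one != 0.
Proof.
have [p] := mor_inhabited C; apply/eqP => one0.
have := cat_mul1l (cat_elt p); rewrite one0 cat_mul0l.
move/(congr1 (mcoeff p)); rewrite mcoeff0 cat_elt_coef eqxx => /eqP.
by rewrite eq_sym oner_eq0.
Qed.

HB.instance Definition _ := GRing.Zmodule_isNzRing.Build KC
  cat_mulA cat_mul1l cat_mul1r cat_mulDl cat_mulDr cat_one_neq0.

Lemma cat_scalerAl c f g : c *: (f * g) = (c *: f) * g.
Proof. by have := cat_mul_linl c f 0 g; rewrite cat_mul0l !addr0. Qed.
HB.instance Definition _ := GRing.Lmodule_isLalgebra.Build K KC cat_scalerAl.

Lemma cat_scalerAr c f g : c *: (f * g) = f * (c *: g).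
Proof. by have := cat_mul_linr c f g 0; rewrite cat_mul0r !addr0. Qed.
HB.instance Definition _ := GRing.Lalgebra_isAlgebra.Build K KC cat_scalerAr.

Lemma cat_eltM p q : cat_elt p * cat_elt q = cat_obasis (comp p q).
Proof. exact: cat_mulE. Qed.

End CategoryAlgebra.

Section TwoSidedIdeal.
Variables (K : comNzRingType) (B : algType K) (S : B -> Prop).

Definition two_sided_ideal (J : B -> Prop) :=
  [/\ J 0, forall x y, J x -> J y -> J (x + y) &
      forall a x b, J x -> J (a * x * b)].

Definition gen_ideal : {pred B} := fun x =>
  `[< forall J, two_sided_ideal J -> (forall s, S s -> J s) -> J x >].

Lemma gen_idealP x :
  x \in gen_ideal <->
  forall J, two_sided_ideal J -> (forall s, S s -> J s) -> J x.
Proof. by split=> [/asboolP|?]; last apply/asboolP. Qed.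

Lemma mem_gen_ideal s : S s -> s \in gen_ideal.
Proof. by move=> Ss; apply/gen_idealP => J _; apply. Qed.

Lemma gen_idealM a x b : x \in gen_ideal -> a * x * b \in gen_ideal.
Proof.
move=> /gen_idealP Ix; apply/gen_idealP => J JI SJ.
by case: (JI) => _ _; apply; apply: Ix.
Qed.

Lemma gen_idealMl a x : x \in gen_ideal -> a * x \in gen_ideal.
Proof. by move=> Ix; rewrite -[a * x]mulr1 gen_idealM. Qed.

Lemma gen_idealMr x b : x \in gen_ideal -> x * b \in gen_ideal.
Proof. by move=> Ix; rewrite -[x]mul1r gen_idealM. Qed.

Lemma gen_idealZ c x : x \in gen_ideal -> c *: x \in gen_ideal.
Proof. by move=> Ix; rewrite -[x]mul1r scalerAl gen_idealMl. Qed.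

Lemma gen_ideal_zmod_closed : zmod_closed gen_ideal.
Proof.
split=> [|x y Ix Iy]; first by apply/gen_idealP => J [].
rewrite -[- y]scaleN1r.
move: (gen_idealZ (-1) Iy) => /gen_idealP Iy'; move/gen_idealP: Ix => Ix.
by apply/gen_idealP => J JI SJ; case: (JI) => _ JD _; apply: JD; [exact: Ix | exact: Iy'].
Qed.

HB.instance Definition _ := GRing.isZmodClosed.Build B gen_ideal
  gen_ideal_zmod_closed.

(* B / <S>, as a possibly zero ring; algType requires 1 != 0, so the algebra
   structure is put below on the quotients where this has been checked. *)
Definition alg_quot := Quotient.quot gen_ideal.
HB.instance Definition _ := GRing.Zmodule.on alg_quot.
HB.instance Definition _ := @isZmodQuotient.Build B (Quotient.equiv gen_ideal)
  0 -%R +%R alg_quot (lock _) (@Quotient.pi_opp _ _) (@Quotient.pi_add _ _).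

Definition quot_pi (x : B) : alg_quot := \pi x.

Lemma quot_piP x y : quot_pi x = quot_pi y <-> x - y \in gen_ideal.
Proof.
rewrite (Quotient.idealrBE gen_ideal).
by split=> [xy|/eqP//]; apply/eqP.
Qed.

Lemma quot_pi0 : quot_pi 0 = 0.
Proof. by rewrite /quot_pi piE. Qed.

Lemma quot_piD x y : quot_pi (x + y) = quot_pi x + quot_pi y.
Proof. by rewrite /quot_pi piE. Qed.

Lemma quot_repr (u : alg_quot) : quot_pi (repr u) = u.
Proof. exact: reprK. Qed.

Lemma quot_reprP x : repr (quot_pi x) - x \in gen_ideal.
Proof. by apply/quot_piP; rewrite quot_repr. Qed.

Definition quot_mul (u v : alg_quot) : alg_quot := quot_pi (repr u * repr v).
Definition quot_scale (c : K) (u : alg_quot) : alg_quot := quot_pi (c *: repr u).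

Lemma quot_piM x y : quot_mul (quot_pi x) (quot_pi y) = quot_pi (x * y).
Proof.
apply/quot_piP; set x' := repr _; set y' := repr _.
have -> : x' * y' - x * y = (x' - x) * y' + x * (y' - y).
  by rewrite mulrBl mulrBr addrA subrK.
by apply: rpredD; [apply: gen_idealMr | apply: gen_idealMl]; exact: quot_reprP.
Qed.

Lemma quot_piZ c x : quot_scale c (quot_pi x) = quot_pi (c *: x).
Proof. by apply/quot_piP; rewrite -scalerBr; apply/gen_idealZ/quot_reprP. Qed.

Lemma quot_mulA : associative quot_mul.
Proof.
move=> u v w; rewrite -(quot_repr u) -(quot_repr v) -(quot_repr w).
by rewrite !quot_piM mulrA.
Qed.

Lemma quot_mul1l : left_id (quot_pi 1) quot_mul.
Proof. by move=> u; rewrite -(quot_repr u) !quot_piM mul1r. Qed.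

Lemma quot_mul1r : right_id (quot_pi 1) quot_mul.
Proof. by move=> u; rewrite -(quot_repr u) !quot_piM mulr1. Qed.

Lemma quot_mulDl : left_distributive quot_mul +%R.
Proof.
move=> u v w; rewrite -(quot_repr u) -(quot_repr v) -(quot_repr w).
by rewrite -quot_piD !quot_piM mulrDl quot_piD.
Qed.

Lemma quot_mulDr : right_distributive quot_mul +%R.
Proof.
move=> u v w; rewrite -(quot_repr u) -(quot_repr v) -(quot_repr w).
by rewrite -quot_piD !quot_piM mulrDr quot_piD.
Qed.

HB.instance Definition _ := GRing.Zmodule_isPzRing.Build alg_quot
  quot_mulA quot_mul1l quot_mul1r quot_mulDl quot_mulDr.

Lemma quot_scalerA a b u : quot_scale a (quot_scale b u) = quot_scale (a * b) u.
Proof. by rewrite -(quot_repr u) !quot_piZ scalerA. Qed.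

Lemma quot_scale1r : left_id 1 quot_scale.
Proof. by move=> u; rewrite -(quot_repr u) quot_piZ scale1r. Qed.

Lemma quot_scalerDr : right_distributive quot_scale +%R.
Proof.
move=> a u v; rewrite -(quot_repr u) -(quot_repr v).
by rewrite -quot_piD !quot_piZ scalerDr quot_piD.
Qed.

Lemma quot_scalerDl u : {morph quot_scale^~ u : a b / a + b}.
Proof.
by move=> a b; rewrite -(quot_repr u) !quot_piZ scalerDl quot_piD.
Qed.

HB.instance Definition _ := GRing.Zmodule_isLmodule.Build K alg_quot
  quot_scalerA quot_scale1r quot_scalerDr quot_scalerDl.

Lemma quot_scalerAl (c : K) (u v : alg_quot) : c *: (u * v) = (c *: u) * v.
Proof.
rewrite -(quot_repr u) -(quot_repr v).
rewrite [_ * _]quot_piM [LHS]quot_piZ [X in _ = X * _]quot_piZ.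
by rewrite [RHS]quot_piM scalerAl.
Qed.

Lemma quot_scalerAr (c : K) (u v : alg_quot) : c *: (u * v) = u * (c *: v).
Proof.
rewrite -(quot_repr u) -(quot_repr v).
rewrite [_ * _]quot_piM [LHS]quot_piZ [X in _ = _ * X]quot_piZ.
by rewrite [RHS]quot_piM scalerAr.
Qed.

Lemma quot_one_neq0 : 1 \notin gen_ideal -> (1 : alg_quot) != 0.
Proof.
apply: contraNneq => one0.
have /quot_piP : quot_pi 1 = quot_pi 0 by rewrite quot_pi0.
by rewrite subr0.
Qed.

End TwoSidedIdeal.

Arguments quot_pi {K B} S x.

Record quiver := Quiver {
  vertex : finType;
  arrow : finType;
  src : arrow -> vertex;
  tgt : arrow -> vertex;
  vertex_inhabited : inhabited vertex
}.

Section Paths.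
Variable Q : quiver.

Fixpoint walk (v : vertex Q) (s : seq (arrow Q)) : bool :=
  if s is a :: s' then (src a == v) && walk (tgt a) s' else true.

Definition walk_end (v : vertex Q) (s : seq (arrow Q)) : vertex Q :=
  last v (map (@tgt Q) s).

(* A path: its starting vertex and its list of arrows, from left to right. *)
Definition qpath := {p : vertex Q * seq (arrow Q) | walk p.1 p.2}.
HB.instance Definition _ := SubChoice.on qpath.

Definition path_src (p : qpath) : vertex Q := (val p).1.
Definition path_tgt (p : qpath) : vertex Q := walk_end (val p).1 (val p).2.
Definition path_arrows (p : qpath) : seq (arrow Q) := (val p).2.

Definition trivial_path (v : vertex Q) : qpath :=
  @exist _ (fun p => walk p.1 p.2) (v, [::]) isT.

Lemma arrow_path_subproof (a : arrow Q) : walk (src a) [:: a].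
Proof. by rewrite /= eqxx. Qed.
Definition arrow_path (a : arrow Q) : qpath :=
  @exist _ (fun p => walk p.1 p.2) (src a, [:: a]) (arrow_path_subproof a).

Definition path_comp (p q : qpath) : option qpath :=
  if path_tgt p == path_src q
  then insub (path_src p, path_arrows p ++ path_arrows q) else None.

Lemma walk_cat v s1 s2 : walk v (s1 ++ s2) = walk v s1 && walk (walk_end v s1) s2.
Proof. by elim: s1 v => [|a s1 IH] v //=; rewrite IH andbA. Qed.

Lemma walk_end_cat v s1 s2 : walk_end v (s1 ++ s2) = walk_end (walk_end v s1) s2.
Proof. by rewrite /walk_end map_cat last_cat. Qed.

Lemma path_comp_None p q : path_tgt p <> path_src q -> path_comp p q = None.
Proof. by rewrite /path_comp; case: eqP. Qed.

Lemma path_comp_Some p q : path_tgt p = path_src q ->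
  exists r, [/\ path_comp p q = Some r, path_src r = path_src p,
    path_tgt r = path_tgt q & path_arrows r = path_arrows p ++ path_arrows q].
Proof.
case: p q => [[v s] Hs] [[w t] Ht]; rewrite /path_comp /path_tgt /path_src /= => E.
have Hst : walk v (s ++ t) by rewrite walk_cat Hs E.
exists (@exist _ (fun p => walk p.1 p.2) (v, s ++ t) Hst); rewrite E eqxx; split=> //.
  exact: (@insubT _ (fun p => walk p.1 p.2) qpath (v, s ++ t) Hst).
by rewrite /path_tgt /= walk_end_cat E.
Qed.

Lemma path_eqP p q :
  path_src p = path_src q -> path_arrows p = path_arrows q -> p = q.
Proof.
move=> E1 E2; apply: val_inj; rewrite [val p]surjective_pairing.
by rewrite [val q]surjective_pairing; congr pair.
Qed.

Lemma path_compA p q r :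
  obind (path_comp p) (path_comp q r) = obind (path_comp^~ r) (path_comp p q).
Proof.
have [Epq|Npq] := path_tgt p =P path_src q; last first.
  rewrite (path_comp_None Npq) /=.
  have [/path_comp_Some[qr [-> Es _ _]]|/path_comp_None -> //] :=
    path_tgt q =P path_src r.
  by rewrite /= path_comp_None // Es.
have [pq [-> Es Et Ea]] := path_comp_Some Epq.
have [Eqr|Nqr] := path_tgt q =P path_src r; last first.
  by rewrite (path_comp_None Nqr) /= path_comp_None // Et.
have [qr [-> Es' Et' Ea']] := path_comp_Some Eqr => /=.
have [|x [-> xs xt xa]] := @path_comp_Some p qr; first by rewrite Es'.
have [|y [-> ys yt ya]] := @path_comp_Some pq r; first by rewrite Et.
congr Some; apply: path_eqP; first by rewrite xs ys Es.
by rewrite xa ya Ea Ea' catA.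
Qed.

Definition trivial_paths : seq qpath := map trivial_path (enum (vertex Q)).

Lemma pmap_enum1 (F : qpath -> option qpath) (v : vertex Q) p :
  (forall w, F (trivial_path w) = if w == v then Some p else None) ->
  pmap F trivial_paths = [:: p].
Proof.
move=> FE; rewrite /trivial_paths.
have -> : pmap F (map trivial_path (enum (vertex Q))) =
          nseq (count_mem v (enum (vertex Q))) p.
  elim: (enum _) => //= w s ->; rewrite FE.
  by case: eqP.
by rewrite enumT -[count_mem v _]/(count_mem v (Finite.enum _)) enumP.
Qed.

Lemma path_comp1p p : pmap (path_comp^~ p) trivial_paths = [:: p].
Proof.
apply: (@pmap_enum1 _ (path_src p)) => w.
have [E|N] := w =P path_src p; last by rewrite path_comp_None.
have [r [-> rs _ ra]] := @path_comp_Some (trivial_path w) p E.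
by congr Some; apply: path_eqP; rewrite ?rs ?ra.
Qed.

Lemma path_compp1 p : pmap (path_comp p) trivial_paths = [:: p].
Proof.
apply: (@pmap_enum1 _ (path_tgt p)) => w.
rewrite eq_sym; have [E|N] := path_tgt p =P w; last by rewrite path_comp_None.
have [r [-> rs _ ra]] := @path_comp_Some p (trivial_path w) E.
by congr Some; apply: path_eqP; rewrite ?rs ?ra ?cats0.
Qed.

Lemma path_inhabited : inhabited qpath.
Proof. by have [v] := vertex_inhabited Q; exists; exact: trivial_path v. Qed.

Definition path_category :=
  Category path_compA path_comp1p path_compp1 path_inhabited.

End Paths.

Definition path_alg (K : comNzRingType) (Q : quiver) := cat_alg K (path_category Q).
HB.instance Definition _ K Q := GRing.Algebra.on (path_alg K Q).

Definition arrow_elt (K : comNzRingType) (Q : quiver) (a : arrow Q) : path_alg K Q :=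
  cat_elt K (C := path_category Q) (arrow_path a).

Section TrivialPathCoefficient.
Variables (K : comNzRingType) (Q : quiver) (v : vertex Q).
Local Notation KQ := (path_alg K Q).

Definition vcoef (x : KQ) : K := @mcoeff (mor (path_category Q)) K (trivial_path v) x.

Lemma vcoef_lin c x y : vcoef (c *: x + y) = c * vcoef x + vcoef y.
Proof. by rewrite /vcoef mcoeffD mcoeffZ. Qed.

Lemma vcoef0 : vcoef 0 = 0. Proof. exact: mcoeff0. Qed.

Lemma vcoefD x y : vcoef (x + y) = vcoef x + vcoef y.
Proof. by rewrite -[x]scale1r vcoef_lin mul1r scale1r. Qed.

Lemma vcoefZ c x : vcoef (c *: x) = c * vcoef x.
Proof. by rewrite -[c *: x]addr0 vcoef_lin vcoef0 addr0. Qed.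

Lemma vcoefB x y : vcoef (x - y) = vcoef x - vcoef y.
Proof. by rewrite -scaleN1r vcoefD vcoefZ mulN1r. Qed.

Lemma path_comp_trivial (p q : qpath Q) :
  (path_comp p q == Some (trivial_path v)) =
  (p == trivial_path v) && (q == trivial_path v).
Proof.
apply/eqP/andP => [|[/eqP-> /eqP->]].
  have [E|/path_comp_None -> //] := path_tgt p =P path_src q.
  have [r [-> rs rt ra]] := path_comp_Some E => -[Er].
  have := ra; rewrite Er /path_arrows /=; move: E rs rt; rewrite Er.
  rewrite /path_src /path_tgt; case: p q {ra} => [[w s] Hs] [[w' s'] Hs'] /=.
  case: s Hs => [|//] Hs; case: s' Hs' => [|//] Hs' /= <- <- _ _.
  by split; apply/eqP; apply: val_inj.
have [|r [-> rs _ ra]] := @path_comp_Some Q (trivial_path v) (trivial_path v) => //.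
by congr Some; apply: path_eqP; rewrite ?rs ?ra.
Qed.

Lemma vcoefM (x y : KQ) : vcoef (x * y) = vcoef x * vcoef y.
Proof.
elim/cat_ind: x => [|c p x IHx]; first by rewrite mul0r vcoef0 mul0r.
rewrite mulrDl -scalerAl !vcoef_lin IHx mulrDl -mulrA.
apply: (congr1 (fun z => c * z + _)).
elim/cat_ind: y {x IHx} => [|d q y IHy]; first by rewrite mulr0 vcoef0 mulr0.
rewrite mulrDr -scalerAr !vcoef_lin IHy mulrDr mulrCA.
apply: (congr1 (fun z => d * z + _)).
rewrite cat_eltM /vcoef !cat_elt_coef.
have := path_comp_trivial p q; rewrite -[path_comp p q]/(comp p q).
case: (comp p q) => [r|] E.
  rewrite cat_obasis_Some cat_elt_coef.
  rewrite [r == _]E -natrM mulnb; exact: congr1.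
rewrite cat_obasis_None mcoeff0 -natrM mulnb.
by rewrite -[_ && _]E.
Qed.

Lemma vcoef1 : vcoef 1 = 1.
Proof.
pose e : KQ := cat_elt K (C := path_category Q) (trivial_path v).
have e1 : vcoef e = 1 by rewrite /vcoef cat_elt_coef eqxx.
by have := vcoefM e 1; rewrite mulr1 e1 mul1r => <-.
Qed.

Lemma vcoef_arrow a : vcoef (arrow_elt K a) = 0.
Proof.
rewrite /vcoef cat_elt_coef (_ : (_ == _) = false) //.
by apply/eqP => /(congr1 (@path_arrows Q)).
Qed.

Lemma vcoef_ideal : two_sided_ideal (fun x : KQ => vcoef x = 0).
Proof.
split=> [|x y x0 y0|a x b x0]; first exact: vcoef0.
  by rewrite vcoefD x0 y0 addr0.
by rewrite !vcoefM x0 mulr0 mul0r.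
Qed.

End TrivialPathCoefficient.

Variant lambda_vertex := vtx1 | vtx2.
Variant lambda_arrow := alpha | sigma | gamma | beta.

Definition lambda_vertex_code (v : lambda_vertex) : bool :=
  if v is vtx1 then false else true.
Definition lambda_vertex_decode (b : bool) : lambda_vertex :=
  if b then vtx2 else vtx1.
Lemma lambda_vertex_codeK : cancel lambda_vertex_code lambda_vertex_decode.
Proof. by case. Qed.
HB.instance Definition _ :=
  Finite.copy lambda_vertex (can_type lambda_vertex_codeK).

Definition lambda_src (a : lambda_arrow) : lambda_vertex :=
  match a with alpha => vtx1 | sigma => vtx1 | gamma => vtx2 | beta => vtx2 end.
Definition lambda_tgt (a : lambda_arrow) : lambda_vertex :=
  match a with alpha => vtx1 | sigma => vtx2 | gamma => vtx1 | beta => vtx2 end.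

Definition lambda_arrow_code (a : lambda_arrow) : lambda_vertex * lambda_vertex :=
  (lambda_src a, lambda_tgt a).
Definition lambda_arrow_decode (p : lambda_vertex * lambda_vertex) : lambda_arrow :=
  match p with
  | (vtx1, vtx1) => alpha | (vtx1, vtx2) => sigma
  | (vtx2, vtx1) => gamma | (vtx2, vtx2) => beta
  end.
Lemma lambda_arrow_codeK : cancel lambda_arrow_code lambda_arrow_decode.
Proof. by case. Qed.
HB.instance Definition _ :=
  Finite.copy lambda_arrow (can_type lambda_arrow_codeK).

Definition lambda_quiver : quiver :=
  @Quiver lambda_vertex lambda_arrow lambda_src lambda_tgt (inhabits vtx1).

Section Lambda3.
Variables (K : comNzRingType) (lam : K).
Local Notation KQ := (path_alg K lambda_quiver).
Local Notation "''a'" := (@arrow_elt K lambda_quiver alpha).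
Local Notation "''s'" := (@arrow_elt K lambda_quiver sigma).
Local Notation "''g'" := (@arrow_elt K lambda_quiver gamma).
Local Notation "''b'" := (@arrow_elt K lambda_quiver beta).

Definition Lambda3_rels : KQ -> Prop := fun x =>
  x \in [:: 'a ^+ 2 - ('s * 'g + 'a ^+ 3);
            lam *: 'b ^+ 2 - 'g * 's;
            'g * 'a - 'b * 'g;
            'a * 's - 's * 'b;
            'a ^+ 4].

Definition Lambda3 := alg_quot Lambda3_rels.
HB.instance Definition _ := GRing.PzRing.on Lambda3.
HB.instance Definition _ := GRing.Lmodule.on Lambda3.

Lemma Lambda3_one_neq0 : (1 : Lambda3) != 0.
Proof.
pose v1 : vertex lambda_quiver := vtx1.
apply: (@quot_one_neq0 K KQ); apply/negP => /gen_idealP/(_ _ (vcoef_ideal K v1)).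
rewrite vcoef1 => H; suff /eqP : (1 : K) = 0 by rewrite oner_eq0.
apply: H => x; rewrite /Lambda3_rels !inE.
by case/or4P=> [/eqP->|/eqP->|/eqP->|/orP[]/eqP->];
  rewrite ?(vcoefB, vcoefD, vcoefZ) ?exprS ?expr0 ?vcoefM ?vcoef_arrow;
  rewrite ?(mul0r, mulr0, addr0, subr0).
Qed.

HB.instance Definition _ :=
  GRing.PzSemiRing_isNonZero.Build Lambda3 Lambda3_one_neq0.
HB.instance Definition _ :=
  GRing.Lmodule_isLalgebra.Build K Lambda3 (@quot_scalerAl K KQ Lambda3_rels).
HB.instance Definition _ :=
  GRing.Lalgebra_isAlgebra.Build K Lambda3 (@quot_scalerAr K KQ Lambda3_rels).

End Lambda3.

(* A^e = A^op (x)_K A is presented as the monoid algebra of the multiplicative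
   monoid of A^op x A, whose basis element << (x, y) >> is the pure tensor
   x (x) y, divided by the bilinearity relations.                             *)
Section EnvelopingAlgebra.
Variables (K : comNzRingType) (A : algType K).

Definition pair_mul (p q : (A^c * A)%type) : option (A^c * A)%type :=
  Some (p * q).

Lemma pair_mulA p q r :
  obind (pair_mul p) (pair_mul q r) = obind (pair_mul^~ r) (pair_mul p q).
Proof. by rewrite /= /pair_mul mulrA. Qed.

Lemma pair_mul1p p : pmap (pair_mul^~ p) [:: 1] = [:: p].
Proof. by rewrite /= mul1r. Qed.

Lemma pair_mulp1 p : pmap (pair_mul p) [:: 1] = [:: p].
Proof. by rewrite /= mulr1. Qed.

Definition pair_monoid := Category pair_mulA pair_mul1p pair_mulp1 (inhabits 1).

Definition pure_tensor (x y : A) : cat_alg K pair_monoid :=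
  cat_elt K (C := pair_monoid) (x, y).

Lemma pure_tensorM x y x' y' :
  pure_tensor x y * pure_tensor x' y' = pure_tensor (x' * x) (y * y').
Proof. exact: (@cat_eltM K pair_monoid (x, y) (x', y')). Qed.

Variant tensor_rels : cat_alg K pair_monoid -> Prop :=
  | TensorDl x x' y : tensor_rels
      (pure_tensor (x + x') y - (pure_tensor x y + pure_tensor x' y))
  | TensorDr x y y' : tensor_rels
      (pure_tensor x (y + y') - (pure_tensor x y + pure_tensor x y'))
  | TensorZl c x y : tensor_rels (pure_tensor (c *: x) y - c *: pure_tensor x y)
  | TensorZr c x y : tensor_rels (pure_tensor x (c *: y) - c *: pure_tensor x y).

Definition enveloping := alg_quot tensor_rels.
HB.instance Definition _ := GRing.PzRing.on enveloping.
HB.instance Definition _ := GRing.Lmodule.on enveloping.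

(* The action (x (x) y) . a = y a x. *)
Definition bimod_act_pre (t : cat_alg K pair_monoid) (a : A) : A :=
  malg_lift (fun p : (A^c * A)%type => p.2 * a * p.1 : A) t.

Lemma bimod_act_preE x y a : bimod_act_pre (pure_tensor x y) a = y * a * x.
Proof. exact: (@cat_lift_basis K pair_monoid). Qed.

Lemma bimod_act_pre_linl c t t' a :
  bimod_act_pre (c *: t + t') a = c *: bimod_act_pre t a + bimod_act_pre t' a.
Proof. exact: linearP. Qed.

Lemma bimod_act_pre_linr c t a a' :
  bimod_act_pre t (c *: a + a') = c *: bimod_act_pre t a + bimod_act_pre t a'.
Proof.
rewrite /bimod_act_pre -malg_lift_comb; apply: eq_bigr => p _ /=.
by rewrite mulrDr mulrDl -scalerAr -scalerAl.
Qed.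

Lemma bimod_act_preD t t' a :
  bimod_act_pre (t + t') a = bimod_act_pre t a + bimod_act_pre t' a.
Proof. by have := bimod_act_pre_linl 1 t t' a; rewrite !scale1r. Qed.

Lemma bimod_act_preZ c t a : bimod_act_pre (c *: t) a = c *: bimod_act_pre t a.
Proof. exact: linearZ. Qed.

Lemma bimod_act_pre0 t : bimod_act_pre t 0 = 0.
Proof.
by have := bimod_act_pre_linr (-1) t 0 0; rewrite scaler0 addr0 scaleN1r addNr.
Qed.

Lemma bimod_act_preB t t' a :
  bimod_act_pre (t - t') a = bimod_act_pre t a - bimod_act_pre t' a.
Proof. by rewrite bimod_act_preD -scaleN1r bimod_act_preZ scaleN1r. Qed.

Lemma bimod_act_pre1 a : bimod_act_pre 1 a = a.
Proof.
have -> : 1 = pure_tensor 1 1.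
  by rewrite [LHS]/(cat_one K pair_monoid) /cat_one big_seq1.
by rewrite bimod_act_preE mul1r mulr1.
Qed.

Lemma bimod_act_preM t u a :
  bimod_act_pre (t * u) a = bimod_act_pre t (bimod_act_pre u a).
Proof.
elim/cat_ind: t => [|c [x y] t IHt].
  by rewrite mul0r; have := bimod_act_preZ 0 0 a; rewrite !scale0r => ->;
     have := bimod_act_preZ 0 0 (bimod_act_pre u a); rewrite !scale0r => ->.
rewrite mulrDl -scalerAl !bimod_act_pre_linl IHt.
apply: (congr1 (fun z => c *: z + _)).
elim/cat_ind: u {t c IHt} => [|c [x' y'] u IHu].
  rewrite mulr0; have := bimod_act_preZ 0 0 a; rewrite !scale0r => ->.
  by rewrite bimod_act_pre0.
rewrite mulrDr -scalerAr !bimod_act_pre_linl bimod_act_pre_linr IHu.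
apply: (congr1 (fun z => c *: z + _)).
rewrite -[@cat_elt K pair_monoid (x, y)]/(pure_tensor x y).
rewrite -[@cat_elt K pair_monoid (x', y')]/(pure_tensor x' y').
by rewrite pure_tensorM !bimod_act_preE !mulrA.
Qed.

Lemma bimod_act_pre_ideal t a : t \in gen_ideal tensor_rels -> bimod_act_pre t a = 0.
Proof.
move=> /gen_idealP/(_ (fun t => forall a, bimod_act_pre t a = 0)) It.
have act0 b : bimod_act_pre 0 b = 0.
  by have := bimod_act_preZ 0 0 b; rewrite !scale0r.
apply: It => {t a} [|_ [x x' y|x y y'|c x y|c x y] a].
- split=> [b|t u t0 u0 b|t u v u0 b]; first exact: act0.
    by rewrite bimod_act_preD t0 u0 addr0.
  by rewrite !bimod_act_preM u0 bimod_act_pre0.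
- by rewrite bimod_act_preB bimod_act_preD !bimod_act_preE mulrDr subrr.
- by rewrite bimod_act_preB bimod_act_preD !bimod_act_preE !mulrDl subrr.
- by rewrite bimod_act_preB bimod_act_preZ !bimod_act_preE scalerAr subrr.
- by rewrite bimod_act_preB bimod_act_preZ !bimod_act_preE -!scalerAl subrr.
Qed.

Lemma enveloping_one_neq0 : (1 : enveloping) != 0.
Proof.
apply: (@quot_one_neq0 K (cat_alg K pair_monoid)).
apply/negP => /(bimod_act_pre_ideal 1)/eqP.
by rewrite bimod_act_pre1 oner_eq0.
Qed.

HB.instance Definition _ :=
  GRing.PzSemiRing_isNonZero.Build enveloping enveloping_one_neq0.
HB.instance Definition _ := GRing.Lmodule_isLalgebra.Build K enveloping
  (@quot_scalerAl K (cat_alg K pair_monoid) tensor_rels).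
HB.instance Definition _ := GRing.Lalgebra_isAlgebra.Build K enveloping
  (@quot_scalerAr K (cat_alg K pair_monoid) tensor_rels).

(* A as a left module over A^e, i.e. as a bimodule over itself. *)
Definition bimod : Type := A.
HB.instance Definition _ := GRing.Zmodule.on bimod.

Definition bimod_act (t : enveloping) (a : bimod) : bimod :=
  bimod_act_pre (repr t) a.

Lemma bimod_act_pi t (a : bimod) :
  bimod_act (quot_pi tensor_rels t) a = bimod_act_pre t a.
Proof.
apply/eqP; rewrite -subr_eq0 -bimod_act_preB; apply/eqP.
exact/bimod_act_pre_ideal/quot_reprP.
Qed.

Lemma bimod_actA t u (a : bimod) : bimod_act t (bimod_act u a) = bimod_act (t * u) a.
Proof.
rewrite -(quot_repr t) -(quot_repr u) [_ * _]quot_piM.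
by rewrite !bimod_act_pi bimod_act_preM.
Qed.

Lemma bimod_act1 : left_id 1 bimod_act.
Proof. by move=> a; rewrite [1]/(quot_pi _ 1) bimod_act_pi bimod_act_pre1. Qed.

Lemma bimod_actDr : right_distributive bimod_act +%R.
Proof.
by move=> t a b; have := bimod_act_pre_linr 1 (repr t) a b; rewrite !scale1r.
Qed.

Lemma bimod_actDl a : {morph bimod_act^~ a : t u / t + u}.
Proof.
move=> t u; rewrite -(quot_repr t) -(quot_repr u) -quot_piD !bimod_act_pi.
exact: bimod_act_preD.
Qed.

HB.instance Definition _ := GRing.Zmodule_isLmodule.Build enveloping bimod
  bimod_actA bimod_act1 bimod_actDr bimod_actDl.

(* The pure tensor x (x) y of A^e. *)
Definition tensor (x y : A) : enveloping := quot_pi tensor_rels (pure_tensor x y).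

Lemma tensorM x y x' y' : tensor x y * tensor x' y' = tensor (x' * x) (y * y').
Proof.
by rewrite /tensor [LHS]quot_piM pure_tensorM.
Qed.

Lemma tensor_act x y (a : bimod) : tensor x y *: a = (y * (a : A) * x : A).
Proof. by rewrite [LHS]bimod_act_pi bimod_act_preE. Qed.

End EnvelopingAlgebra.

Section Ext.
Variables (K : comNzRingType) (R : algType K).

Definition projective (P : lmodType R) : Prop :=
  forall (U V : lmodType R) (g : {linear U -> V}) (f : {linear P -> V}),
    (forall v, exists u, g u = v) ->
    exists h : {linear P -> U}, forall x, g (h x) = f x.

Record proj_resolution (M : lmodType R) := ProjResolution {
  res_mod : nat -> lmodType R;
  res_diff : forall n, {linear res_mod n.+1 -> res_mod n};
  res_aug : {linear res_mod 0 -> M};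
  res_proj : forall n, projective (res_mod n);
  res_aug_surj : forall m, exists x, res_aug x = m;
  res_exact0 : forall x, res_aug x = 0 <-> exists y, res_diff 0 y = x;
  res_exact : forall n x, res_diff n x = 0 <-> exists y, res_diff n.+1 y = x
}.

Variables (M : lmodType R) (P : proj_resolution M) (N : lmodType R).

(* Cochains are the R-linear maps P_n -> N.  They form a K-space in which c acts
   on f as x |-> c%:A *: f x, c%:A being the image of c in the centre of R. *)
Definition cocycle (n : nat) (f : res_mod P n -> N) : Prop :=
  forall x, f (res_diff P n x) = 0.

Definition coboundary (n : nat) : (res_mod P n -> N) -> Prop :=
  match n with
  | 0 => fun f => forall x, f x = 0
  | m.+1 => fun f => exists g : {linear res_mod P m -> N},
      forall x, f x = g (res_diff P m x)
  end.

(* dim_K H^n(Hom_R(P, N)) = d: the classes of some d cocycles form a basis of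
   cocycles modulo coboundaries. *)
Definition cohomology_dim (n d : nat) : Prop :=
  exists b : 'I_d -> {linear res_mod P n -> N},
  [/\ forall i, cocycle (b i),
      forall f : {linear res_mod P n -> N}, cocycle f ->
        exists c : 'I_d -> K,
          coboundary (fun x => f x - \sum_(i < d) (c i)%:A *: b i x)
    & forall c : 'I_d -> K,
        coboundary (fun x => \sum_(i < d) (c i)%:A *: b i x) ->
        forall i, c i = 0].

End Ext.

Section FreeResolution.
Variables (K : comNzRingType) (R : algType K).

Lemma free_projective (T : choiceType) : projective ({malg R[T]} : lmodType R).
Proof.
move=> U V g f g_surj.
have /choice[u ug] t : exists x, g x = f << t >> := g_surj (f << t >>).
exists (malg_lift u) => x; elim/malg_ind_basis: x => [|c t x IHx].
  by rewrite !raddf0.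
by rewrite !linearP /= malg_liftU ug -IHx.
Qed.

Section Kernel.
Variables (U V : lmodType R) (f : {linear U -> V}).

Definition kernel_pred : {pred U} := fun x => f x == 0.

Lemma kernel_submod_closed : submod_closed kernel_pred.
Proof.
split=> [|c x y]; rewrite !unfold_in ?raddf0 // linearP => /eqP-> /eqP->.
by rewrite scaler0 addr0.
Qed.

HB.instance Definition _ :=
  GRing.isSubmodClosed.Build R U kernel_pred kernel_submod_closed.

Definition kernel := {x : U | x \in kernel_pred}.
HB.instance Definition _ := SubChoice.on kernel.
HB.instance Definition _ := [SubChoice_isSubLmodule of kernel by <:].

End Kernel.

Variable M : lmodType R.

Definition free_cover (U : lmodType R) : {linear {malg R[U]} -> U} :=
  malg_lift (id : U -> U).

Fixpoint syzygy (n : nat) : lmodType R :=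
  if n is m.+1 then kernel (free_cover (syzygy m)) else M.

Definition free_res_mod (n : nat) : lmodType R := {malg R[syzygy n]}.

Definition free_res_diff (n : nat) : {linear free_res_mod n.+1 -> free_res_mod n} :=
  (val : syzygy n.+1 -> free_res_mod n) \o free_cover (syzygy n.+1).

Lemma free_cover_surj U m : exists x, free_cover U x = m.
Proof. by exists << m >>; exact: (malg_liftU (id : U -> U) m). Qed.

Lemma free_res_exact_aux n (x : free_res_mod n) :
  free_cover (syzygy n) x = 0 <-> exists y, free_res_diff n y = x.
Proof.
split=> [x0|[y <-]].
  have kx : x \in kernel_pred (free_cover (syzygy n)) by apply/eqP.
  have [y yx] := @free_cover_surj (syzygy n.+1) (exist _ x kx).
  by exists y; rewrite /free_res_diff /= [malg_lift _ _]yx.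
exact/eqP/(valP (free_cover (syzygy n.+1) y)).
Qed.

Lemma free_res_exact n (x : free_res_mod n.+1) :
  free_res_diff n x = 0 <-> exists y, free_res_diff n.+1 y = x.
Proof.
rewrite -free_res_exact_aux; split=> [x0|]; first exact: val_inj.
by move=> x0; rewrite /free_res_diff /= [malg_lift _ _]x0.
Qed.

Lemma proj_resolution_exists : inhabited (proj_resolution M).
Proof.
exists; apply: (@ProjResolution K R M free_res_mod free_res_diff (free_cover M)).
- by move=> n; apply: free_projective.
- exact: free_cover_surj.
- exact: (@free_res_exact_aux 0).
- exact: free_res_exact.
Qed.

End FreeResolution.

(* dim_K Ext^n_R(M, N) = d, with Ext computed from any projective resolution of
   M; one exists by proj_resolution_exists. *)
Definition Ext_dim (K : comNzRingType) (R : algType K) (M N : lmodType R) (n d : nat) :=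
  forall P : proj_resolution M, cohomology_dim P N n d.

Definition HH_dim (K : comNzRingType) (A : algType K) (n d : nat) :=
  @Ext_dim K (enveloping A) (bimod A) (bimod A) n d.

(* Main.v *)
(* The Hochschild cohomology is read off an explicit minimal bimodule resolution
   P3 -> P2 -> P1 -> P0 -> A -> 0, extended arbitrarily to the left; by the
   comparison theorem every projective resolution gives the same dimensions.
   The algebra A has the basis e1, alpha, alpha^2, alpha^3, sigma, alpha sigma,
   e2, beta, beta^2, beta^3, gamma, gamma alpha, because the relations force
   (1 - lambda)^2 alpha^2 sigma = alpha^4 sigma = 0 and similarly
   gamma alpha^2 = 0.  Exactness follows from a right A-linear homotopy which
   contracts the complex up to a nilpotent error.  Applying Hom(-, A) gives
   cochain spaces of dimensions 8, 12, 12, 8 with differentials of ranks 2, 6, 2,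
   whose cohomology has dimensions 8 - 2 = 6, 12 - 2 - 6 = 4 and 12 - 6 - 2 = 4;
   the basis classes are again certified by a contracting homotopy.
   All coefficients are polynomials in lambda over the two-element field, so
   these finitely many identities are checked by computation on lists. *)
Require Import Defs.
From HB Require Import structures.
From mathcomp Require Import all_boot all_order all_algebra.
From mathcomp Require Import finmap monalg boolp.

Set Implicit Arguments.
Unset Strict Implicit.
Unset Printing Implicit Defensive.

Import GRing.Theory.
Local Open Scope ring_scope.

(** * Independence of the projective resolution *)

(** [HH_dim] quantifies over all projective resolutions; once these are compared, only the explicit
    one matters. To make it computable, its terms in degrees at most 3 are sums of left ideals of
    the enveloping algebra cut out by idempotents, and its differentials are matrices acting from
    the right, so an identity between maps becomes an identity between lists of indices.
    Coefficients stay in F_2[lambda], where one cannot divide: homotopies are multiplied by a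
    polynomial, which is inverted only at the end. For the resolution this is lambda (1 + lambda),
    nonzero by the two conditions on lambda; for the cochains it is lambda, the pivot in gamma sigma
    = lambda beta^2. The obstacle to exactness is that alpha^2 = sigma gamma + alpha^3 is not
    homogeneous: a homotopy built for the graded relation misses by terms of greater path length,
    and iterating the error a bounded number of times gives zero. At P0 there is no error, since
    [h0] is the Fox derivative of the basis paths. The relation alpha^4 contributes no generator to
    P2: by exactness at P1 its Fox derivative is a combination of the other four. *)

Section Comparison.
Variables (K : comNzRingType) (R : algType K).

(** [projective] lifts along surjections only. When the image of f merely lies in the image of g,
    the pullback of f and g surjects onto P, and a section of that surjection followed by the
    projection to U is the lift. *)
Lemma projective_lift (P U V : lmodType R) (g : {linear U -> V})
    (f : {linear P -> V}) : projective P -> (forall x, exists u, g u = f x) ->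
  exists h : {linear P -> U}, forall x, g (h x) = f x.
Proof.
move=> projP fg.
pose W := kernel ((f \o fst) \- (g \o snd) : {linear (P * U)%type -> V}).
pose p1 : {linear W -> P} := fst \o (val : W -> (P * U)%type).
pose p2 : {linear W -> U} := snd \o (val : W -> (P * U)%type).
have p12 w : g (p2 w) = f (p1 w).
  by apply/esym/eqP; rewrite -subr_eq0; exact: (valP w).
have [x|h hE] := projP W P p1 idfun.
  have [u gu] := fg x.
  have kx : (x, u) \in kernel_pred ((f \o fst) \- (g \o snd) : {linear (P * U)%type -> V}).
    by rewrite unfold_in /= gu subrr.
  by exists (exist _ (x, u) kx).
by exists (p2 \o h) => x /=; rewrite p12 hE.
Qed.

Section ChainMap.
Variables (M : lmodType R) (P Q : proj_resolution M).

(** Counting the augmentation as the differential out of degree 0 lets one exactness statement serve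
    all degrees. *)
Definition is_cycle (P : proj_resolution M) n : res_mod P n -> Prop :=
  match n with 0 => fun x => res_aug P x = 0 | m.+1 => fun x => res_diff P m x = 0 end.

Lemma is_cycleP (P' : proj_resolution M) n (x : res_mod P' n) :
  is_cycle x <-> exists y, res_diff P' n y = x.
Proof. by case: n x => [|n] x; [exact: res_exact0 | exact: res_exact]. Qed.

(** Preservation of cycles is bundled with the map because it is what the next step of the recursion
    needs in order to lift. *)
Definition cycle_map n :=
  {f : {linear res_mod P n -> res_mod Q n} | forall x, is_cycle x -> is_cycle (f x)}.

Lemma chain_map0 : {f : cycle_map 0 | forall x, res_aug Q (sval f x) = res_aug P x}.
Proof.
have [x|f fE] := cid (projective_lift (g := res_aug Q) (f := res_aug P) (@res_proj _ _ _ P 0) _).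
  exact: res_aug_surj.
have fC x : is_cycle x -> is_cycle (f x) by rewrite /is_cycle fE.
by exists (exist _ f fC) => x /=.
Qed.

Lemma chain_mapS n (f : cycle_map n) :
  {f' : cycle_map n.+1 | forall x, res_diff Q n (sval f' x) = sval f (res_diff P n x)}.
Proof.
case: f => f fC /=.
have [x|f' f'E] := cid (projective_lift (g := res_diff Q n) (f := f \o res_diff P n)
   (@res_proj _ _ _ P n.+1) _).
  by apply/is_cycleP/fC/is_cycleP; exists x.
have f'C x : is_cycle x -> is_cycle (f' x) by rewrite /is_cycle f'E /= => ->; rewrite raddf0.
by exists (exist _ f' f'C).
Qed.

Fixpoint chain_map_rec n : cycle_map n :=
  match n with 0 => sval chain_map0 | m.+1 => sval (chain_mapS (chain_map_rec m)) end.

Definition chain_map n : {linear res_mod P n -> res_mod Q n} := sval (chain_map_rec n).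

Lemma chain_map_aug x : res_aug Q (chain_map 0 x) = res_aug P x.
Proof. by rewrite /chain_map /=; case: chain_map0. Qed.

Lemma chain_map_diff n x :
  res_diff Q n (chain_map n.+1 x) = chain_map n (res_diff P n x).
Proof. by rewrite /chain_map /=; case: chain_mapS. Qed.

End ChainMap.

Lemma res_diff_diff (M : lmodType R) (P : proj_resolution M) n x :
  res_diff P n (res_diff P n.+1 x) = 0.
Proof. by apply/res_exact; exists x. Qed.

Section Homotopy.
Variables (M : lmodType R) (P : proj_resolution M) (N : lmodType R).
Variable e : forall n, {linear res_mod P n -> res_mod P n}.
Hypothesis e_aug : forall x, res_aug P (e 0 x) = res_aug P x.
Hypothesis e_diff : forall n x, res_diff P n (e n.+1 x) = e n (res_diff P n x).

(** Only half of the homotopy identity is kept: the remainder is a cycle, hence a boundary by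
    exactness, and a cocycle vanishes on it. The induction thus carries one map at a time. *)
Lemma chain_homotopy n : exists h : {linear res_mod P n -> res_mod P n.+1},
  forall x, res_diff P n (e n.+1 x - x - h (res_diff P n x)) = 0.
Proof.
elim: n => [|n [h hE]].
  have [x|h hE] := projective_lift (g := res_diff P 0) (f := e 0 \- idfun) (@res_proj _ _ _ P 0).
    by apply/res_exact0; rewrite /= raddfB /= e_aug subrr.
  by exists h => x; rewrite !raddfB /= hE e_diff subrr.
have [x|h' h'E] := projective_lift (g := res_diff P n.+1)
    (f := (e n.+1 \- idfun) \- (h \o res_diff P n)) (@res_proj _ _ _ P n.+1).
  by apply/res_exact; rewrite /= hE.
exists h' => x; rewrite !raddfB /= h'E /= e_diff res_diff_diff raddf0 subr0 subrr.
by [].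
Qed.

Lemma cocycle_homotopy n (f : {linear res_mod P n -> N}) :
  cocycle (P := P) f -> coboundary (fun x => f (e n x) - f x).
Proof.
case: n f => [|n] f fZ /=.
  move=> x; rewrite -raddfB /=; have [|y <-] := (res_exact0 (e 0 x - x)).1 _.
    by rewrite raddfB /= e_aug subrr.
  exact: fZ.
have [h hE] := chain_homotopy n; exists (f \o h) => x /=.
apply/eqP; rewrite -!raddfB -subr_eq0 -raddfB /=; apply/eqP.
by have [y <-] := (res_exact _).1 (hE x); exact: fZ.
Qed.

End Homotopy.

Section Coboundary.
Variables (M : lmodType R) (P : proj_resolution M) (N : lmodType R) (n : nat).

Lemma eq_coboundary (f g : res_mod P n -> N) : f =1 g -> coboundary f -> coboundary g.
Proof.
case: n f g => [|m] f g fg /=; first by move=> f0 x; rewrite -fg f0.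
by case=> h hE; exists h => x; rewrite -fg.
Qed.

Lemma coboundaryB (f g : res_mod P n -> N) :
  coboundary f -> coboundary g -> coboundary (fun x => f x - g x).
Proof.
case: n f g => [|m] f g /=; first by move=> f0 g0 x; rewrite f0 g0 subr0.
by case=> h hE [k kE]; exists (h \- k) => x /=; rewrite hE kE.
Qed.

Lemma coboundary_comp (Q : proj_resolution M) (g : forall n, {linear res_mod Q n -> res_mod P n})
    (f : res_mod P n -> N) :
  (forall n x, res_diff P n (g n.+1 x) = g n (res_diff Q n x)) ->
  coboundary f -> coboundary (fun x => f (g n x)).
Proof.
move=> gE; case: n f => [|m] f /=; first by move=> f0 x.
by case=> h hE; exists (h \o g m) => x /=; rewrite hE gE.
Qed.

End Coboundary.

Definition lincomb (U N : lmodType R) d (c : 'I_d -> K) (b : 'I_d -> {linear U -> N}) x :=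
  \sum_(i < d) (c i)%:A *: b i x.

Lemma scalar_commute (c : K) (r : R) : c%:A * r = r * c%:A.
Proof. by rewrite -scalerAl mul1r -scalerAr mulr1. Qed.

Lemma lincomb_is_linear (U N : lmodType R) d (c : 'I_d -> K) (b : 'I_d -> {linear U -> N}) :
  linear (lincomb c b).
Proof.
move=> r x y; rewrite /lincomb scaler_sumr -big_split; apply: eq_bigr => i _ /=.
by rewrite linearP scalerDr !scalerA scalar_commute.
Qed.

HB.instance Definition _ (U N : lmodType R) d (c : 'I_d -> K) (b : 'I_d -> {linear U -> N}) :=
  GRing.isLinear.Build R U N *:%R (lincomb c b) (lincomb_is_linear c b).

(** Classes are pulled back along [g] from Q to P. They span because [f] after [g] is homotopic to
    the identity of Q, and are independent because [g] after [f] is homotopic to the identity of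
    P. *)
Theorem cohomology_dim_indep (M N : lmodType R) (P Q : proj_resolution M) n d :
  cohomology_dim P N n d -> cohomology_dim Q N n d.
Proof.
case=> b [bZ bS bI].
pose f := chain_map P Q; pose g := chain_map Q P.
have gE m x : res_diff P m (g m.+1 x) = g m (res_diff Q m x) by exact: chain_map_diff.
have fE m x : res_diff Q m (f m.+1 x) = f m (res_diff P m x) by exact: chain_map_diff.
exists (fun i => b i \o g n); split=> [i x|h hZ|c cB].
- by rewrite /= -gE; apply: bZ.
- have [|c cP] := bS (h \o f n); first by move=> x /=; rewrite -fE; apply: hZ.
  exists c.
  have e0 x : res_aug Q ((f 0 \o g 0) x) = res_aug Q x by rewrite /= !chain_map_aug.
  have eS m x : res_diff Q m ((f m.+1 \o g m.+1) x) = (f m \o g m) (res_diff Q m x).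
    by rewrite /= fE gE.
  have eB := @cocycle_homotopy M Q N (fun m => f m \o g m) e0 eS n h hZ.
  have := coboundaryB (coboundary_comp gE cP) eB.
  apply: eq_coboundary => x /=.
  by rewrite opprB addrC addrA subrK.
- apply: bI; pose h := lincomb c b.
  have hZ : cocycle (P := P) h.
    by move=> x; apply: big1 => i _; rewrite bZ scaler0.
  have e0 x : res_aug P ((g 0 \o f 0) x) = res_aug P x by rewrite /= !chain_map_aug.
  have eS m x : res_diff P m ((g m.+1 \o f m.+1) x) = (g m \o f m) (res_diff P m x).
    by rewrite /= gE fE.
  have eB := @cocycle_homotopy M P N (fun m => g m \o f m) e0 eS n h hZ.
  have := coboundaryB (coboundary_comp fE cB) eB.
  by apply: eq_coboundary => x /=; rewrite opprB addrC subrK.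
Qed.

End Comparison.

(** * Completing an exact sequence to a projective resolution *)

Section TruncatedResolution.
Variables (K : comNzRingType) (R : algType K) (M Q0 Q1 Q2 Q3 : lmodType R).
Variables (aug : {linear Q0 -> M}) (d0 : {linear Q1 -> Q0}).
Variables (d1 : {linear Q2 -> Q1}) (d2 : {linear Q3 -> Q2}).
Hypotheses (proj0 : projective Q0) (proj1 : projective Q1).
Hypotheses (proj2 : projective Q2) (proj3 : projective Q3).
Hypothesis aug_surj : forall m, exists x, aug x = m.
Hypothesis exact0 : forall x, aug x = 0 <-> exists y, d0 y = x.
Hypothesis exact1 : forall x, d0 x = 0 <-> exists y, d1 y = x.
Hypothesis exact2 : forall x, d1 x = 0 <-> exists y, d2 y = x.

Definition extended_mod n : lmodType R :=
  match n with
  | 0 => Q0 | 1 => Q1 | 2 => Q2 | 3 => Q3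
  | m.+4 => free_res_mod (kernel d2) m
  end.

Definition extended_diff n : {linear extended_mod n.+1 -> extended_mod n} :=
  match n with
  | 0 => d0 | 1 => d1 | 2 => d2
  | 3 => (val : kernel d2 -> Q3) \o free_cover (kernel d2)
  | m.+4 => free_res_diff (kernel d2) m
  end.

(** Left transparent, so that the modules and differentials in low degrees reduce to the given
    ones. *)
Definition extended_resolution : proj_resolution M.
Proof.
apply: (@ProjResolution K R M extended_mod extended_diff aug) => //.
- by case=> [|[|[|[|n]]]] //; exact: free_projective.
- case=> [|[|[|[|n]]]] //= x.
  + split=> [x0|[y <-]]; last exact/eqP/(valP (free_cover (kernel d2) y)).
    have kx : x \in kernel_pred d2 by apply/eqP.
    have [y yx] := free_cover_surj (exist _ x kx : kernel d2).
    by exists y; rewrite yx.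
  + rewrite -(@free_res_exact_aux K R (kernel d2) 0); split=> [x0|-> //].
    exact: val_inj.
  + exact: free_res_exact.
Defined.

End TruncatedResolution.

(** * Direct sums of left ideals generated by idempotents *)

Section Summand.
Variables (K : comNzRingType) (R : algType K).
Implicit Type T : finType.

(** Right multiplication by 1 - e turns the condition v e = v into membership in a kernel, which
    inherits a module structure. *)
Definition complement_map (T : finType) (e : T -> R) (v : {ffun T -> R^o}) :
  {ffun T -> R^o} := [ffun t => v t * (1 - e t)].

Lemma complement_map_is_linear T e : linear (@complement_map T e).
Proof. by move=> c v w; apply/ffunP=> t; rewrite !ffunE mulrDl scalerAl. Qed.

HB.instance Definition _ T e := GRing.isLinear.Build R {ffun T -> R^o} {ffun T -> R^o}
  *:%R (@complement_map T e) (@complement_map_is_linear T e).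

(* For idempotents e_t this is the direct sum of the left ideals R e_t. *)
Definition summand (T : finType) (e : T -> R) : lmodType R := kernel (@complement_map T e).

Lemma in_summand T (e : T -> R) (v : {ffun T -> R^o}) :
  (forall t, v t * e t = v t) -> v \in kernel_pred (@complement_map T e).
Proof.
by move=> ve; apply/eqP/ffunP => t; rewrite !ffunE mulrBr mulr1 ve subrr.
Qed.

Definition to_summand T (e : T -> R) (v : {ffun T -> R^o})
  (ve : forall t, v t * e t = v t) : summand e :=
  exist _ v (in_summand ve).

Lemma summandP T (e : T -> R) (v : summand e) t : val v t * e t = val v t.
Proof.
have /eqP/ffunP/(_ t) := valP v; rewrite !ffunE mulrBr mulr1 => /eqP.
by rewrite subr_eq0 => /eqP.
Qed.

Section Hom.
Variables (T : finType) (e : T -> R) (X : lmodType R).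

Definition summand_hom (x : T -> X) (v : summand e) : X := \sum_t val v t *: x t.

Lemma summand_hom_is_linear x : linear (summand_hom x).
Proof.
move=> c v w; rewrite /summand_hom scaler_sumr -big_split; apply: eq_bigr => t _ /=.
by rewrite !ffunE scalerDl scalerA.
Qed.

HB.instance Definition _ x := GRing.isLinear.Build R (summand e) X *:%R
  (summand_hom x) (summand_hom_is_linear x).

Hypothesis e_idem : forall t, e t * e t = e t.

Definition gen_fun t : {ffun T -> R^o} := [ffun u => if u == t then e t else 0].

Lemma gen_subproof t : forall u, gen_fun t u * e u = gen_fun t u.
Proof. by move=> u; rewrite ffunE; case: eqP => [->|_]; rewrite ?mul0r. Qed.

Definition summand_gen t : summand e := to_summand (gen_subproof t).

Lemma summand_genE (v : summand e) : v = \sum_t val v t *: summand_gen t.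
Proof.
apply: val_inj; apply/ffunP => u; rewrite raddf_sum /= sum_ffunE (bigD1 u) //=.
rewrite !ffunE eqxx [_ *: _]summandP big1 ?addr0 // => t tu.
by rewrite !ffunE eq_sym (negPf tu) scaler0.
Qed.

Lemma hom_summand (f : {linear summand e -> X}) v :
  f v = summand_hom (fun t => f (summand_gen t)) v.
Proof.
by rewrite {1}[v]summand_genE linear_sum; apply: eq_bigr => t _; rewrite linearZ.
Qed.

Lemma summand_hom_gen x t : summand_hom x (summand_gen t) = e t *: x t.
Proof.
rewrite /summand_hom (bigD1 t) //= ffunE eqxx big1 ?addr0 // => u ut.
by rewrite ffunE (negPf ut) scale0r.
Qed.

Lemma summand_gen_fixed t : e t *: summand_gen t = summand_gen t.
Proof.
apply: val_inj; apply/ffunP => u; rewrite !ffunE.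
by case: eqP => _; rewrite ?scaler0 // [_ *: _]e_idem.
Qed.

End Hom.

(** [summand_hom] accepts arbitrary values, so any preimages of the images of the generators define
    the lift. *)
Lemma summand_projective T (e : T -> R) :
  (forall t, e t * e t = e t) -> projective (summand e).
Proof.
move=> e_idem U V g f g_surj.
have /choice[u ug] t : exists x, g x = f (summand_gen e_idem t) by exact: g_surj.
exists (summand_hom u) => v; rewrite [RHS](hom_summand e_idem) linear_sum.
by apply: eq_bigr => t _; rewrite linearZ /= ug.
Qed.

Section MatrixMap.
Variables (T T' : finType) (e : T -> R) (e' : T' -> R) (D : T -> T' -> R).

Definition rowmul (v : {ffun T -> R^o}) : {ffun T' -> R^o} :=
  [ffun u => \sum_t v t * D t u].

Hypothesis De : forall t u, D t u * e' u = D t u.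

Lemma rowmul_summand v t : rowmul v t * e' t = rowmul v t.
Proof. by rewrite ffunE mulr_suml; apply: eq_bigr => u _; rewrite -mulrA De. Qed.

Definition summand_map (v : summand e) : summand e' :=
  to_summand (rowmul_summand (val v)).

Lemma summand_map_is_linear : linear summand_map.
Proof.
move=> c v w; apply: val_inj; apply/ffunP => u; rewrite !ffunE scaler_sumr -big_split.
by apply: eq_bigr => t _; rewrite !ffunE mulrDl scalerAl.
Qed.

HB.instance Definition _ := GRing.isLinear.Build R (summand e) (summand e') *:%R
  summand_map summand_map_is_linear.

End MatrixMap.

End Summand.

(** * Linear combinations with coefficients in F_2[lambda] *)

(* [seq bool] stands for a polynomial over the two-element field, constant
   coefficient first. *)
Definition coef := seq bool.

Fixpoint cadd (p q : coef) : coef :=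
  match p, q with
  | [::], _ => q
  | _, [::] => p
  | a :: p', b :: q' => (a (+) b) :: cadd p' q'
  end.

Fixpoint cmul (p q : coef) : coef :=
  if p is a :: p' then cadd (if a then q else [::]) (false :: cmul p' q) else [::].

Definition czero (p : coef) := all negb p.

(* A formal linear combination of indices, as a list of terms in which an index
   may occur several times. *)
Definition lin (I : Type) := seq (coef * I).

Definition lone I (i : I) : lin I := [:: ([:: true], i)].

Definition lscale I (c : coef) (x : lin I) : lin I := [seq (cmul c t.1, t.2) | t <- x].

Definition lbind I J (f : I -> lin J) (x : lin I) : lin J :=
  flatten [seq lscale t.1 (f t.2) | t <- x].

Fixpoint linsert (I : eqType) (c : coef) (i : I) (x : lin I) : lin I :=
  if x is (d, j) :: x' then
    if i == j then let s := cadd c d in if czero s then x' else (s, j) :: x'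
    else (d, j) :: linsert c i x'
  else if czero c then [::] else [:: (c, i)].

Definition lnorm (I : eqType) (x : lin I) : lin I := foldr (fun t => linsert t.1 t.2) [::] x.

Section Evaluation.
Variables (K : fieldType) (char2 : 2%N \in [pchar K]) (lam : K).

Fixpoint cev (p : coef) : K := if p is a :: p' then a%:R + lam * cev p' else 0.

Lemma cevD p q : cev (cadd p q) = cev p + cev q.
Proof.
elim: p q => [|a p IHp] [|b q] /=; rewrite ?add0r ?addr0 //.
rewrite IHp mulrDr addrACA; congr (_ + _); case: a b => [] [] //=;
  by rewrite ?addr0 ?add0r ?(addrr_pchar2 char2).
Qed.

Lemma cevM p q : cev (cmul p q) = cev p * cev q.
Proof.
elim: p => [|a p IHp] /=; first by rewrite mul0r.
rewrite cevD /= IHp add0r mulrDl mulrA; congr (_ + _).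
by case: a; rewrite ?mul1r ?mul0r.
Qed.

Lemma czeroP p : czero p -> cev p = 0.
Proof. by elim: p => //= -[] // p IHp /IHp ->; rewrite mulr0 add0r. Qed.

Section Module.
Variables (V : lmodType K).

Definition lev (I : Type) (b : I -> V) (x : lin I) : V := \sum_(t <- x) cev t.1 *: b t.2.

Lemma lev_nil I (b : I -> V) : lev b [::] = 0. Proof. exact: big_nil. Qed.

Lemma lev_cons I (b : I -> V) t x : lev b (t :: x) = cev t.1 *: b t.2 + lev b x.
Proof. exact: big_cons. Qed.

Lemma lev_cat I (b : I -> V) x y : lev b (x ++ y) = lev b x + lev b y.
Proof. exact: big_cat. Qed.

Lemma lev_one I (b : I -> V) i : lev b (lone i) = b i.
Proof. by rewrite lev_cons lev_nil /= mulr0 !addr0 scale1r. Qed.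

Lemma lev_pair I (b : I -> V) i j : lev b (lone i ++ lone j) = b i + b j.
Proof. by rewrite lev_cat !lev_one. Qed.

Lemma lev_scale I (b : I -> V) c x : lev b (lscale c x) = cev c *: lev b x.
Proof.
by rewrite /lev big_map scaler_sumr; apply: eq_bigr => t _; rewrite cevM scalerA.
Qed.

Lemma lev_bind I J (b : J -> V) (f : I -> lin J) x :
  lev b (lbind f x) = lev (fun i => lev b (f i)) x.
Proof.
elim: x => [|t x IHx]; first by rewrite !lev_nil.
by rewrite /lbind /= lev_cat -/(lbind f x) IHx lev_cons lev_scale.
Qed.

Lemma eq_lev I (b b' : I -> V) x : b =1 b' -> lev b x = lev b' x.
Proof. by move=> bb; apply: eq_bigr => t _; rewrite bb. Qed.

Lemma lev_insert (I : eqType) (b : I -> V) c i x :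
  lev b (linsert c i x) = cev c *: b i + lev b x.
Proof.
elim: x => [|[d j] x IHx] /=.
  by case: ifP => [/czeroP -> | _]; rewrite ?lev_cons lev_nil ?scale0r ?addr0.
case: eqP => [->|_]; last by rewrite !lev_cons IHx addrCA.
by case: ifP => [/czeroP|_]; rewrite !lev_cons /= cevD addrA -scalerDl // => ->;
  rewrite scale0r add0r.
Qed.

Lemma lev_norm (I : eqType) (b : I -> V) x : lev b (lnorm x) = lev b x.
Proof. by elim: x => //= t x IHx; rewrite lev_insert IHx lev_cons. Qed.

Lemma lev_nilp (I : eqType) (b : I -> V) x : nilp (lnorm x) -> lev b x = 0.
Proof. by rewrite -lev_norm => /nilP ->; rewrite lev_nil. Qed.

(** In characteristic 2 concatenation also computes differences. *)
Lemma lev_eq (I : eqType) (b : I -> V) x y : nilp (lnorm (x ++ y)) -> lev b x = lev b y.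
Proof.
move=> /(lev_nilp b); rewrite lev_cat => /eqP; rewrite addr_eq0 => /eqP ->.
by rewrite -scaleN1r (oppr_pchar2 char2) scale1r.
Qed.

End Module.

Lemma lev_linear (V W : lmodType K) (f : {linear V -> W}) I (b : I -> V) x :
  f (lev b x) = lev (f \o b) x.
Proof. by rewrite linear_sum; apply: eq_bigr => t _; rewrite linearZ. Qed.

Section LinearExtension.
Variables (I : finType) (J : Type) (V : lmodType K) (b : J -> V) (L : I -> lin J).

Definition lop (w : {ffun I -> K^o}) : V := \sum_i w i *: lev b (L i).

Lemma lop_is_linear : linear lop.
Proof.
move=> c w w'; rewrite /lop scaler_sumr -big_split; apply: eq_bigr => i _ /=.
by rewrite !ffunE scalerDl scalerA.
Qed.

HB.instance Definition _ := GRing.isLinear.Build K {ffun I -> K^o} V *:%R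
  lop lop_is_linear.

End LinearExtension.

Lemma lop_linear (V W : lmodType K) (f : {linear V -> W}) (I : finType) J (b : J -> V)
  (L : I -> lin J) w : f (lop b L w) = lop (f \o b) L w.
Proof. by rewrite linear_sum; apply: eq_bigr => i _; rewrite linearZ lev_linear. Qed.

End Evaluation.

Section Basis.
Variables (K : fieldType) (char2 : 2%N \in [pchar K]) (lam : K).

Record module_basis (V : lmodType K) (I : finType) := ModuleBasis {
  bas :> I -> V;
  bcoord : {linear V -> {ffun I -> K^o}};
  coord_bas : forall j i, bcoord (bas j) i = (i == j)%:R;
  bas_coord : forall v, v = \sum_i bcoord v i *: bas i
}.

Arguments bcoord {V I} m.

Lemma lop_bas (V W : lmodType K) (I : finType) (J : Type) (b : module_basis V I) (c : J -> W) L i :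
  lop lam c L (bcoord b (b i)) = lev lam c (L i).
Proof.
rewrite /lop (bigD1 i) //= coord_bas eqxx scale1r big1 ?addr0 // => j ji.
by rewrite coord_bas (negPf ji) scale0r.
Qed.

Lemma eq_linear_bas (V W : lmodType K) (I : finType) (b : module_basis V I)
  (f g : {linear V -> W}) : (forall i, f (b i) = g (b i)) -> forall v, f v = g v.
Proof.
move=> fg v; rewrite (bas_coord b v) !linear_sum; apply: eq_bigr => i _.
by rewrite !linearZ /= fg.
Qed.

Section RowBasis.
Variables (V : lmodType K) (I T : finType) (b : module_basis V I).

Definition row_bas (x : T * I) : {ffun T -> V} := [ffun u => if u == x.1 then b x.2 else 0].

Definition row_coord (v : {ffun T -> V}) : {ffun T * I -> K^o} :=
  [ffun x => bcoord b (v x.1) x.2].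

Lemma row_coord_is_linear : linear row_coord.
Proof. by move=> c v w; apply/ffunP => x; rewrite !ffunE linearP !ffunE. Qed.

HB.instance Definition _ := GRing.isLinear.Build K {ffun T -> V} {ffun T * I -> K^o} *:%R
  row_coord row_coord_is_linear.

Lemma row_coord_bas y x : row_coord (row_bas y) x = (x == y)%:R.
Proof.
rewrite !ffunE; case: x y => [t i] [u j] /=; rewrite xpair_eqE.
by case: eqP => _; rewrite ?coord_bas // linear0 ffunE.
Qed.

Lemma row_bas_coord v : v = \sum_x row_coord v x *: row_bas x.
Proof.
apply/ffunP => u; rewrite sum_ffunE.
transitivity (\sum_t \sum_i (row_coord v (t, i) *: row_bas (t, i)) u); last first.
  by rewrite pair_bigA /=; apply: eq_bigr => -[t i].
rewrite (bigD1 u) //= [X in _ + X]big1 ?addr0 => [|t tu].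
  by rewrite [LHS](bas_coord b); apply: eq_bigr => i _; rewrite !ffunE eqxx.
by apply: big1 => i _; rewrite !ffunE eq_sym (negPf tu) scaler0.
Qed.

Definition row_basis : module_basis {ffun T -> V} (T * I)%type :=
  ModuleBasis row_coord_bas row_bas_coord.

End RowBasis.

Definition mult_table (A : algType K) (I : finType) (b : module_basis A I) (mt : I -> I -> lin I) :=
  forall i j, b i * b j = lev lam b (mt i j).

End Basis.
Arguments bcoord {K V I} m.

(** * The enveloping algebra of an algebra with a basis *)

Section QuotientLinear.
Variables (K : comNzRingType) (B : algType K) (S : B -> Prop).

Lemma quot_piZE c x : quot_pi S (c *: x) = c *: quot_pi S x.
Proof. by rewrite -quot_piZ. Qed.

Lemma quot_piME x y : quot_pi S (x * y) = quot_pi S x * quot_pi S y.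
Proof. by rewrite -quot_piM. Qed.

Lemma quot_eq x y : S (x - y) -> quot_pi S x = quot_pi S y.
Proof. by move=> Sxy; apply/quot_piP/mem_gen_ideal. Qed.

Lemma quot_pi_is_linear : linear (quot_pi S).
Proof. by move=> c x y; rewrite quot_piD quot_piZE. Qed.

HB.instance Definition _ := GRing.isLinear.Build K B (alg_quot S) *:%R
  (quot_pi S) quot_pi_is_linear.

Variables (V : lmodType K) (f : {linear B -> V}).
Hypothesis fI : forall x, x \in gen_ideal S -> f x = 0.

Definition quot_lift_fun (u : alg_quot S) : V := f (repr u).

Lemma quot_lift_fun_pi x : quot_lift_fun (quot_pi S x) = f x.
Proof. by apply/eqP; rewrite -subr_eq0 -linearB fI //; exact: quot_reprP. Qed.

Lemma quot_lift_is_linear : linear quot_lift_fun.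
Proof.
move=> c u v; rewrite -(quot_repr u) -(quot_repr v) -linearP !quot_lift_fun_pi.
exact: linearP.
Qed.

Definition quot_lift : {linear alg_quot S -> V} :=
  HB.pack quot_lift_fun
    (GRing.isLinear.Build K (alg_quot S) V *:%R quot_lift_fun quot_lift_is_linear).

Lemma quot_lift_pi x : quot_lift (quot_pi S x) = f x.
Proof. exact: quot_lift_fun_pi. Qed.

End QuotientLinear.

Section Tensor.
Variables (K : comNzRingType) (A : algType K).

Lemma tensorDl (x x' y : A) : tensor (x + x') y = tensor x y + tensor x' y.
Proof. by rewrite /tensor -quot_piD; apply/quot_eq/TensorDl. Qed.

Lemma tensorDr (x y y' : A) : tensor x (y + y') = tensor x y + tensor x y'.
Proof. by rewrite /tensor -quot_piD; apply/quot_eq/TensorDr. Qed.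

Lemma tensorZl c (x y : A) : tensor (c *: x) y = c *: tensor x y.
Proof. by rewrite /tensor -[RHS]quot_piZE; apply/quot_eq/TensorZl. Qed.

Lemma tensorZr c (x y : A) : tensor x (c *: y) = c *: tensor x y.
Proof. by rewrite /tensor -[RHS]quot_piZE; apply/quot_eq/TensorZr. Qed.

Lemma tensor_linl (y : A) : linear (fun x => tensor x y).
Proof. by move=> c x x'; rewrite tensorDl tensorZl. Qed.

Lemma tensor_linr (x : A) : linear (tensor x).
Proof. by move=> c y y'; rewrite tensorDr tensorZr. Qed.

HB.instance Definition _ x := GRing.isLinear.Build K A (enveloping A) *:%R
  (tensor x) (tensor_linr x).

Definition tensorr (y x : A) := tensor x y.

HB.instance Definition _ y := GRing.isLinear.Build K A (enveloping A) *:%R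
  (tensorr y) (tensor_linl y).

Lemma enveloping_ind (P : enveloping A -> Prop) :
  P 0 -> (forall c x y r, P r -> P (c *: tensor x y + r)) -> forall r, P r.
Proof.
move=> P0 PD r; rewrite -(quot_repr r); elim/cat_ind: (repr r) => [|c [x y] t Pt].
  by rewrite linear0.
by rewrite linearP; apply: PD.
Qed.

Section TensorLift.
Variables (V : lmodType K) (phi : A -> A -> V).
Hypothesis phi_linl : forall y, linear (phi^~ y).
Hypothesis phi_linr : forall x, linear (phi x).

Definition tensor_lift_pre (t : cat_alg K (pair_monoid A)) : V :=
  malg_lift (fun p : (A^c * A)%type => phi p.1 p.2) t.

Lemma tensor_lift_pre_is_linear : linear tensor_lift_pre.
Proof. exact: malg_lift_is_linear. Qed.

HB.instance Definition _ := GRing.isLinear.Build K (cat_alg K (pair_monoid A)) V *:%R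
  tensor_lift_pre tensor_lift_pre_is_linear.

Lemma tensor_lift_preE x y : tensor_lift_pre (pure_tensor x y) = phi x y.
Proof. exact: (@cat_lift_basis K (pair_monoid A)). Qed.

(** The enveloping algebra is a quotient by a two-sided ideal while phi is only bilinear, so
    vanishing is tested on all products u * r * v with r a relation. For pure tensors u and v such a
    product expands to a bilinearity relation again. *)
Lemma tensor_lift_pre_ideal t :
  t \in gen_ideal (@tensor_rels K A) -> tensor_lift_pre t = 0.
Proof.
move=> /gen_idealP/(_ (fun t => forall u v, tensor_lift_pre (u * t * v) = 0)) It.
rewrite -[t]mul1r -[1 * t]mulr1; apply: It => {t}.
  split=> [u v|t t' t0 t0' u v|u t v t0 u' v'].
  - by rewrite mulr0 mul0r linear0.
  - by rewrite mulrDr mulrDl linearD /= t0 t0' addr0.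
  - by rewrite !mulrA -(mulrA _ v) t0.
move=> r r_rel u v.
have [PD PZ] : (forall x x' y, phi (x + x') y = phi x y + phi x' y) /\
    (forall c x y, phi (c *: x) y = c *: phi x y).
  split=> [x x' y|c x y]; first by rewrite -[x]scale1r phi_linl !scale1r.
  have p0 : phi 0 y = 0 by have := phi_linl y (-1) 0 0; rewrite scaler0 addr0 scaleN1r addNr.
  by rewrite -[c *: x]addr0 phi_linl p0 addr0.
have [DP ZP] : (forall x y y', phi x (y + y') = phi x y + phi x y') /\
    (forall c x y, phi x (c *: y) = c *: phi x y).
  split=> [x y y'|c x y]; first by rewrite -[y]scale1r phi_linr !scale1r.
  have p0 : phi x 0 = 0 by have := phi_linr x (-1) 0 0; rewrite scaler0 addr0 scaleN1r addNr.
  by rewrite -[c *: y]addr0 phi_linr p0 addr0.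
elim/cat_ind: u => [|a [u1 u2] u IHu]; first by rewrite !mul0r linear0.
rewrite !mulrDl linearD /= IHu addr0 -!scalerAl linearZ /= {IHu}.
suff -> : tensor_lift_pre (pure_tensor (u1 : A) u2 * r * v) = 0 by rewrite scaler0.
elim/cat_ind: v => [|{}a [v1 v2] v IHv]; first by rewrite !mulr0 linear0.
rewrite !mulrDr linearD /= IHv addr0 -!scalerAr linearZ /= {IHv}.
suff -> : tensor_lift_pre (pure_tensor (u1 : A) u2 * r * pure_tensor (v1 : A) v2) = 0.
  by rewrite scaler0.
case: r / r_rel => [x x' y|x y y'|c x y|c x y];
  rewrite mulrBr mulrBl ?(mulrDr, mulrDl) -?(scalerAr, scalerAl) !pure_tensorM;
  rewrite linearB ?linearD ?linearZ /= !tensor_lift_preE;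
  rewrite ?(mulrDr, mulrDl) -?(scalerAr, scalerAl) ?(PD, DP, PZ, ZP);
  rewrite -?opprD ?scalerN; exact: subrr.
Qed.

Definition tensor_lift : {linear enveloping A -> V} := quot_lift tensor_lift_pre_ideal.

Lemma tensor_liftE x y : tensor_lift (tensor x y) = phi x y.
Proof. by rewrite [LHS]quot_lift_pi /= tensor_lift_preE. Qed.

End TensorLift.

End Tensor.

Section TensorBasis.
Variables (K : fieldType) (A : algType K) (I : finType) (b : module_basis A I).

(* In A^op (x) A = A^e acting on bimodules, the pair (i, j) stands for the element
   acting as x |-> b_i x b_j, hence for b_i (x) b_j in a free bimodule. *)
Definition tensor_bas (p : I * I) : enveloping A := tensor (b p.2) (b p.1).

Definition tensor_coord_pre (x y : A) : {ffun I * I -> K^o} :=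
  [ffun p => bcoord b y p.1 * bcoord b x p.2].

Lemma tensor_coord_linl y : linear (tensor_coord_pre^~ y).
Proof.
by move=> c x x'; apply/ffunP => p; rewrite !ffunE linearP !ffunE mulrDr mulrCA.
Qed.

Lemma tensor_coord_linr x : linear (tensor_coord_pre x).
Proof.
by move=> c y y'; apply/ffunP => p; rewrite !ffunE linearP !ffunE mulrDl -mulrA.
Qed.

Definition tensor_coord := tensor_lift tensor_coord_linl tensor_coord_linr.

Arguments tensor_coord : simpl never.

Lemma tensor_coordE x y p : tensor_coord (tensor x y) p = bcoord b y p.1 * bcoord b x p.2.
Proof. by rewrite /tensor_coord tensor_liftE ffunE. Qed.

Lemma tensor_coord_bas q p : tensor_coord (tensor_bas q) p = (p == q)%:R.
Proof.
rewrite tensor_coordE !coord_bas -natrM mulnb.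
by case: p q => [i j] [k l].
Qed.

Lemma tensor_bas_coord r : r = \sum_p tensor_coord r p *: tensor_bas p.
Proof.
have [S SE] : exists S, forall r, S r = \sum_p tensor_coord r p *: tensor_bas p by eexists.
have SP c u v : S (c *: u + v) = c *: S u + S v.
  rewrite !SE scaler_sumr -big_split; apply: eq_bigr => p _.
  by rewrite linearP !ffunE scalerDl scalerA.
rewrite -SE; elim/enveloping_ind: r => [|c x y r IHr].
  by rewrite SE linear0; apply/esym/big1 => p _; rewrite ffunE scale0r.
rewrite SP -IHr.
apply: (congr1 (fun z => c *: z + r)).
rewrite SE.
rewrite {1}(bas_coord b x) {1}(bas_coord b y).
rewrite -[LHS]/(tensorr _ (\sum_(i | true) bcoord b x i *: b i)) linear_sum /=.
transitivity (\sum_i \sum_j tensor_coord (tensor x y) (i, j) *: tensor_bas (i, j)); last first.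
  by rewrite pair_bigA /=; apply: eq_bigr => -[].
rewrite exchange_big; apply: eq_bigr => j _ /=.
rewrite /tensorr linear_sum; apply: eq_bigr => i _ /=.
by rewrite tensor_coordE tensorZl linearZ scalerA mulrC.
Qed.

Definition tensor_basis : module_basis (enveloping A) (I * I)%type :=
  ModuleBasis tensor_coord_bas tensor_bas_coord.

(** The second components multiply in the opposite order because they act from the right. *)
Definition tensor_table (mt : I -> I -> lin I) (p q : I * I) : lin (I * I)%type :=
  lbind (fun m => lbind (fun n => lone (m, n)) (mt q.2 p.2)) (mt p.1 q.1).

Variables (lam : K) (char2 : 2%N \in [pchar K]) (mt : I -> I -> lin I).
Hypothesis mtE : mult_table lam b mt.

Lemma tensor_lev x y : tensor (lev lam b x) (lev lam b y) =
  lev lam (fun m => lev lam (fun n => tensor (b n) (b m)) x) y.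
Proof.
rewrite lev_linear; apply: eq_lev => m.
exact: (lev_linear lam (tensorr (b m)) b x).
Qed.

Lemma tensor_tableP : mult_table lam tensor_basis (tensor_table mt).
Proof.
move=> [i j] [k l].
transitivity (tensor (b l * b j) (b i * b k)); first exact: tensorM.
rewrite (mtE l j) (mtE i k) tensor_lev.
apply/esym; apply: etrans (lev_bind char2 _ _ _ _) _.
apply: eq_lev => m.
apply: etrans (lev_bind char2 _ _ _ _) _.
by apply: eq_lev => n; apply: lev_one.
Qed.

End TensorBasis.

(** * Complexes of projective modules over an algebra with a basis *)

Section RowOperators.
Variables (K : fieldType) (char2 : 2%N \in [pchar K]) (lam : K).
Variables (R : algType K) (P : finType) (b : module_basis R P).
Variables (mt : P -> P -> lin P) (mtE : mult_table lam b mt).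
Implicit Types T : finType.

Local Notation rlev := (lev lam (row_bas b)).

Definition row_entry T T' (D : T -> lin (T' * P)) t u : R := (rlev (D t) : {ffun T' -> R}) u.

Definition lin_mul T (p : P) (x : lin (T * P)) : lin (T * P) :=
  lbind (fun y => lbind (fun r => lone (y.1, r)) (mt p y.2)) x.

Definition row_op T T' (D : T -> lin (T' * P)) (x : T * P) := lin_mul x.2 (D x.1).

Lemma rlev_entry T (x : lin (T * P)) u :
  (rlev x : {ffun T -> R}) u = lev lam (fun y => if u == y.1 then b y.2 else 0) x.
Proof.
by rewrite /lev sum_ffunE; apply: eq_bigr => t _; rewrite !ffunE.
Qed.

Lemma mul_lev I (F : I -> R) a x : a * lev lam F x = lev lam (fun i => a * F i) x.
Proof. by rewrite mulr_sumr; apply: eq_bigr => t _; rewrite scalerAr. Qed.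

Lemma lev_mul I (F : I -> R) a x : lev lam F x * a = lev lam (fun i => F i * a) x.
Proof. by rewrite mulr_suml; apply: eq_bigr => t _; rewrite scalerAl. Qed.

Lemma rlev_mul T p (x : lin (T * P)) u : (rlev (lin_mul p x) : {ffun T -> R}) u =
  b p * (rlev x : {ffun T -> R}) u.
Proof.
rewrite !rlev_entry lev_bind // mul_lev; apply: eq_lev => -[t q] /=.
rewrite lev_bind //; case: eqP => [->|ut].
  by rewrite mtE; apply: eq_lev => r; rewrite lev_one eqxx.
by rewrite mulr0; apply: big1 => -[a r] _; rewrite lev_one /=; case: eqP => // _; rewrite scaler0.
Qed.

(** The map [rowmul] seen over K, where it can be combined with homotopies, which are not linear
    over R. *)
Definition rowmulK T T' (D : T -> T' -> R) (v : {ffun T -> R}) : {ffun T' -> R} := rowmul D v.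

Lemma rowmulK_is_linear T T' (D : T -> T' -> R) : linear (rowmulK D).
Proof.
move=> c v w; apply/ffunP => u; rewrite !ffunE scaler_sumr -big_split.
by apply: eq_bigr => t _ /=; rewrite !ffunE mulrDl scalerAl.
Qed.

HB.instance Definition _ T T' D := GRing.isLinear.Build K {ffun T -> R} {ffun T' -> R} *:%R
  (@rowmulK T T' D) (@rowmulK_is_linear T T' D).

Lemma rowmul_bas T T' (D : T -> lin (T' * P)) x :
  rowmulK (row_entry D) (row_bas b x) = rlev (row_op D x).
Proof.
apply/ffunP => u; rewrite rlev_mul ffunE (bigD1 x.1) //= ffunE eqxx big1 ?addr0 // => t tx.
by rewrite ffunE (negPf tx) mul0r.
Qed.

Lemma rowmul_lev T T' (D : T -> lin (T' * P)) x :
  rowmulK (row_entry D) (rlev x) = rlev (lbind (row_op D) x).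
Proof. by rewrite lev_linear lev_bind //; apply: eq_lev => y; exact: rowmul_bas. Qed.

Section Projection.
Variables (T : finType) (e : T -> P).

Definition row_proj (x : T * P) : lin (T * P) :=
  lbind (fun r => lone (x.1, r)) (mt x.2 (e x.1)).

Lemma row_proj_lev (x : lin (T * P)) u :
  (rlev x : {ffun T -> R}) u * b (e u) = (rlev (lbind row_proj x) : {ffun T -> R}) u.
Proof.
rewrite !rlev_entry lev_bind // lev_mul; apply: eq_lev => -[t p] /=; rewrite lev_bind //.
case: eqP => [->|ut].
  by rewrite mtE; apply: eq_lev => r; rewrite lev_one eqxx.
by rewrite mul0r; apply/esym/big1 => -[d r] _;
  rewrite lev_one /=; case: eqP => // _; rewrite scaler0.
Qed.

Lemma row_entry_idr T' (D : T' -> lin (T * P)) t u :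
  nilp (lnorm (D t ++ lbind row_proj (D t))) ->
  row_entry D t u * b (e u) = row_entry D t u.
Proof. by move=> Dt; rewrite /row_entry row_proj_lev -(lev_eq char2 _ _ Dt). Qed.

End Projection.

Lemma row_entry_idl T T' (D : T' -> lin (T * P)) p t u :
  nilp (lnorm (lin_mul p (D t) ++ D t)) -> b p * row_entry D t u = row_entry D t u.
Proof. by move=> Dt; rewrite /row_entry -rlev_mul (lev_eq char2 _ _ Dt). Qed.

Section Exactness.
Variables (T T' : finType) (D : T' -> lin (T * P)) (e : T -> P) (Z : {ffun T -> R} -> Prop).
Hypothesis ZD : forall c v w, Z v -> Z (c *: v + rowmulK (row_entry D) w).
Variables (h : T * P -> lin (T' * P)) (h' : T * P -> lin (T * P)) (c : coef) (n : nat).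
Hypothesis Zh' : forall v, Z v -> lop lam (row_bas b) h' (row_coord b v) = 0.
Hypothesis c_neq0 : cev lam c != 0.

Definition defect (x : T * P) : lin (T * P) :=
  lnorm (lscale c (lone x) ++ lbind (row_op D) (h x) ++ h' x).

(** Starting from the projection of x restricts the nilpotency test to the summand; outside it there
    is nothing to contract. *)
Definition iter_defect k (x : T * P) : lin (T * P) :=
  iter k (fun y => lnorm (lbind defect y)) (row_proj e x).

Hypothesis nilpotent_defect : forall x, nilp (iter_defect n x).

Lemma row_projE (v : {ffun T -> R}) : (forall t, v t * b (e t) = v t) ->
  v = lop lam (row_bas b) (row_proj e) (row_coord b v).
Proof.
move=> ve; apply/ffunP => u; rewrite -{1}ve {1}(row_bas_coord b v) !sum_ffunE mulr_suml.
apply: eq_bigr => x _; rewrite !ffunE -scalerAl; congr (_ *: _).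
by have := row_proj_lev e (lone x) u; rewrite lev_one lev_bind // lev_one ffunE.
Qed.

(* The operator N = c + d h + h' maps a cycle z to c z + d h z, so the cycles c z
   and N z differ by a boundary; as N is nilpotent, c^n z is a boundary.  It is
   enough that h be a contracting homotopy up to terms of higher degree. *)
Lemma exact_of_homotopy (v : {ffun T -> R}) : (forall t, v t * b (e t) = v t) -> Z v ->
  exists w, rowmulK (row_entry D) w = v.
Proof.
move=> ve Zv.
pose N : {linear {ffun T -> R} -> {ffun T -> R}} :=
  lop lam (row_bas b) defect \o row_coord b.
have NE w : N w = cev lam c *: w
    + rowmulK (row_entry D) (lop lam (row_bas b) h (row_coord b w))
    + lop lam (row_bas b) h' (row_coord b w).
  rewrite /N /= {2}(row_bas_coord b w) scaler_sumr /lop linear_sum -!big_split.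
  apply: eq_bigr => x _.
  rewrite lev_norm // !lev_cat lev_scale // lev_one -rowmul_lev // !scalerDr addrA.
  by congr (_ + _ + _); [rewrite !scalerA mulrC | rewrite linearZ].
have k_ind k : exists w, cev lam c ^+ k *: v = rowmulK (row_entry D) w + iter k N v.
  elim: k => [|k [w IH]]; first by exists 0; rewrite linear0 add0r expr0 scale1r.
  have Zk : Z (iter k N v).
    have -> : iter k N v = cev lam c ^+ k *: v + rowmulK (row_entry D) (- w).
      by rewrite IH linearN /= addrAC subrr add0r.
    exact: ZD.
  exists (cev lam c *: w + - lop lam (row_bas b) h (row_coord b (iter k N v))).
  rewrite exprS -scalerA IH iterS NE Zh' // addr0 scalerDr linearD linearN linearZ /=.
  by rewrite addrACA addNr addr0.
have [w cw] := k_ind n.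
have Nlev k x : iter k N (rlev x) = rlev (iter k (fun y => lnorm (lbind defect y)) x).
  elim: k => //= k ->; rewrite lev_norm // lev_bind // /N /=.
  rewrite (lev_linear lam (row_coord b)) lev_linear; apply: eq_lev => y.
  exact: (lop_bas lam (row_basis T b)).
have Nsum k (F : T * P -> {ffun T -> R}) (a : T * P -> K) :
    iter k N (\sum_x a x *: F x) = \sum_x a x *: iter k N (F x).
  elim: k => // k IHk; rewrite iterS IHk linear_sum; apply: eq_bigr => x _.
  by rewrite linearZ.
(* The division by c is delayed to this point, so that the lists only need coefficients in
   F_2[lambda]. *)
exists ((cev lam c ^+ n)^-1 *: w); rewrite linearZ /=.
apply: (canLR (scalerK (expf_neq0 n c_neq0))).
rewrite cw {1}(row_projE ve) Nsum big1 ?addr0 // => x _.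
by rewrite Nlev -/(iter_defect n x) (nilP (nilpotent_defect x)) lev_nil scaler0.
Qed.

End Exactness.

Section Map.
Variables (T T' : finType) (e : T -> P) (e' : T' -> P) (D : T -> lin (T' * P)).

(** The entry at (t, u) lies in b_(e t) R b_(e' u). The right condition makes rows land in the
    target summand, the left one makes row t the image of the generator t. *)
Definition entries_fixed : Prop :=
  forall t, nilp (lnorm (D t ++ lbind (row_proj e') (D t))) /\
            nilp (lnorm (lin_mul (e t) (D t) ++ D t)).

Hypothesis De : entries_fixed.

Lemma entry_idr t u : row_entry D t u * b (e' u) = row_entry D t u.
Proof. exact: (row_entry_idr u (De t).1). Qed.

Lemma entry_idl t u : b (e t) * row_entry D t u = row_entry D t u.
Proof. exact: (row_entry_idl u (De t).2). Qed.

Definition basis_map : {linear summand (fun t => b (e t)) -> summand (fun t => b (e' t))} :=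
  summand_map (e := fun t => b (e t)) entry_idr.

Lemma basis_mapE x u : val (basis_map x) u = \sum_t val x t * row_entry D t u.
Proof. by rewrite ffunE. Qed.

Lemma basis_map_gen (e_idem : forall t, b (e t) * b (e t) = b (e t)) t u :
  val (basis_map (summand_gen e_idem t)) u = row_entry D t u.
Proof.
rewrite basis_mapE (bigD1 t) //= ffunE eqxx entry_idl big1 ?addr0 // => s st.
by rewrite ffunE (negPf st) mul0r.
Qed.

End Map.

Lemma rowmul_comp0 (T T' T'' : finType) (D : T -> lin (T' * P))
    (D' : T' -> lin (T'' * P)) (w : {ffun T -> R}) :
  (forall x, nilp (lnorm (lbind (row_op D') (row_op D x)))) ->
  rowmulK (row_entry D') (rowmulK (row_entry D) w) = 0.
Proof.
move=> DD; rewrite (row_bas_coord b w) !linear_sum big1 // => x _.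
rewrite !linearZ /= rowmul_bas rowmul_lev lev_nilp //.
exact: scaler0.
Qed.

Lemma basis_exact (T T' : finType) (e : T -> P) (e' : T' -> P)
    (D : T' -> lin (T * P)) (De : entries_fixed e' e D) (Z : {ffun T -> R} -> Prop)
    (h : T * P -> lin (T' * P)) (h' : T * P -> lin (T * P)) c n :
  (forall a v w, Z v -> Z (a *: v + rowmulK (row_entry D) w)) ->
  (forall v, Z v -> lop lam (row_bas b) h' (row_coord b v) = 0) ->
  (forall t, b (e' t) * b (e' t) = b (e' t)) ->
  cev lam c != 0 -> (forall x, nilp (iter_defect D e h h' c n x)) ->
  forall v : summand (fun t => b (e t)), Z (val v) -> exists y, basis_map De y = v.
Proof.
move=> ZD Zh' e'_idem c0 nil v Zv.
have [w wv] := exact_of_homotopy ZD Zh' c0 nil (summandP v) Zv.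
(* The preimage w lives in the free module. Multiplying by the idempotents moves it into the summand
   and keeps its image, because the entries of D absorb them on the left. *)
pose w' : {ffun T' -> R^o} := [ffun t => w t * b (e' t)].
have we t : w' t * b (e' t) = w' t by rewrite ffunE -mulrA e'_idem.
exists (to_summand we); apply/val_inj/ffunP => u.
rewrite (basis_mapE De) -wv [RHS]ffunE; apply: eq_bigr => t _.
by rewrite ffunE -mulrA (entry_idl De).
Qed.

Section ExactStep.
Variables (T0 T1 T2 : finType) (e0 : T0 -> P) (e1 : T1 -> P) (e2 : T2 -> P).
Variables (D : T1 -> lin (T0 * P)) (D' : T2 -> lin (T1 * P)).
Hypotheses (De : entries_fixed e1 e0 D) (D'e : entries_fixed e2 e1 D').

(** The term h d of a contraction, which vanishes on cycles; the scalar c brings h to the same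
    multiple as the next homotopy. *)
Definition prev_homotopy (c : coef) (h : T0 * P -> lin (T1 * P)) (x : T1 * P) :=
  lscale c (lbind h (row_op D x)).

Lemma prev_homotopyE c h v : rowmulK (row_entry D) v = 0 ->
  lop lam (row_bas b) (prev_homotopy c h) (row_coord b v) = 0.
Proof.
pose s : {linear {ffun T0 -> R} -> {ffun T1 -> R}} := lop lam (row_bas b) h \o row_coord b.
have s_lev x : s (lev lam (row_bas b) x) = lev lam (row_bas b) (lbind h x).
  rewrite lev_linear lev_bind //; apply: eq_lev => y.
  exact: (lop_bas lam (row_basis T0 b)).
move=> v0; suff -> : lop lam (row_bas b) (prev_homotopy c h) (row_coord b v) =
    cev lam c *: s (rowmulK (row_entry D) v) by rewrite v0 linear0 scaler0.
pose f : {linear {ffun T1 -> R} -> {ffun T1 -> R}} :=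
  lop lam (row_bas b) (prev_homotopy c h) \o row_coord b.
pose g : {linear {ffun T1 -> R} -> {ffun T1 -> R}} :=
  cev lam c \*: (s \o rowmulK (row_entry D)).
apply: (eq_linear_bas (b := row_basis T1 b) (f := f) (g := g)) => x.
apply: etrans (lop_bas lam (row_basis T1 b) _ _ x) _.
transitivity (cev lam c *: s (rowmulK (row_entry D) (row_bas b x))); last by [].
by rewrite rowmul_bas s_lev -lev_scale.
Qed.

Hypothesis e2_idem : forall t, b (e2 t) * b (e2 t) = b (e2 t).
Hypothesis DD' : forall x, nilp (lnorm (lbind (row_op D) (row_op D' x))).
Variables (h0 : T0 * P -> lin (T1 * P)) (h1 : T1 * P -> lin (T2 * P)).
Variables (c c' : coef) (n : nat).
Hypothesis c_neq0 : cev lam c != 0.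
Hypothesis nil : forall x, nilp (iter_defect D' e1 h1 (prev_homotopy c' h0) c n x).

Lemma exact_step x : basis_map De x = 0 <-> exists y, basis_map D'e y = x.
Proof.
have valE T T' (e : T -> P) (e' : T' -> P) (F : T -> lin (T' * P))
  (Fe : entries_fixed e e' F) y : val (basis_map Fe y) = rowmulK (row_entry F) (val y) by [].
split=> [x0|[y <-]]; last first.
  by apply: val_inj; rewrite !valE; exact: (rowmul_comp0).
apply: (basis_exact D'e (Z := fun v => rowmulK (row_entry D) v = 0)) nil _ _ => //.
- move=> a v w v0; rewrite linearP /= v0 scaler0 add0r.
  exact: (rowmul_comp0).
- by move=> v; exact: prev_homotopyE.
- exact: (congr1 val x0).
Qed.

End ExactStep.

End RowOperators.

(** * Cochains with values in the algebra *)

HB.lock Definition act (K : comNzRingType) (A : algType K) (r : enveloping A) (a : A) : A :=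
  r *: (a : bimod A).

Lemma actE (K : comNzRingType) (A : algType K) (r : enveloping A) (a : A) :
  act r a = r *: (a : bimod A).
Proof. by rewrite act.unlock. Qed.

Lemma act_pi (K : comNzRingType) (A : algType K) t (a : A) :
  act (quot_pi (@tensor_rels K A) t) a = bimod_act_pre t a.
Proof. by rewrite actE; exact: bimod_act_pi. Qed.

Lemma act_tensor (K : comNzRingType) (A : algType K) (x y a : A) :
  act (tensor x y) a = y * a * x.
Proof. by rewrite actE tensor_act. Qed.

Lemma act_linl (K : comNzRingType) (A : algType K) (a : A) : linear ((@act K A)^~ a).
Proof.
move=> c r s; rewrite -(quot_repr r) -(quot_repr s) -linearP !act_pi.
exact: bimod_act_pre_linl.
Qed.

Lemma act_linr (K : comNzRingType) (A : algType K) (r : enveloping A) : linear (act r).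
Proof.
by move=> c x y; rewrite -(quot_repr r) !act_pi bimod_act_pre_linr.
Qed.

Definition act_by (K : comNzRingType) (A : algType K) (a : A) (r : enveloping A) := act r a.

HB.instance Definition _ (K : comNzRingType) (A : algType K) (r : enveloping A) :=
  GRing.isLinear.Build K A A *:%R (@act K A r) (@act_linr K A r).
HB.instance Definition _ (K : comNzRingType) (A : algType K) (a : A) :=
  GRing.isLinear.Build K (enveloping A) A *:%R (@act_by K A a) (@act_linl K A a).

Section Cochains.
Variables (K : fieldType) (char2 : 2%N \in [pchar K]) (lam : K).
Variables (A : algType K) (I : finType) (b : module_basis A I).
Variables (mt : I -> I -> lin I) (mtE : mult_table lam b mt).
Implicit Types T : finType.

Local Notation tb := (tensor_basis b).
Local Notation clev := (lev lam (row_bas b)).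

Lemma act_bas p q k : act (tb (p, q)) (b k) = lev lam b (lbind (mt^~ q) (mt p k)).
Proof.
rewrite [LHS]act_tensor mtE lev_bind // /lev mulr_suml; apply: eq_bigr => t _.
by rewrite -scalerAl mtE.
Qed.

Definition cob T T' (D : T' -> lin (T * (I * I))) (n : {ffun T -> A}) : {ffun T' -> A} :=
  [ffun t => \sum_u act (row_entry lam tb D t u) (n u)].

Lemma cob_is_linear T T' (D : T' -> lin (T * (I * I))) : linear (cob D).
Proof.
move=> c n m; apply/ffunP => t; rewrite !ffunE scaler_sumr -big_split.
by apply: eq_bigr => u _ /=; rewrite !ffunE act_linr.
Qed.

HB.instance Definition _ T T' D := GRing.isLinear.Build K {ffun T -> A} {ffun T' -> A} *:%R
  (@cob T T' D) (@cob_is_linear T T' D).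

(** A term b_p (x) b_q of the entry at (t, x.1) contributes b_p b_k b_q at t, where k is x.2. The
    explicit enumeration [sT'] makes this computable. *)
Definition cob_op T T' (sT' : seq T') (D : T' -> lin (T * (I * I))) (x : T * I) : lin (T' * I) :=
  flatten [seq lbind (fun y => if y.1 == x.1 then
    lbind (fun m => lbind (fun r => lone (t, r)) (mt m y.2.2)) (mt y.2.1 x.2) else [::]) (D t)
  | t <- sT'].

Lemma cob_bas T T' (sT' : seq T') (D : T' -> lin (T * (I * I))) x :
  uniq sT' -> (forall t, t \in sT') ->
  cob D (row_bas b x) = clev (cob_op sT' D x).
Proof.
move=> sU sT; apply/ffunP => t; rewrite ffunE (bigD1 x.1) //= big1 ?addr0; last first.
  move=> u ux; by rewrite ffunE (negPf ux) linear0.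
rewrite ffunE eqxx.
have -> : act (row_entry lam tb D t x.1) (b x.2) = lev lam b (lbind (fun y => if y.1 == x.1 then
    lbind (mt^~ y.2.2) (mt y.2.1 x.2) else [::]) (D t)).
  rewrite /row_entry rlev_entry lev_bind //.
  rewrite -[LHS]/(act_by (b x.2) _) lev_linear; apply: eq_lev => -[u [p q]].
  rewrite /= /act_by eq_sym; case: eqP => _; first exact: act_bas.
  by rewrite lev_nil; exact: (linear0 (act_by (b x.2))).
rewrite rlev_entry /cob_op.
pose G (y : T' * I) : A := if t == y.1 then b y.2 else 0.
have G0 J (F : J -> A) y : (forall j, F j = 0) -> lev lam F y = 0.
  by move=> F0; apply: big1 => j _; rewrite F0 scaler0.
have GE u : lev lam G (lbind (fun y => if y.1 == x.1 then
      lbind (fun m => lbind (fun r => lone (u, r)) (mt m y.2.2)) (mt y.2.1 x.2) else [::]) (D u))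
    = if t == u then lev lam b (lbind (fun y => if y.1 == x.1 then
        lbind (mt^~ y.2.2) (mt y.2.1 x.2) else [::]) (D u)) else 0.
  rewrite !lev_bind //; case: eqP => [tu|/eqP tu].
    apply: eq_lev => y; case: eqP => _; rewrite ?lev_nil // !lev_bind //.
    apply: eq_lev => m; rewrite lev_bind //; apply: eq_lev => r.
    by rewrite lev_one /G tu eqxx.
  apply: (G0 _) => y; case: eqP => _; rewrite ?lev_nil // lev_bind //.
  apply: (G0 _) => m; rewrite lev_bind //; apply: (G0 _) => r.
  by rewrite lev_one /G (negPf tu).
have -> s (F : T' -> lin (T' * I)) : lev lam G (flatten [seq F u | u <- s])
    = \sum_(u <- s) lev lam G (F u).
  by elim: s => [|u s IHs]; rewrite ?lev_nil ?big_nil // lev_cat big_cons IHs.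
rewrite (bigD1_seq t) //= GE eqxx big1 ?addr0 // => u ut.
by rewrite GE eq_sym (negPf ut).
Qed.

Definition cob_list T T' (sT' : seq T') (D : T' -> lin (T * (I * I))) :
  lin (T * I) -> lin (T' * I) :=
  lbind (cob_op sT' D).

Lemma cob_lev T T' (sT' : seq T') (D : T' -> lin (T * (I * I))) x :
  uniq sT' -> (forall t, t \in sT') -> cob D (clev x) = clev (cob_list sT' D x).
Proof.
move=> sU sT; rewrite lev_linear /cob_list lev_bind //.
by apply: eq_lev => y; exact: cob_bas.
Qed.

(** Bimodule maps from A e (x) f A to A correspond to the corner e A f; this projects A onto it. *)
Definition corner T (e : T -> I * I) (x : T * I) : lin (T * I) :=
  lbind (fun m => lbind (fun r => lone (x.1, r)) (mt m (e x.1).2)) (mt (e x.1).1 x.2).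

Definition corner_proj T (e : T -> I * I) (n : {ffun T -> A}) : {ffun T -> A} :=
  [ffun t => act (tb (e t)) (n t)].

Lemma corner_proj_is_linear T (e : T -> I * I) : linear (corner_proj e).
Proof. by move=> c n m; apply/ffunP => t; rewrite !ffunE linearP. Qed.

HB.instance Definition _ T e := GRing.isLinear.Build K {ffun T -> A} {ffun T -> A} *:%R
  (@corner_proj T e) (@corner_proj_is_linear T e).

Lemma corner_bas T (e : T -> I * I) x : corner_proj e (row_bas b x) = clev (corner e x).
Proof.
apply/ffunP => t; rewrite ffunE rlev_entry lev_bind // ffunE.
case: eqP => [->|tx].
  rewrite /corner; case: (e x.1) => p q; rewrite act_bas lev_bind //.
  apply: eq_lev => m; rewrite lev_bind //; apply: eq_lev => r.
  by rewrite lev_one eqxx.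
rewrite linear0; apply/esym/big1 => m _; rewrite lev_bind // [X in _ *: X]big1 ?scaler0 //.
by move=> r _; rewrite lev_one /=; case: eqP => // _; rewrite scaler0.
Qed.

Lemma corner_lev T (e : T -> I * I) x : corner_proj e (clev x) = clev (lbind (corner e) x).
Proof.
by rewrite lev_linear lev_bind //; apply: eq_lev => y; exact: corner_bas.
Qed.

Section Cohomology.
Variables (T0 T1 T2 : finType) (s1 : seq T1) (s2 : seq T2).
Hypotheses (s1U : uniq s1) (s1P : forall t, t \in s1).
Hypotheses (s2U : uniq s2) (s2P : forall t, t \in s2).
Variables (D0 : T1 -> lin (T0 * (I * I))) (D1 : T2 -> lin (T1 * (I * I))) (e : T1 -> I * I).
Variables (h : T1 * I -> lin (T0 * I)) (h' : T2 * I -> lin (T1 * I)).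
Variables (c : coef) (B : seq (lin (T1 * I))) (g : T1 * I -> lin nat).

(* [g] gives c times the coordinates of a class in the basis [B], and c times the
   identity is the sum of the projection so defined and a homotopy. *)
Definition cohomology_certificate : bool :=
  [&& all (fun y => nilp (lnorm (cob_list s2 D1 y))) B,
      all (fun y => nilp (lnorm (y ++ lbind (corner e) y))) B &
      all (fun i => lnorm (lbind g (nth [::] B i)) == [:: (c, i)]) (iota 0 (size B))].

Definition homotopy_certificate (x : T1 * I) : bool :=
  nilp (lnorm (lscale c (corner e x)
    ++ cob_list s1 D0 (lbind h (corner e x)) ++ lbind h' (cob_list s2 D1 (corner e x))
    ++ lbind (nth [::] B) (lbind g (corner e x)))).

Hypothesis c_neq0 : cev lam c != 0.
Hypothesis certB : cohomology_certificate.
Hypothesis cert_homotopy : forall x, homotopy_certificate x.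
Hypothesis cert_boundary : forall x, nilp (lnorm (lbind g (cob_op s1 D0 x))).

Definition class_vec (i : 'I_(size B)) : {ffun T1 -> A} := clev (nth [::] B i).

Lemma class_vec_cocycle i : cob D1 (class_vec i) = 0.
Proof.
rewrite /class_vec (cob_lev _ _ s2U s2P) lev_nilp //.
by case/and3P: certB => /allP/(_ (nth [::] B i)) -> //; rewrite mem_nth.
Qed.

Lemma class_vec_corner i : corner_proj e (class_vec i) = class_vec i.
Proof.
rewrite /class_vec corner_lev; apply/esym/lev_eq => //.
by case/and3P: certB => _ /allP/(_ (nth [::] B i)) -> //; rewrite mem_nth.
Qed.

Let nat_vec (k : nat) : {ffun 'I_(size B) -> K^o} := [ffun i : 'I_(size B) => (k == i :> nat)%:R].

Let class_coord (n : {ffun T1 -> A}) : {ffun 'I_(size B) -> K^o} :=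
  lop lam nat_vec g (row_coord b n).

Let class_coord_lev x : class_coord (clev x) = lev lam nat_vec (lbind g x).
Proof.
rewrite /class_coord lev_bind // (lev_linear lam (row_coord b)) lev_linear.
by apply: eq_lev => y; exact: (lop_bas lam (row_basis T1 b)).
Qed.

Let class_coord_cob y : class_coord (cob D0 y) = 0.
Proof.
rewrite (row_bas_coord b y) linear_sum /class_coord !linear_sum big1 // => x _.
rewrite linearZ !linearZ /= -/(class_coord _) (cob_bas _ _ s1U s1P) class_coord_lev.
by rewrite lev_nilp // scaler0.
Qed.

Let class_coord_vec i : class_coord (class_vec i) = cev lam c *: nat_vec i.
Proof.
rewrite class_coord_lev -lev_norm //.
case/and3P: certB => _ _ /allP/(_ (val i)); rewrite mem_iota ltn_ord => /(_ isT)/eqP ->.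
by rewrite lev_cons lev_nil addr0.
Qed.

(** The coordinates given by g vanish on coboundaries and are c times dual to the class vectors, so
    they read off c a_i. *)
Lemma class_vec_indep (a : 'I_(size B) -> K) y :
  \sum_i a i *: class_vec i = cob D0 y -> forall i, a i = 0.
Proof.
move=> /(congr1 class_coord); rewrite class_coord_cob.
have -> : class_coord (\sum_i a i *: class_vec i) = \sum_i a i *: class_coord (class_vec i).
  rewrite /class_coord !linear_sum; apply: eq_bigr => i _.
  by rewrite !linearZ.
move=> + i => /ffunP/(_ i); rewrite sum_ffunE (bigD1 i) //= big1 ?addr0.
  rewrite class_coord_vec !ffunE eqxx => /eqP; rewrite scaler_eq0 => /orP[/eqP//|].
  by rewrite [_ *: _]mulr1 (negPf c_neq0).
move=> j ji; rewrite class_coord_vec !ffunE (negPf (_ : j != i :> nat)) ?scaler0 //.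
Qed.

Lemma class_vec_span n : corner_proj e n = n -> cob D1 n = 0 ->
  exists a : 'I_(size B) -> K, exists y, n - \sum_i a i *: class_vec i = cob D0 y.
Proof.
move=> en dn.
pose f1 : {linear {ffun T1 -> A} -> {ffun T0 -> A}} := lop lam (row_bas b) h \o row_coord b.
pose f2 : {linear {ffun T2 -> A} -> {ffun T1 -> A}} := lop lam (row_bas b) h' \o row_coord b.
pose f3 : {linear {ffun T1 -> A} -> {ffun T1 -> A}} :=
  lop lam (fun k => clev (nth [::] B k)) g \o row_coord b.
have f1P x : f1 (clev x) = clev (lbind h x).
  rewrite lev_linear lev_bind //; apply: eq_lev => y; exact: (lop_bas lam (row_basis T1 b)).
have f2P x : f2 (clev x) = clev (lbind h' x).
  rewrite lev_linear lev_bind //; apply: eq_lev => y; exact: (lop_bas lam (row_basis T2 b)).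
have f3P x : f3 (clev x) = clev (lbind (nth [::] B) (lbind g x)).
  rewrite lev_linear !lev_bind //; apply: eq_lev => y; exact: (lop_bas lam (row_basis T1 b)).
have f3E m : f3 m = \sum_i class_coord m i *: class_vec i.
  pose phi : {linear {ffun 'I_(size B) -> K^o} -> {ffun T1 -> A}} :=
    lop lam class_vec (@lone 'I_(size B)).
  have phiE w : phi w = \sum_i w i *: class_vec i.
    by apply: eq_bigr => i _; rewrite lev_one.
  rewrite -phiE /class_coord lop_linear /=; apply: eq_bigr => x _.
  congr (_ *: _); apply: eq_lev => k; rewrite /= phiE.
  have [kB|kB] := ltnP k (size B).
    rewrite (bigD1 (Ordinal kB)) //= ffunE eqxx scale1r big1 ?addr0 // => i ik.
    by rewrite ffunE (negPf (_ : k != i :> nat)) ?scale0r // eq_sym.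
  (* An index beyond B gives zero on both sides: the default list is empty and [nat_vec] has no such
     entry. *)
  rewrite nth_default // lev_nil big1 // => i _.
  by rewrite ffunE gtn_eqF ?scale0r // (leq_trans (ltn_ord i)).
(* The certificate says F = 0. At a cocycle n fixed by the corner projection this reads, in
   characteristic 2, that c n is the coboundary of f1 n plus the combination f3 n of the classes. *)
pose F : {linear {ffun T1 -> A} -> {ffun T1 -> A}} :=
  (cev lam c \*: corner_proj e) \+ ((cob D0 \o (f1 \o corner_proj e))
  \+ ((f2 \o (cob D1 \o corner_proj e)) \+ (f3 \o corner_proj e))).
have FE m : F m = cev lam c *: corner_proj e m + (cob D0 (f1 (corner_proj e m))
  + (f2 (cob D1 (corner_proj e m)) + f3 (corner_proj e m))) by [].
have Fx x : F (row_bas b x) = 0.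
  rewrite FE corner_bas f1P f3P !(cob_lev _ _ s1U s1P, cob_lev _ _ s2U s2P) f2P.
  by rewrite -lev_scale // -!lev_cat lev_nilp //; exact: cert_homotopy.
have Fn : F n = 0.
  rewrite (row_bas_coord b n) linear_sum big1 // => x _; rewrite linearZ.
  by rewrite [F _](Fx x); exact: scaler0.
have opp2 (v : {ffun T1 -> A}) : - v = v.
  by rewrite -scaleN1r (oppr_pchar2 char2) scale1r.
move: Fn; rewrite FE en dn (linear0 f2) add0r f3E => /eqP.
rewrite addr_eq0 => /eqP cn.
exists (fun i => (cev lam c)^-1 * class_coord n i), ((cev lam c)^-1 *: f1 n).
rewrite linearZ; apply: (canRL (scalerK c_neq0)); rewrite scalerBr cn opp2.
rewrite [X in _ - X](_ : _ = \sum_i class_coord n i *: class_vec i) ?addrK //.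
rewrite scaler_sumr; apply: eq_bigr => i _.
by rewrite scalerA mulrA divff // mul1r.
Qed.

End Cohomology.

End Cochains.

(** * Bimodule homomorphisms into A as tuples of elements of A *)

Section BimoduleComplex.
Variables (K : fieldType) (char2 : 2%N \in [pchar K]) (lam : K).
Variables (A : algType K) (I : finType) (b : module_basis A I).
Variables (mt : I -> I -> lin I) (mtE : mult_table lam b mt).

Local Notation R := (enveloping A).
Local Notation tb := (tensor_basis b).
Local Notation tmt := (tensor_table mt).
Local Notation ent := (row_entry lam tb).
Local Notation M := (bimod A).

Lemma tmtE : mult_table lam tb tmt.
Proof. exact: tensor_tableP. Qed.

Lemma act_scalar c (a : A) : act (c%:A : R) a = c *: a.
Proof.
rewrite -[act _ _]/(act_by a _) linearZ /= /act_by; congr (_ *: _).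
by rewrite actE scale1r.
Qed.

Local Notation bimod_map := (basis_map (mt := tmt) char2 tmtE).

Section Cochain.
Variables (T : finType) (e : T -> I * I).
Hypothesis e_idem : forall t, tb (e t) * tb (e t) = tb (e t).
Local Notation P := (summand (fun t => tb (e t))).

Definition cochain (f : {linear P -> M}) : {ffun T -> A} := [ffun t => f (summand_gen e_idem t)].

Definition hom_of (n : {ffun T -> A}) : {linear P -> M} :=
  summand_hom (e := fun t => tb (e t)) (fun t => n t : M).

Lemma cochain_corner f : corner_proj b e (cochain f) = cochain f.
Proof.
apply/ffunP => t; rewrite !ffunE actE -linearZ; congr (f _).
exact: summand_gen_fixed.
Qed.

Lemma hom_ofE n x : hom_of n x = \sum_t act (val x t) (n t).
Proof. by apply: eq_bigr => t _; rewrite actE. Qed.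

Lemma hom_cochain (f : {linear P -> M}) x : f x = hom_of (cochain f) x.
Proof.
apply: etrans (hom_summand e_idem f x) _; apply: eq_bigr => t _.
by rewrite ffunE.
Qed.

Lemma cochain_hom n : corner_proj b e n = n -> cochain (hom_of n) = n.
Proof.
move=> en; apply/ffunP => t; transitivity (corner_proj b e n t); last by rewrite en.
rewrite ffunE [RHS]ffunE actE.
exact: (summand_hom_gen e_idem (fun t => n t : M) t).
Qed.

Lemma cochain_sub (f : {linear P -> M}) d (c : 'I_d -> K) (F : 'I_d -> {linear P -> M}) :
  cochain (f \- lincomb c F) = cochain f - \sum_i c i *: cochain (F i).
Proof.
apply/ffunP => t; rewrite !ffunE sum_ffunE; congr (_ - _).
by apply: eq_bigr => i _; rewrite !ffunE -act_scalar actE.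
Qed.

Lemma cochain_lincomb d (c : 'I_d -> K) (F : 'I_d -> {linear P -> M}) :
  cochain (lincomb c F) = \sum_i c i *: cochain (F i).
Proof.
apply/ffunP => t; rewrite !ffunE sum_ffunE.
by apply: eq_bigr => i _; rewrite !ffunE -act_scalar actE.
Qed.

End Cochain.

(** The coboundary is the transpose of the matrix D: composing with D on homomorphisms is [cob] on
    tuples. *)
Lemma row_act_map (T T' : finType) (D : T' -> lin (T * (I * I))) (w : {ffun T' -> R})
    (n : {ffun T -> A}) :
  \sum_u act (rowmulK (ent D) w u) (n u) = \sum_t act (w t) (cob lam b D n t).
Proof.
transitivity (\sum_u \sum_t act (w t) (act (ent D t u) (n u))).
  apply: eq_bigr => u _; rewrite ffunE.
  rewrite -[LHS]/(act_by (n u) _) linear_sum; apply: eq_bigr => t _.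
  by rewrite /= /act_by !actE scalerA.
rewrite exchange_big; apply: eq_bigr => t _ /=.
by rewrite ffunE linear_sum.
Qed.

Section CochainMap.
Variables (T T' : finType) (e : T -> I * I) (e' : T' -> I * I).
Hypothesis e_idem : forall t, tb (e t) * tb (e t) = tb (e t).
Hypothesis e'_idem : forall t, tb (e' t) * tb (e' t) = tb (e' t).
Variables (D : T' -> lin (T * (I * I))) (De : entries_fixed tmt e' e D).
Local Notation P := (summand (fun t => tb (e t))).
Local Notation P' := (summand (fun t => tb (e' t))).

Lemma hom_of_map n x : hom_of e n (bimod_map De x) = hom_of e' (cob lam b D n) x.
Proof.
by rewrite !hom_ofE -row_act_map.
Qed.

Lemma cochain_map (g : {linear P -> M}) t :
  g (bimod_map De (summand_gen e'_idem t)) = cob lam b D (cochain e_idem g) t.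
Proof.
rewrite (hom_cochain e_idem) hom_ofE [RHS]ffunE; apply: eq_bigr => u _.
by rewrite (basis_map_gen char2 tmtE).
Qed.

Lemma cocycle_cochain (f : {linear P -> M}) :
  (forall x, f (bimod_map De x) = 0) <-> cob lam b D (cochain e_idem f) = 0.
Proof.
split=> [f0|f0 x]; first by apply/ffunP => t; rewrite -cochain_map f0 ffunE.
rewrite (hom_cochain e_idem) hom_of_map f0 hom_ofE big1 // => t _.
by rewrite ffunE linear0.
Qed.

(** The primitive y ranges over all tuples, since [hom_of] makes a homomorphism of any tuple and
    sees only its corner part. *)
Lemma coboundary_cochain (f : {linear P' -> M}) :
  (exists g : {linear P -> M}, forall x, f x = g (bimod_map De x)) <->
  exists y, cochain e'_idem f = cob lam b D y.
Proof.
split=> [[g fg]|[y fy]].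
  by exists (cochain e_idem g); apply/ffunP => t; rewrite ffunE fg cochain_map.
by exists (hom_of e y) => x; rewrite hom_of_map (hom_cochain e'_idem) fy.
Qed.

End CochainMap.

Section CohomologyBasis.
Variables (T0 T1 T2 : finType) (s1 : seq T1) (s2 : seq T2).
Hypotheses (s1U : uniq s1) (s1P : forall t, t \in s1).
Hypotheses (s2U : uniq s2) (s2P : forall t, t \in s2).
Variables (D0 : T1 -> lin (T0 * (I * I))) (D1 : T2 -> lin (T1 * (I * I))).
Variables (e1 : T1 -> I * I) (e2 : T2 -> I * I).
Hypothesis e1_idem : forall t, tb (e1 t) * tb (e1 t) = tb (e1 t).
Hypothesis e2_idem : forall t, tb (e2 t) * tb (e2 t) = tb (e2 t).
Hypothesis D1e : entries_fixed tmt e2 e1 D1.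
Variables (h : T1 * I -> lin (T0 * I)) (h' : T2 * I -> lin (T1 * I)).
Variables (c : coef) (B : seq (lin (T1 * I))) (g : T1 * I -> lin nat).
Hypothesis c_neq0 : cev lam c != 0.
Hypothesis certB : cohomology_certificate mt s2 D1 e1 c B g.
Hypothesis certH : forall x, homotopy_certificate mt s1 s2 D0 D1 e1 h h' c B g x.
Hypothesis certD : forall x, nilp (lnorm (lbind g (cob_op mt s1 D0 x))).

Local Notation P1 := (summand (fun t => tb (e1 t))).

Definition class_hom (i : 'I_(size B)) : {linear P1 -> M} := hom_of e1 (class_vec lam b i).

Lemma cochain_class_hom i : cochain e1_idem (class_hom i) = class_vec lam b i.
Proof. by apply: cochain_hom; apply: (class_vec_corner char2 mtE certB). Qed.

Lemma class_hom_cocycle i x : class_hom i (bimod_map D1e x) = 0.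
Proof.
move: x; apply/(cocycle_cochain e1_idem e2_idem).
by rewrite cochain_class_hom; apply: (class_vec_cocycle char2 mtE s2U s2P certB).
Qed.

Lemma class_hom_span (f : {linear P1 -> M}) : (forall x, f (bimod_map D1e x) = 0) ->
  exists (a : 'I_(size B) -> K) (y : {ffun T0 -> A}),
    cochain e1_idem (f \- lincomb a class_hom) = cob lam b D0 y.
Proof.
move/(cocycle_cochain e1_idem e2_idem) => fZ.
have [a [y ay]] := class_vec_span char2 mtE s1U s1P s2U s2P c_neq0 certH
  (cochain_corner e1_idem f) fZ.
exists a, y; rewrite cochain_sub -ay; congr (_ - _).
by apply: eq_bigr => i _; rewrite cochain_class_hom.
Qed.

Lemma class_hom_indep (a : 'I_(size B) -> K) (y : {ffun T0 -> A}) :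
  cochain e1_idem (lincomb a class_hom) = cob lam b D0 y -> forall i, a i = 0.
Proof.
move=> ay; apply: (class_vec_indep char2 mtE s1U s1P c_neq0 certB certD (y := y)).
rewrite -ay cochain_lincomb.
by apply: eq_bigr => i _; rewrite cochain_class_hom.
Qed.

End CohomologyBasis.

End BimoduleComplex.

(** * A basis of Lambda_3(lambda) *)

(* The basis of the paths alpha^k (a), beta^k (b), sigma, alpha sigma (s) and
   gamma, gamma alpha (g), where a0 and b0 are the trivial paths. *)
Variant lambda_bas := a0 | a1 | a2 | a3 | b0 | b1 | b2 | b3 | s0 | s1 | g0 | g1.

(** The tag is an arrow parallel to the basis path, from which its end points are read; the bits are
    the index in binary. *)
Definition lambda_bas_code (i : lambda_bas) : lambda_arrow * (bool * bool) :=
  match i with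
  | a0 => (alpha, (false, false)) | a1 => (alpha, (false, true))
  | a2 => (alpha, (true, false)) | a3 => (alpha, (true, true))
  | b0 => (beta, (false, false)) | b1 => (beta, (false, true))
  | b2 => (beta, (true, false)) | b3 => (beta, (true, true))
  | s0 => (sigma, (false, false)) | s1 => (sigma, (false, true))
  | g0 => (gamma, (false, false)) | g1 => (gamma, (false, true))
  end.

Definition lambda_bas_decode (p : lambda_arrow * (bool * bool)) : lambda_bas :=
  match p with
  | (alpha, (false, false)) => a0 | (alpha, (false, true)) => a1
  | (alpha, (true, false)) => a2 | (alpha, (true, true)) => a3
  | (beta, (false, false)) => b0 | (beta, (false, true)) => b1
  | (beta, (true, false)) => b2 | (beta, (true, true)) => b3
  | (sigma, (_, false)) => s0 | (sigma, (_, true)) => s1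
  | (gamma, (_, false)) => g0 | (gamma, (_, true)) => g1
  end.

Lemma lambda_bas_codeK : cancel lambda_bas_code lambda_bas_decode.
Proof. by case. Qed.
HB.instance Definition _ := Finite.copy lambda_bas (can_type lambda_bas_codeK).

Definition vertices := [:: vtx1; vtx2].
Definition arrows := [:: alpha; sigma; gamma; beta].
Definition lambda_basis_seq := [:: a0; a1; a2; a3; b0; b1; b2; b3; s0; s1; g0; g1].

Lemma vertices_uniq : uniq vertices. Proof. by []. Qed.
Lemma mem_vertices v : v \in vertices. Proof. by case: v. Qed.
Lemma arrows_uniq : uniq arrows. Proof. by []. Qed.
Lemma mem_arrows a : a \in arrows. Proof. by case: a. Qed.
Lemma mem_basis i : i \in lambda_basis_seq. Proof. by case: i. Qed.

Definition bas_src (i : lambda_bas) := lambda_src (lambda_bas_code i).1.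
Definition bas_tgt (i : lambda_bas) := lambda_tgt (lambda_bas_code i).1.

Definition bas_vertex (v : lambda_vertex) := if v is vtx1 then a0 else b0.
Definition bas_arrow (a : lambda_arrow) :=
  match a with alpha => a1 | sigma => s0 | gamma => g0 | beta => b1 end.

Definition bas_word (i : lambda_bas) : seq lambda_arrow :=
  match i with
  | a0 | b0 => [::]
  | a1 => [:: alpha] | a2 => [:: alpha; alpha] | a3 => [:: alpha; alpha; alpha]
  | b1 => [:: beta] | b2 => [:: beta; beta] | b3 => [:: beta; beta; beta]
  | s0 => [:: sigma] | s1 => [:: alpha; sigma]
  | g0 => [:: gamma] | g1 => [:: gamma; alpha]
  end.

(* 1 and lambda *)
Definition c1 : coef := [:: true].
Definition cl : coef := [:: false; true].

(** Right multiplication by arrows, with signs dropped in characteristic 2. The default case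
    collects the pairs that do not compose and the products that vanish, such as alpha^2 sigma. *)
Definition arrow_table (i : lambda_bas) (a : lambda_arrow) : lin lambda_bas :=
  match a, i with
  | alpha, a0 => lone a1 | alpha, a1 => lone a2 | alpha, a2 => lone a3
  | alpha, g0 => lone g1
  | sigma, a0 => lone s0 | sigma, a1 => lone s1
  | sigma, g0 => [:: (cl, b2)] | sigma, g1 => [:: (cl, b3)]
  | gamma, b0 => lone g0 | gamma, b1 => lone g1
  | gamma, s0 => [:: (c1, a2); (c1, a3)] | gamma, s1 => lone a3
  | beta, b0 => lone b1 | beta, b1 => lone b2 | beta, b2 => lone b3
  | beta, s0 => lone s1
  | _, _ => [::]
  end.

Definition vertex_table (i : lambda_bas) (v : lambda_vertex) : lin lambda_bas :=
  if bas_tgt i == v then lone i else [::].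

Definition word_act (x : lin lambda_bas) (w : seq lambda_arrow) : lin lambda_bas :=
  foldl (fun y a => lnorm (lbind (arrow_table^~ a) y)) x w.

(** Multiplying by the word of j letter by letter reduces the whole table to products with single
    arrows. *)
Definition lambda_table (i j : lambda_bas) : lin lambda_bas :=
  word_act (vertex_table i (bas_src j)) (bas_word j).

Section Relations.
Variables (K : fieldType) (lam : K) (A : algType K) (a s g b : A).
Hypotheses (lam_neq0 : lam != 0) (lam_neq1 : lam != 1).
Hypotheses (aaE : a * a = s * g + a * a * a) (bbE : lam *: (b * b) = g * s).
Hypotheses (gaE : g * a = b * g) (asE : a * s = s * b) (a4 : a * a * a * a = 0).

(* a acts on a^2 s as the nonzero scalar 1 - lambda, and a^4 = 0. *)
Lemma aas_eq0 : a * a * s = 0.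
Proof.
have X : a * (a * a * s) = (1 - lam) *: (a * a * s).
  have E : a * a * s = lam *: (a * a * s) + a * (a * a * s).
    rewrite {1}aaE mulrDl -(mulrA s g s) -bbE -scalerAr (mulrA s b b) -asE -(mulrA a s b) -asE.
    by rewrite !mulrA.
  by rewrite scalerBl scale1r {2}E addrC addKr.
have X2 : (1 - lam) *: ((1 - lam) *: (a * a * s)) = 0.
  by rewrite -X scalerAr -X !mulrA a4 mul0r.
move/eqP: X2; rewrite !scaler_eq0 subr_eq0 eq_sym (negPf lam_neq1) /=.
by move/eqP.
Qed.

(** Mirror image of the previous argument: a acts on g a^2 from the right as 1 - lambda. *)
Lemma gaa_eq0 : g * a * a = 0.
Proof.
have X : g * a * a * a = (1 - lam) *: (g * a * a).
  have E : g * a * a = lam *: (g * a * a) + g * a * a * a.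
    rewrite -{1}(mulrA g a a) aaE mulrDr !mulrA -bbE -scalerAl gaE -(mulrA b g a) gaE.
    by rewrite !mulrA.
  by rewrite scalerBl scale1r {2}E addrC addKr.
have X2 : (1 - lam) *: ((1 - lam) *: (g * a * a)) = 0.
  rewrite -X scalerAl -X; have -> : g * a * a * a * a = g * (a * a * a * a) by rewrite !mulrA.
  by rewrite a4 mulr0.
move/eqP: X2; rewrite !scaler_eq0 subr_eq0 eq_sym (negPf lam_neq1) /=.
by move/eqP.
Qed.

Lemma bbg_eq0 : b * b * g = 0.
Proof. by rewrite -mulrA -gaE mulrA -gaE gaa_eq0. Qed.

(** Here lambda b^4 = b^2 g s, and b^2 g = g a^2 = 0. *)
Lemma b4_eq0 : b * b * b * b = 0.
Proof.
apply: (scalerI lam_neq0); rewrite scaler0 -mulrA scalerAr bbE mulrA bbg_eq0.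
by rewrite mul0r.
Qed.

Lemma sg_eq : s * g = a * a - a * a * a.
Proof. by rewrite {1}aaE addrK. Qed.

Lemma asg_eq : a * s * g = a * a * a.
Proof. by rewrite -mulrA sg_eq mulrBr !mulrA a4 subr0. Qed.

Lemma gas_eq : g * a * s = lam *: (b * b * b).
Proof. by rewrite gaE -mulrA -bbE -scalerAr mulrA. Qed.

End Relations.

(** * Path algebras and their representations *)

Section PathAlgebra.
Variables (K : comNzRingType) (Q : quiver).
Local Notation KQ := (path_alg K Q).

Definition vertex_elt (v : vertex Q) : KQ :=
  cat_elt K (C := path_category Q) (trivial_path v).

Definition word_elt (v : vertex Q) (s : seq (arrow Q)) : KQ :=
  foldl (fun x a => x * arrow_elt K a) (vertex_elt v) s.

Lemma path_elt (p : qpath Q) :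
  cat_elt K (C := path_category Q) p = word_elt (path_src p) (path_arrows p).
Proof.
case: p => [[v s] vs]; rewrite /path_src /path_arrows /=.
elim/last_ind: s vs => [|s a IHs] vs.
  by congr (cat_elt K _); apply: val_inj.
have /andP[vs' /=] : walk v s && walk (walk_end v s) [:: a] by rewrite -walk_cat cats1.
rewrite andbT => /eqP E; rewrite /word_elt foldl_rcons -/(word_elt v s) -(IHs vs').
rewrite [RHS]cat_eltM.
have [//|r [rE rs _ ra]] := @path_comp_Some Q (exist _ (v, s) vs') (arrow_path a).
rewrite [Defs.comp _ _]rE; congr (cat_elt K _); apply: path_eqP; first by rewrite rs.
by rewrite ra /path_arrows /= cats1.
Qed.

Lemma vertex_eltM v w : vertex_elt v * vertex_elt w = if v == w then vertex_elt v else 0.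
Proof.
rewrite [LHS]cat_eltM; case: eqP => [<-|vw]; last by rewrite [Defs.comp _ _]path_comp_None.
have [//|r [rE rs _ ra]] := @path_comp_Some Q (trivial_path v) (trivial_path v).
by rewrite [Defs.comp _ _]rE; congr (cat_elt K _); apply: path_eqP.
Qed.

Lemma vertex_arrow v a : vertex_elt v * arrow_elt K a = if src a == v then arrow_elt K a else 0.
Proof.
rewrite [LHS]cat_eltM eq_sym; case: eqP => [E|vw]; last by rewrite [Defs.comp _ _]path_comp_None.
have [//|r [rE rs _ ra]] := @path_comp_Some Q (trivial_path v) (arrow_path a).
by rewrite [Defs.comp _ _]rE; congr (cat_elt K _); apply: path_eqP; rewrite ?rs ?ra.
Qed.

Lemma arrow_vertex a v : arrow_elt K a * vertex_elt v = if tgt a == v then arrow_elt K a else 0.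
Proof.
rewrite [LHS]cat_eltM; case: eqP => [E|vw]; last by rewrite [Defs.comp _ _]path_comp_None.
have [//|r [rE rs _ ra]] := @path_comp_Some Q (arrow_path a) (trivial_path v).
by rewrite [Defs.comp _ _]rE; congr (cat_elt K _); apply: path_eqP; rewrite ?rs ?ra.
Qed.

Lemma path_alg_ind (P : KQ -> Prop) :
  P 0 -> (forall c v s f, P f -> P (c *: word_elt v s + f)) -> forall f, P f.
Proof.
move=> P0 PD; elim/cat_ind => // c p f Pf; rewrite [cat_elt K _]path_elt.
exact: PD.
Qed.

Section Representation.
Variables (W : lmodType K) (actv : vertex Q -> {linear W -> W}) (acta : arrow Q -> {linear W -> W}).
Hypothesis actvv : forall v v' w, actv v' (actv v w) = if v == v' then actv v w else 0.
Hypothesis actva : forall v a w, acta a (actv v w) = if src a == v then acta a w else 0.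
Hypothesis actav : forall a v w, actv v (acta a w) = if tgt a == v then acta a w else 0.

Definition path_act (w : W) (p : qpath Q) : W :=
  foldl (fun x a => acta a x) (actv (path_src p) w) (path_arrows p).

Lemma path_act_is_linear p : linear (path_act^~ p).
Proof.
move=> c w w'; rewrite /path_act linearP.
by elim: (path_arrows p) (actv _ w) (actv _ w') => //= a s IHs x y; rewrite linearP IHs.
Qed.

Lemma path_act_tgt w p v :
  actv v (path_act w p) = if path_tgt p == v then path_act w p else 0.
Proof.
case: p => [[u s] us]; rewrite /path_act /path_tgt /path_src /path_arrows /= /walk_end.
case/lastP: s us => [|s a] _; first exact: actvv.
by rewrite map_rcons last_rcons foldl_rcons actav.
Qed.

Lemma path_act0 p : path_act 0 p = 0.
Proof. by rewrite /path_act linear0; elim: (path_arrows p) => //= a s; rewrite linear0. Qed.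

Lemma path_act_comp w p q :
  path_act (path_act w p) q = oapp (path_act w) 0 (path_comp p q).
Proof.
have [E|N] := path_tgt p =P path_src q.
  have [r [-> rs _ ra]] := path_comp_Some E.
  by rewrite {1}/path_act path_act_tgt E eqxx /path_act /= rs ra foldl_cat.
rewrite path_comp_None // {1}/path_act path_act_tgt; case: eqP => // _ /=.
by elim: (path_arrows q) => //= a s; rewrite linear0.
Qed.

Definition rep_act (w : W) (x : KQ) : W := malg_lift (path_act w) x.

Lemma rep_act_linr w : linear (rep_act w).
Proof. exact: malg_lift_is_linear. Qed.

Lemma rep_act_linl x : linear (rep_act^~ x).
Proof.
move=> c w w'; rewrite /rep_act -malg_lift_comb; apply: eq_bigr => p _.
by rewrite path_act_is_linear.
Qed.

HB.instance Definition _ w := GRing.isLinear.Build K KQ W *:%R (rep_act w) (rep_act_linr w).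

Lemma rep_actE w p : rep_act w (cat_elt K (C := path_category Q) p) = path_act w p.
Proof. exact: (@cat_lift_basis K (path_category Q)). Qed.

Lemma rep_act0 x : rep_act 0 x = 0.
Proof. by apply: big1 => p _; rewrite path_act0 scaler0. Qed.

Lemma rep_actM w x y : rep_act w (x * y) = rep_act (rep_act w x) y.
Proof.
elim/cat_ind: x => [|c p x IHx]; first by rewrite mul0r !linear0 rep_act0.
rewrite mulrDl -scalerAl !rep_act_linr rep_act_linl IHx.
apply: (congr1 (fun z => c *: z + _)) => {x IHx}.
elim/cat_ind: y => [|d q y IHy]; first by rewrite mulr0 !linear0.
rewrite mulrDr -scalerAr !rep_act_linr IHy.
apply: (congr1 (fun z => d *: z + _)) => {y IHy}.
rewrite cat_eltM !rep_actE path_act_comp -[Defs.comp p q]/(path_comp p q).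
by case: (path_comp p q) => [r|] /=; [exact: rep_actE | exact: linear0].
Qed.

Lemma rep_act_vertex w v : rep_act w (vertex_elt v) = actv v w.
Proof. exact: rep_actE. Qed.

Lemma rep_act_arrow w a : rep_act w (arrow_elt K a) = acta a w.
Proof. by rewrite rep_actE /path_act /= actva eqxx. Qed.

Lemma rep_act_word w v s :
  rep_act w (word_elt v s) = foldl (fun x a => acta a x) (actv v w) s.
Proof.
elim/last_ind: s => [|s a IHs]; first exact: rep_act_vertex.
by rewrite /word_elt !foldl_rcons rep_actM rep_act_arrow IHs.
Qed.

Lemma rep_act_ideal (S : KQ -> Prop) : (forall x w, S x -> rep_act w x = 0) ->
  forall x w, x \in gen_ideal S -> rep_act w x = 0.
Proof.
move=> S0 x w /gen_idealP/(_ (fun x => forall w, rep_act w x = 0)); apply=> {x w}.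
  split=> [w|x y x0 y0 w|a x b x0 w]; first exact: linear0.
    by have := rep_act_linr w 1 x y; rewrite !scale1r x0 y0 addr0.
  by rewrite !rep_actM x0 rep_act0.
by move=> x Sx w; apply: S0.
Qed.

End Representation.

End PathAlgebra.

(** * The twelve-dimensional representation defined by the table *)

Section Lambda3Basis.
Variables (K : fieldType) (char2 : 2%N \in [pchar K]) (lam : K).
Hypotheses (lam_neq0 : lam != 0) (lam_neq1 : lam != 1).

Local Notation KQ := (path_alg K lambda_quiver).
Local Notation W := {ffun lambda_bas -> K^o}.

Definition unit_vec (i : lambda_bas) : W := [ffun j => (j == i)%:R].

Lemma unit_vec_coord j i : idfun (unit_vec j) i = (i == j)%:R.
Proof. by rewrite ffunE. Qed.

Lemma unit_vec_sum (w : W) : w = \sum_i idfun w i *: unit_vec i.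
Proof.
apply/ffunP => j; rewrite sum_ffunE (bigD1 j) //= big1 ?addr0 => [|i ij].
  by rewrite !ffunE eqxx [_ *: _]mulr1.
by rewrite !ffunE eq_sym (negPf ij) scaler0.
Qed.

Definition unit_basis : module_basis W lambda_bas := ModuleBasis unit_vec_coord unit_vec_sum.

Definition vec_vertex (v : lambda_vertex) : {linear W -> W} :=
  lop lam unit_vec (vertex_table^~ v).
Definition vec_arrow (a : lambda_arrow) : {linear W -> W} :=
  lop lam unit_vec (arrow_table^~ a).

Lemma vec_vertexE v i : vec_vertex v (unit_vec i) = lev lam unit_vec (vertex_table i v).
Proof. exact: (lop_bas lam unit_basis). Qed.

Lemma vec_arrowE a i : vec_arrow a (unit_vec i) = lev lam unit_vec (arrow_table i a).
Proof. exact: (lop_bas lam unit_basis). Qed.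

Lemma vec_vertex_lev v x :
  vec_vertex v (lev lam unit_vec x) = lev lam unit_vec (lbind (vertex_table^~ v) x).
Proof. by rewrite lev_linear lev_bind //; apply: eq_lev => i; exact: vec_vertexE. Qed.

Lemma vec_arrow_lev a x :
  vec_arrow a (lev lam unit_vec x) = lev lam unit_vec (lbind (arrow_table^~ a) x).
Proof. by rewrite lev_linear lev_bind //; apply: eq_lev => i; exact: vec_arrowE. Qed.

Lemma vec_word_lev s x :
  foldl (fun w a => vec_arrow a w) (lev lam unit_vec x) s = lev lam unit_vec (word_act x s).
Proof. by elim: s x => //= a s IHs x; rewrite vec_arrow_lev -lev_norm // IHs. Qed.

Lemma vec_vertex_vertex v v' w :
  vec_vertex v' (vec_vertex v w) = if v == v' then vec_vertex v w else 0.
Proof.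
pose f := vec_vertex v' \o vec_vertex v.
case: eqP => [<-|vv].
  apply: (eq_linear_bas (b := unit_basis) (f := vec_vertex v \o vec_vertex v)
    (g := vec_vertex v)) => i /=.
  by rewrite vec_vertexE vec_vertex_lev; apply: lev_eq => //; case: v i {f} => -[].
apply: (eq_linear_bas (b := unit_basis) (f := f) (g := \0)) => i /=.
rewrite vec_vertexE vec_vertex_lev; apply: lev_nilp => //.
by case: v v' i vv {f} => -[] [] // /(_ erefl).
Qed.

Lemma vec_vertex_arrow v a w :
  vec_arrow a (vec_vertex v w) = if lambda_src a == v then vec_arrow a w else 0.
Proof.
pose f := vec_arrow a \o vec_vertex v.
case: eqP => [av|av].
  apply: (eq_linear_bas (b := unit_basis) (f := f) (g := vec_arrow a)) => i /=.
  rewrite vec_vertexE vec_arrow_lev vec_arrowE; apply: lev_eq => //.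
  by rewrite -av {f av}; case: a i => -[].
apply: (eq_linear_bas (b := unit_basis) (f := f) (g := \0)) => i /=.
rewrite vec_vertexE vec_arrow_lev; apply: lev_nilp => //.
by case: a v i av {f} => -[] [] // /(_ erefl).
Qed.

Lemma vec_arrow_vertex a v w :
  vec_vertex v (vec_arrow a w) = if lambda_tgt a == v then vec_arrow a w else 0.
Proof.
pose f := vec_vertex v \o vec_arrow a.
case: eqP => [av|av].
  apply: (eq_linear_bas (b := unit_basis) (f := f) (g := vec_arrow a)) => i /=.
  rewrite vec_arrowE vec_vertex_lev; apply: lev_eq => //.
  by rewrite -av {f av}; case: a i => -[].
apply: (eq_linear_bas (b := unit_basis) (f := f) (g := \0)) => i /=.
rewrite vec_arrowE vec_vertex_lev; apply: lev_nilp => //.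
by case: a v i av {f} => -[] [] // /(_ erefl).
Qed.

Definition vec_act (w : W) (x : KQ) : W :=
  rep_act (Q := lambda_quiver) vec_vertex vec_arrow w x.

Lemma vec_actM w x y : vec_act w (x * y) = vec_act (vec_act w x) y.
Proof. exact: (rep_actM (Q := lambda_quiver) vec_vertex_vertex vec_arrow_vertex). Qed.

Lemma vec_act_arrow w a : vec_act w (@arrow_elt K lambda_quiver a) = vec_arrow a w.
Proof. exact: (rep_act_arrow (Q := lambda_quiver) vec_vertex_arrow). Qed.

Lemma vec_act_word w v s : vec_act w (@word_elt K lambda_quiver v s) =
  foldl (fun x a => vec_arrow a x) (vec_vertex v w) s.
Proof.
exact: (rep_act_word (Q := lambda_quiver) vec_vertex_vertex vec_vertex_arrow vec_arrow_vertex).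
Qed.

Lemma vec_act_lin w c x y : vec_act w (c *: x + y) = c *: vec_act w x + vec_act w y.
Proof. exact: rep_act_linr. Qed.

Lemma vec_actB w x y : vec_act w (x - y) = vec_act w x - vec_act w y.
Proof. by have := vec_act_lin w (-1) y x; rewrite !scaleN1r ![- _ + _]addrC. Qed.

Lemma vec_actD w x y : vec_act w (x + y) = vec_act w x + vec_act w y.
Proof. by have := vec_act_lin w 1 x y; rewrite !scale1r. Qed.

Lemma vec_act0 w : vec_act w 0 = 0.
Proof. by rewrite -(subrr 0) vec_actB subrr. Qed.

Lemma vec_actZ w c x : vec_act w (c *: x) = c *: vec_act w x.
Proof. by rewrite -[c *: x]addr0 vec_act_lin vec_act0 addr0. Qed.

Definition vec_word (s : seq lambda_arrow) (w : W) : W := foldl (fun u a => vec_arrow a u) w s.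

Arguments vec_word : simpl never.

Lemma vec_word_is_linear s : linear (vec_word s).
Proof. by rewrite /vec_word; elim: s => //= a s IHs c u v; rewrite linearP IHs. Qed.

HB.instance Definition _ s := GRing.isLinear.Build K W W *:%R (vec_word s) (vec_word_is_linear s).

Lemma vec_wordE s i : vec_word s (unit_vec i) = lev lam unit_vec (word_act (lone i) s).
Proof. by rewrite -vec_word_lev lev_one. Qed.

Lemma cev_cl : cev lam cl = lam.
Proof. by rewrite /= mulr0 addr0 mulr1 add0r. Qed.

Lemma vec_act_rels x w : Lambda3_rels lam x -> vec_act w x = 0.
Proof.
rewrite /Lambda3_rels !inE; case/or4P => [/eqP->|/eqP->|/eqP->|/orP[]/eqP->];
  rewrite ?(vec_actB, vec_actD, vec_actZ) ?exprS ?expr0 ?mulr1 ?vec_actM ?vec_act_arrow;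
  try (apply/eqP; rewrite subr_eq0; apply/eqP).
- apply: (eq_linear_bas (b := unit_basis) (f := vec_word [:: alpha; alpha])
    (g := vec_word [:: sigma; gamma] \+ vec_word [:: alpha; alpha; alpha])) => i.
  by rewrite /= !vec_wordE -lev_cat; apply: lev_eq => //; case: i.
- apply: (eq_linear_bas (b := unit_basis) (f := lam \*: vec_word [:: beta; beta])
    (g := vec_word [:: gamma; sigma])) => i.
  by rewrite /= !vec_wordE -{1}cev_cl -lev_scale //; apply: lev_eq => //; case: i.
- apply: (eq_linear_bas (b := unit_basis) (f := vec_word [:: gamma; alpha])
    (g := vec_word [:: beta; gamma])) => i.
  by rewrite /= !vec_wordE; apply: lev_eq => //; case: i.
- apply: (eq_linear_bas (b := unit_basis) (f := vec_word [:: alpha; sigma])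
    (g := vec_word [:: sigma; beta])) => i.
  by rewrite /= !vec_wordE; apply: lev_eq => //; case: i.
- apply: (eq_linear_bas (b := unit_basis) (f := vec_word [:: alpha; alpha; alpha; alpha])
    (g := \0)) => i.
  by rewrite /= vec_wordE; apply: lev_nilp => //; case: i.
Qed.

(** The action descends to A; applied to the vector of 1 it supplies coordinates, hence the linear
    independence of the twelve words. *)
Lemma vec_act_ideal x w : x \in gen_ideal (Lambda3_rels lam) -> vec_act w x = 0.
Proof.
exact: (rep_act_ideal (Q := lambda_quiver) vec_vertex_vertex vec_arrow_vertex
  (fun x w => @vec_act_rels x w)).
Qed.

Local Notation L := (Lambda3 lam).
Local Notation q := (quot_pi (Lambda3_rels lam)).

Definition lambda_vx (v : lambda_vertex) : L := q (@vertex_elt K lambda_quiver v).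
Definition lambda_ar (a : lambda_arrow) : L := q (@arrow_elt K lambda_quiver a).
Lemma q_word v s : q (@word_elt K lambda_quiver v s) =
  foldl (fun x a => x * lambda_ar a) (lambda_vx v) s :> L.
Proof.
elim/last_ind: s => // s a IHs; rewrite /word_elt !foldl_rcons [LHS]quot_piME.
by rewrite -IHs.
Qed.

Lemma vxM v w : lambda_vx v * lambda_vx w = if v == w then lambda_vx v else 0.
Proof.
rewrite -[LHS]quot_piME vertex_eltM; case: eqP => //= _; exact: quot_pi0.
Qed.

Lemma vx_ar v a : lambda_vx v * lambda_ar a = if lambda_src a == v then lambda_ar a else 0.
Proof.
rewrite -[LHS]quot_piME vertex_arrow; case: eqP => //= _; exact: quot_pi0.
Qed.

Lemma ar_vx a v : lambda_ar a * lambda_vx v = if lambda_tgt a == v then lambda_ar a else 0.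
Proof.
rewrite -[LHS]quot_piME arrow_vertex; case: eqP => //= _; exact: quot_pi0.
Qed.

Local Notation x_ := (lambda_ar alpha).
Local Notation s_ := (lambda_ar sigma).
Local Notation g_ := (lambda_ar gamma).
Local Notation y_ := (lambda_ar beta).

Lemma q_rel x y : Lambda3_rels lam (x - y) -> q x = q y.
Proof. exact: quot_eq. Qed.

Lemma rel_xx : x_ * x_ = s_ * g_ + x_ * x_ * x_.
Proof.
rewrite -[x_ * x_]quot_piME -[_ * x_]quot_piME -[s_ * g_]quot_piME -[RHS]quot_piD; apply: q_rel.
rewrite -expr2 -exprSr; exact: mem_head.
Qed.

Lemma rel_yy : lam *: (y_ * y_) = g_ * s_.
Proof.
rewrite -[y_ * y_]quot_piME -quot_piZE -[RHS]quot_piME; apply: q_rel.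
by rewrite -expr2; apply/predU1P; right; apply/orP; left; exact: eqxx.
Qed.

Lemma rel_gx : g_ * x_ = y_ * g_.
Proof.
rewrite -[LHS]quot_piME -[RHS]quot_piME; apply: q_rel.
by apply/predU1P; right; do 1![apply/orP; right]; apply/orP; left; exact: eqxx.
Qed.

Lemma rel_xs : x_ * s_ = s_ * y_.
Proof.
rewrite -[LHS]quot_piME -[RHS]quot_piME; apply: q_rel.
by apply/predU1P; right; do 2![apply/orP; right]; apply/orP; left; exact: eqxx.
Qed.

Lemma rel_x4 : x_ * x_ * x_ * x_ = 0.
Proof.
have -> : x_ * x_ * x_ * x_ = q (@arrow_elt K lambda_quiver alpha ^+ 4).
  by rewrite !exprSr expr0 mul1r !quot_piME.
rewrite -(@quot_pi0 K _ (Lambda3_rels lam)); apply: q_rel; rewrite subr0.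
by apply/predU1P; right; do 3![apply/orP; right]; apply/orP; left; exact: eqxx.
Qed.

End Lambda3Basis.

(** * The table in any algebra satisfying the relations *)

Section Table.
Variables (K : fieldType) (char2 : 2%N \in [pchar K]) (lam : K) (A : algType K).
Variables (vx : lambda_vertex -> A) (ar : lambda_arrow -> A).
Hypotheses (lam_neq0 : lam != 0) (lam_neq1 : lam != 1).
Hypothesis vxM : forall v w, vx v * vx w = if v == w then vx v else 0.
Hypothesis vx_ar : forall v a, vx v * ar a = if lambda_src a == v then ar a else 0.
Hypothesis ar_vx : forall a v, ar a * vx v = if lambda_tgt a == v then ar a else 0.
Local Notation x_ := (ar alpha).
Local Notation s_ := (ar sigma).
Local Notation g_ := (ar gamma).
Local Notation y_ := (ar beta).
Hypotheses (xx : x_ * x_ = s_ * g_ + x_ * x_ * x_) (yy : lam *: (y_ * y_) = g_ * s_).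
Hypotheses (gx : g_ * x_ = y_ * g_) (xs : x_ * s_ = s_ * y_) (x4 : x_ * x_ * x_ * x_ = 0).

Definition word_val (i : lambda_bas) : A :=
  foldl (fun x a => x * ar a) (vx (bas_src i)) (bas_word i).

Lemma word_val_vertex i v : word_val i * vx v = lev lam word_val (vertex_table i v).
Proof.
have -> : word_val i * vx v = if bas_tgt i == v then word_val i else 0.
  by case: i; rewrite /word_val /= -?mulrA ?vxM ?ar_vx; case: eqP; rewrite ?mulr0.
by rewrite /vertex_table; case: eqP => _; rewrite ?lev_one ?lev_nil.
Qed.

Lemma word_val_arrow i a : word_val i * ar a = lev lam word_val (arrow_table i a).
Proof.
have [E|N] := eqVneq (bas_tgt i) (lambda_src a); last first.
  (* Inserting the idempotents at the end of the word and at the start of the arrow exposes a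
     product of two different ones. *)
  have -> : word_val i * ar a = word_val i * vx (bas_tgt i) * (vx (lambda_src a) * ar a).
    by rewrite word_val_vertex vx_ar eqxx /vertex_table eqxx lev_one.
  rewrite -mulrA (mulrA (vx _)) vxM (negPf N) mul0r mulr0.
  by case: i a N => -[] // _; rewrite lev_nil.
have xxs := aas_eq0 lam_neq1 xx yy xs x4.
have gxx := gaa_eq0 lam_neq1 xx yy gx x4.
have yyg := bbg_eq0 lam_neq1 xx yy gx x4.
have y4 := b4_eq0 lam_neq0 lam_neq1 xx yy gx x4.
have sg := sg_eq xx.
have xsg := asg_eq xx x4.
have gxs := gas_eq yy gx.
have opp2 (z : A) : - z = z by rewrite -scaleN1r (oppr_pchar2 char2) scale1r.
have cl_lam := cev_cl lam.
case: i a E => -[] //= _; rewrite ?lev_one ?lev_nil ?lev_cons ?lev_nil ?cl_lam;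
  rewrite /word_val /= ?vx_ar /= ?mulr0 ?addr0 ?scale1r ?(xxs, gxx, yyg, y4, xsg, gxs, sg, opp2) //.
(* The cases left are alpha^3 sigma, beta^3 gamma and alpha sigma beta. *)
- by rewrite -!mulrA (mulrA x_ x_ s_) xxs mulr0.
- by rewrite -!mulrA (mulrA y_ y_ g_) yyg mulr0.
- by rewrite -mulrA -xs mulrA xxs.
Qed.

End Table.

(** * The twelve words form a basis *)

Section Lambda3ModuleBasis.
Variables (K : fieldType) (char2 : 2%N \in [pchar K]) (lam : K).
Hypotheses (lam_neq0 : lam != 0) (lam_neq1 : lam != 1).

Local Notation KQ := (path_alg K lambda_quiver).
Local Notation W := {ffun lambda_bas -> K^o}.
Local Notation L := (Lambda3 lam).
Local Notation q := (quot_pi (Lambda3_rels lam)).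
Local Notation vx := (lambda_vx lam).
Local Notation ar := (lambda_ar lam).
Local Notation unit_vec := (unit_vec K).

Definition lambda_elt : lambda_bas -> L := word_val vx ar.

Lemma lambda_elt_vertex i v : lambda_elt i * vx v = lev lam lambda_elt (vertex_table i v).
Proof. exact: (word_val_vertex lam (vxM lam) (ar_vx lam)). Qed.

Lemma lambda_elt_arrow i a : lambda_elt i * ar a = lev lam lambda_elt (arrow_table i a).
Proof.
exact: (word_val_arrow char2 lam_neq0 lam_neq1 (vxM lam) (vx_ar lam) (ar_vx lam) (rel_xx lam)
  (rel_yy lam) (rel_gx lam) (rel_xs lam) (rel_x4 lam)).
Qed.

Definition vec_val : {linear W -> L} := lop lam lambda_elt (@lone lambda_bas).

Lemma vec_val_unit i : vec_val (unit_vec i) = lambda_elt i.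
Proof.
apply: etrans (lop_bas lam (unit_basis K) lambda_elt (@lone lambda_bas) i) _.
exact: lev_one.
Qed.

Lemma vec_val_lev x : vec_val (lev lam unit_vec x) = lev lam lambda_elt x.
Proof. by rewrite lev_linear; apply: eq_lev => i; exact: vec_val_unit. Qed.

Lemma vec_valE w : vec_val w = \sum_i w i *: lambda_elt i.
Proof. by apply: eq_bigr => i _; rewrite lev_one. Qed.

Lemma vec_val_mul (w : W) (z : L) (T : lambda_bas -> lin lambda_bas) :
  (forall i, lambda_elt i * z = lev lam lambda_elt (T i)) ->
  vec_val (lop lam unit_vec T w) = vec_val w * z.
Proof.
move=> Tz; rewrite lop_linear vec_valE mulr_suml; apply: eq_bigr => i _.
rewrite -scalerAl Tz; apply: (congr1 (fun u => w i *: u)).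
by apply: eq_lev => j; exact: vec_val_unit.
Qed.

(** [vec_val] carries the representation to right multiplication in A. With w the vector of 1 it
    recovers the class of x, so the words span. *)
Lemma vec_val_act w x : vec_val (vec_act lam w x) = vec_val w * q x.
Proof.
elim/path_alg_ind: x => [|c v s x IHx].
  by rewrite vec_act0 linear0 quot_pi0 mulr0.
have -> : q (c *: word_elt K v s + x) = c *: q (word_elt K v s) + q x.
  exact: quot_pi_is_linear.
rewrite mulrDr -scalerAr vec_act_lin linearP IHx.
apply: (congr1 (fun z => c *: z + _)) => {IHx}.
rewrite q_word vec_act_word //; elim/last_ind: s => [|s a IHs] /=.
  by apply: vec_val_mul => i; exact: lambda_elt_vertex.
rewrite !foldl_rcons mulrA -IHs.
by apply: vec_val_mul => i; exact: lambda_elt_arrow.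
Qed.

Definition vec_one : lin lambda_bas := lone a0 ++ lone b0.

Lemma vec_val_one : vec_val (lev lam unit_vec vec_one) = 1.
Proof.
have -> : 1 = q (@vertex_elt K lambda_quiver vtx1 + @vertex_elt K lambda_quiver vtx2).
  congr (q _); rewrite [LHS]/(cat_one K _) /cat_one big_map big_enum /=.
  rewrite (bigD1 vtx1) //= (bigD1 vtx2) //= big1 ?addr0 //.
  by case.
have -> : q (@vertex_elt K lambda_quiver vtx1 + @vertex_elt K lambda_quiver vtx2)
    = vx vtx1 + vx vtx2 by exact: quot_piD.
by rewrite vec_val_lev lev_pair.
Qed.

Lemma lambda_elt_one : lambda_elt a0 + lambda_elt b0 = 1.
Proof. by rewrite -vec_val_one vec_val_lev lev_pair. Qed.

Definition lambda_coord_pre (x : KQ) : W := vec_act lam (lev lam unit_vec vec_one) x.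

Lemma lambda_coord_pre_is_linear : linear lambda_coord_pre.
Proof. by move=> c x y; rewrite /lambda_coord_pre vec_act_lin. Qed.

HB.instance Definition _ := GRing.isLinear.Build K KQ W *:%R
  lambda_coord_pre lambda_coord_pre_is_linear.

Lemma lambda_coord_pre_ideal x :
  x \in gen_ideal (Lambda3_rels lam) -> lambda_coord_pre x = 0.
Proof. exact: vec_act_ideal. Qed.

Definition lambda_coord : {linear L -> W} := quot_lift lambda_coord_pre_ideal.
Arguments lambda_coord : simpl never.

Lemma lambda_coord_pi x : lambda_coord (q x) = vec_act lam (lev lam unit_vec vec_one) x.
Proof. exact: (quot_lift_pi lambda_coord_pre_ideal). Qed.

Lemma lambda_elt_pi i : lambda_elt i = q (@word_elt K lambda_quiver (bas_src i) (bas_word i)).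
Proof. by rewrite q_word. Qed.

Lemma lambda_coord_elt j i : lambda_coord (lambda_elt j) i = (i == j)%:R.
Proof.
rewrite lambda_elt_pi lambda_coord_pi vec_act_word // vec_vertex_lev // vec_word_lev //.
rewrite (@lev_eq _ char2 _ _ _ _ _ (lone j)); first by rewrite lev_one ffunE.
by case: j.
Qed.

Lemma lambda_elt_coord a : a = \sum_i lambda_coord a i *: lambda_elt i.
Proof.
rewrite -vec_valE -{2}(quot_repr a) lambda_coord_pi vec_val_act vec_val_one mul1r.
by rewrite quot_repr.
Qed.

Definition lambda_basis : module_basis L lambda_bas :=
  ModuleBasis lambda_coord_elt lambda_elt_coord.

Lemma lambda_tableP : mult_table lam lambda_basis lambda_table.
Proof.
move=> i j; rewrite [X in _ * X]lambda_elt_pi -[X in X * _]vec_val_unit -vec_val_act.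
rewrite vec_act_word // vec_vertexE vec_word_lev //.
exact: vec_val_lev.
Qed.

End Lambda3ModuleBasis.

(** * The minimal resolution *)

Definition pos : finType := (lambda_bas * lambda_bas)%type.

(* The minimal bimodule resolution starts with
   P0 = P3 = sum over the vertices v of A e_v (x) e_v A and
   P1 = P2 = sum over the arrows c of A e_(src c) (x) e_(tgt c) A,
   where the generator of P2 attached to c stands for the relation r_c parallel
   to the arrow c.  D2 is given by the Fox derivatives of the relations, and D3 by
   the identities alpha r_alpha + r_alpha alpha = sigma r_gamma + r_sigma gamma and
   beta r_beta + r_beta beta = gamma r_sigma + r_gamma sigma. *)
Definition D1 (a : lambda_arrow) : lin (lambda_vertex * pos) :=
  [:: (c1, (lambda_src a, (bas_vertex (lambda_src a), bas_arrow a)));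
      (c1, (lambda_tgt a, (bas_arrow a, bas_vertex (lambda_tgt a))))].

Definition D2 (a : lambda_arrow) : lin (lambda_arrow * pos) :=
  match a with
  | alpha => [:: (c1, (alpha, (a0, a1))); (c1, (alpha, (a1, a0)));
                 (c1, (sigma, (a0, g0))); (c1, (gamma, (s0, a0)));
                 (c1, (alpha, (a0, a2))); (c1, (alpha, (a1, a1))); (c1, (alpha, (a2, a0)))]
  | beta => [:: (cl, (beta, (b0, b1))); (cl, (beta, (b1, b0)));
                (c1, (gamma, (b0, s0))); (c1, (sigma, (g0, b0)))]
  | gamma => [:: (c1, (gamma, (b0, a1))); (c1, (alpha, (g0, a0)));
                 (c1, (beta, (b0, g0))); (c1, (gamma, (b1, a0)))]
  | sigma => [:: (c1, (alpha, (a0, s0))); (c1, (sigma, (a1, b0)));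
                 (c1, (sigma, (a0, b1))); (c1, (beta, (s0, b0)))]
  end.

Definition D3 (v : lambda_vertex) : lin (lambda_arrow * pos) :=
  match v with
  | vtx1 => [:: (c1, (alpha, (a0, a1))); (c1, (alpha, (a1, a0)));
                (c1, (gamma, (s0, a0))); (c1, (sigma, (a0, g0)))]
  | vtx2 => [:: (c1, (beta, (b0, b1))); (c1, (beta, (b1, b0)));
                (c1, (sigma, (g0, b0))); (c1, (gamma, (b0, s0)))]
  end.

(** A right A-linear map is given by its values S on elements with left factor b_i and trivial right
    factor. *)
Definition right_extend (T T' : finType) (S : T -> lambda_bas -> lin (T' * pos))
  (x : T * pos) : lin (T' * pos) :=
  lbind (fun y => lbind (fun r => lone (y.1, (y.2.1, r))) (lambda_table y.2.2 x.2.2)) (S x.1 x.2.1).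

Definition idem0 (v : lambda_vertex) : pos := (bas_vertex v, bas_vertex v).
Definition idem1 (a : lambda_arrow) : pos :=
  (bas_vertex (lambda_src a), bas_vertex (lambda_tgt a)).

Definition tens_table := tensor_table lambda_table.

(* Right A-linear homotopies for the filtration by path length: h0 contracts the
   resolution, whereas h1 and h2, which carry the factor lambda (1 + lambda), do so
   only for the associated graded algebra, where alpha^2 = sigma gamma. *)
Definition h0 (v : lambda_vertex) (i : lambda_bas) : lin (lambda_arrow * pos) :=
  match v, i with
  | vtx1, a1 => [:: (c1, (alpha, (a0, a0)))]
  | vtx1, a2 => [:: (c1, (alpha, (a0, a1))); (c1, (alpha, (a1, a0)))]
  | vtx1, a3 => [:: (c1, (alpha, (a0, a2))); (c1, (alpha, (a1, a1))); (c1, (alpha, (a2, a0)))]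
  | vtx1, g0 => [:: (c1, (gamma, (b0, a0)))]
  | vtx1, g1 => [:: (c1, (gamma, (b0, a1))); (c1, (alpha, (g0, a0)))]
  | vtx2, b1 => [:: (c1, (beta, (b0, b0)))]
  | vtx2, b2 => [:: (c1, (beta, (b0, b1))); (c1, (beta, (b1, b0)))]
  | vtx2, b3 => [:: (c1, (beta, (b0, b2))); (c1, (beta, (b1, b1))); (c1, (beta, (b2, b0)))]
  | vtx2, s0 => [:: (c1, (sigma, (a0, b0)))]
  | vtx2, s1 => [:: (c1, (alpha, (a0, s0))); (c1, (sigma, (a1, b0)))]
  | _, _ => [::]
  end.

(* lambda (1 + lambda), lambda^2 and 1 + lambda *)
Definition cd : coef := [:: false; true; true].
Definition cl2 : coef := [:: false; false; true].
Definition cm : coef := [:: true; true].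

Definition h1 (a : lambda_arrow) (i : lambda_bas) : lin (lambda_arrow * pos) :=
  match a, i with
  | alpha, a3 => [:: (cl, (alpha, (a0, a2))); (cd, (alpha, (a2, a0))); (cl, (beta, (s0, g0)));
                     (cl2, (sigma, (a1, g0))); (cl2, (sigma, (a0, g1)))]
  | alpha, g1 => [:: (cl2, (gamma, (b0, a1))); (cl2, (gamma, (b1, a0)));
                     (cl, (alpha, (g0, a0))); (cl, (beta, (b0, g0)))]
  | sigma, a2 => [:: (cl2, (sigma, (a0, b1))); (cl2, (sigma, (a1, b0)));
                     (cl, (alpha, (a0, s0))); (cl, (beta, (s0, b0)))]
  | sigma, a3 => [:: (cl, (alpha, (a0, s1))); (cl2, (sigma, (a0, b2))); (cd, (sigma, (a2, b0)));
                     (cl2, (sigma, (a1, b1))); (cl, (beta, (s0, b1)))]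
  | sigma, g0 => [:: (cd, (beta, (b0, b0)))]
  | sigma, g1 => [:: (cd, (gamma, (b0, s0))); (cd, (beta, (b1, b0)))]
  | gamma, s0 => [:: (cd, (alpha, (a0, a0)))]
  | gamma, s1 => [:: (cd, (alpha, (a1, a0)))]
  | gamma, b1 => [:: (cd, (gamma, (b0, a0)))]
  | gamma, b2 => [:: (cl, (alpha, (g0, a0))); (cl, (gamma, (b0, a1)));
                     (cl, (gamma, (b1, a0))); (cl, (beta, (b0, g0)))]
  | gamma, b3 => [:: (cl, (gamma, (b1, a1))); (cl, (alpha, (g0, a1))); (cl, (gamma, (b0, a2)));
                     (cl, (beta, (b0, g1))); (cd, (gamma, (b2, a0)))]
  | beta, s0 => [:: (cd, (sigma, (a0, b0)))]
  | beta, s1 => [:: (cl2, (sigma, (a0, b1))); (cl, (alpha, (a0, s0)));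
                    (cl, (sigma, (a1, b0))); (cl, (beta, (s0, b0)))]
  | beta, b3 => [:: (c1, (alpha, (g0, s0))); (c1, (gamma, (b0, s1))); (cl, (beta, (b0, b2)));
                    (c1, (gamma, (b1, s0))); (cm, (beta, (b2, b0)))]
  | _, _ => [::]
  end.

Definition h2 (a : lambda_arrow) (i : lambda_bas) : lin (lambda_vertex * pos) :=
  match a, i with
  | alpha, a3 => [:: (cd, (vtx1, (a2, a0)))]
  | alpha, g1 => [:: (cd, (vtx1, (g0, a0))); (cd, (vtx2, (b0, g0)))]
  | beta, s1 => [:: (cd, (vtx1, (a0, s0))); (cd, (vtx2, (s0, b0)))]
  | beta, b3 => [:: (cd, (vtx2, (b2, b0)))]
  | gamma, s0 => [:: (cd, (vtx1, (a0, a0)))]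
  | gamma, s1 => [:: (cd, (vtx1, (a1, a0)))]
  | gamma, b3 => [:: (cm, (vtx1, (g0, a1))); (cm, (vtx1, (g1, a0)));
                     (cm, (vtx2, (b1, g0))); (cm, (vtx2, (b0, g1)))]
  | sigma, a3 => [:: (cd, (vtx1, (a1, s0))); (cd, (vtx1, (a0, s1)));
                     (cd, (vtx2, (s0, b1))); (cd, (vtx2, (s1, b0)))]
  | sigma, g0 => [:: (cd, (vtx2, (b0, b0)))]
  | sigma, g1 => [:: (cd, (vtx2, (b1, b0)))]
  | _, _ => [::]
  end.

(** The augmentation followed by its right A-linear section, which sends a path r starting at v to
    e_v (x) r; it vanishes on the kernel of the augmentation. *)
Definition aug_homotopy (x : lambda_vertex * pos) : lin (lambda_vertex * pos) :=
  lbind (fun r => lone (bas_src r, (bas_vertex (bas_src r), r)))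
    (lbind (lambda_table^~ x.2.2) (lambda_table x.2.1 (bas_vertex x.1))).

Definition poss := [seq (i, j) | i <- lambda_basis_seq, j <- lambda_basis_seq].

(** * The cochain complex *)

(* There are no cochains in degree -1. *)
Definition D0 (v : lambda_vertex) : lin (void * pos) := [::].
Definition k0 (x : lambda_vertex * lambda_bas) : lin (void * lambda_bas) := [::].

(* lambda times a contraction of the complex of cochains onto its cohomology. *)
Definition k1 (x : lambda_arrow * lambda_bas) : lin (lambda_vertex * lambda_bas) :=
  match x with
  | (sigma, s0) => [:: (cl, (vtx2, b0))]
  | (sigma, s1) => [:: (cl, (vtx2, b1))]
  | _ => [::]
  end.

Definition k2 (x : lambda_arrow * lambda_bas) : lin (lambda_arrow * lambda_bas) :=
  match x with
  | (alpha, a2) => [:: (cl, (alpha, a0)); (cl, (beta, b0))]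
  | (alpha, a3) => [:: (cl, (alpha, a1)); (cl, (beta, b1))]
  | (beta, b2) => [:: (c1, (gamma, g0)); (c1, (alpha, a0)); (c1, (beta, b0));
                      (c1, (alpha, a1)); (c1, (beta, b1))]
  | (beta, b3) => [:: (c1, (gamma, g1)); (c1, (alpha, a1)); (c1, (beta, b1))]
  | (sigma, s0) => [:: (cl, (beta, b0))]
  | (sigma, s1) => [:: (cl, (beta, b1))]
  | _ => [::]
  end.

Definition k3 (x : lambda_vertex * lambda_bas) : lin (lambda_arrow * lambda_bas) :=
  match x with
  | (vtx2, b2) => [:: (c1, (gamma, g0))]
  | (vtx2, b3) => [:: (c1, (gamma, g1))]
  | _ => [::]
  end.

(** A basis of the centre: alpha + beta is central by alpha sigma = sigma beta and gamma alpha =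
    beta gamma, and the higher powers of alpha and of beta annihilate sigma and gamma on both
    sides. *)
Definition HH0_classes : seq (lin (lambda_vertex * lambda_bas)) :=
  [:: [:: (c1, (vtx1, a0)); (c1, (vtx2, b0))]; [:: (c1, (vtx1, a1)); (c1, (vtx2, b1))];
      lone (vtx1, a2); lone (vtx1, a3); lone (vtx2, b2); lone (vtx2, b3)].

Definition HH0_coord (x : lambda_vertex * lambda_bas) : lin nat :=
  match x with
  | (vtx1, a0) => [:: (cl, 0)] | (vtx1, a1) => [:: (cl, 1)]
  | (vtx1, a2) => [:: (cl, 2)] | (vtx1, a3) => [:: (cl, 3)]
  | (vtx2, b2) => [:: (cl, 4)] | (vtx2, b3) => [:: (cl, 5)]
  | _ => [::]
  end%N.

(** Derivations moving a single loop. Those with values alpha^2 and beta^2 respect the relations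
    because 2 alpha^3 and 2 lambda beta^3 vanish in characteristic 2. *)
Definition HH1_classes : seq (lin (lambda_arrow * lambda_bas)) :=
  [:: lone (alpha, a2); lone (alpha, a3); lone (beta, b2); lone (beta, b3)].

Definition HH1_coord (x : lambda_arrow * lambda_bas) : lin nat :=
  match x with
  | (alpha, a2) => [:: (cl, 0)] | (alpha, a3) => [:: (cl, 1)]
  | (beta, b2) => [:: (cl, 2)] | (beta, b3) => [:: (cl, 3)]
  | _ => [::]
  end%N.

(** First-order deformations of r_alpha by e_1 or alpha and of r_beta by e_2 or beta; they are
    cocycles because each term of [D3] at a loop occurs on both sides and cancels in characteristic
    2. *)
Definition HH2_classes : seq (lin (lambda_arrow * lambda_bas)) :=
  [:: lone (alpha, a0); lone (alpha, a1); lone (beta, b0); lone (beta, b1)].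

Definition HH2_coord (x : lambda_arrow * lambda_bas) : lin nat :=
  match x with
  | (alpha, a0) => [:: (cl, 0)] | (alpha, a1) => [:: (cl, 1)]
  | (beta, b0) => [:: (cl, 2)] | (beta, b1) => [:: (cl, 3)]
  | _ => [::]
  end%N.

(** * Finite verifications *)

Definition vertex_pos := [seq (t, p) | t <- vertices, p <- poss].
Definition arrow_pos := [seq (t, p) | t <- arrows, p <- poss].
Definition vertex_bas := [seq (t, i) | t <- vertices, i <- lambda_basis_seq].
Definition arrow_bas := [seq (t, i) | t <- arrows, i <- lambda_basis_seq].

Lemma mem_poss p : p \in poss.
Proof. by case: p => i j; apply: allpairs_f; exact: mem_basis. Qed.

Lemma vertex_posP (Pr : pred (lambda_vertex * pos)) : all Pr vertex_pos -> forall x, Pr x.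
Proof.
by move=> /allP H [v p]; apply: H; apply: allpairs_f; [exact: mem_vertices | exact: mem_poss].
Qed.

Lemma arrow_posP (Pr : pred (lambda_arrow * pos)) : all Pr arrow_pos -> forall x, Pr x.
Proof.
by move=> /allP H [v p]; apply: H; apply: allpairs_f; [exact: mem_arrows | exact: mem_poss].
Qed.

Lemma vertex_basP (Pr : pred (lambda_vertex * lambda_bas)) : all Pr vertex_bas -> forall x, Pr x.
Proof.
by move=> /allP H [v p]; apply: H; apply: allpairs_f; [exact: mem_vertices | exact: mem_basis].
Qed.

Lemma arrow_basP (Pr : pred (lambda_arrow * lambda_bas)) : all Pr arrow_bas -> forall x, Pr x.
Proof.
by move=> /allP H [v p]; apply: H; apply: allpairs_f; [exact: mem_arrows | exact: mem_basis].
Qed.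

Lemma D1_fixed : entries_fixed tens_table idem1 idem0 D1.
Proof. by case; split; vm_compute. Qed.

Lemma D2_fixed : entries_fixed tens_table idem1 idem1 D2.
Proof. by case; split; vm_compute. Qed.

Lemma D3_fixed : entries_fixed tens_table idem0 idem1 D3.
Proof. by case; split; vm_compute. Qed.

Lemma D1D2 x : nilp (lnorm (lbind (row_op tens_table D1) (row_op tens_table D2 x))).
Proof. by move: x; apply: arrow_posP; vm_compute. Qed.

Lemma D2D3 x : nilp (lnorm (lbind (row_op tens_table D2) (row_op tens_table D3 x))).
Proof. by move: x; apply: vertex_posP; vm_compute. Qed.

(** One iteration: here the homotopy contracts exactly and the defect itself is zero. *)
Lemma defect0_nilpotent x :
  nilp (iter_defect tens_table D1 idem0 (right_extend h0) aug_homotopy c1 1 x).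
Proof. by move: x; apply: vertex_posP; vm_compute. Qed.

(** [h1] already contains the factor [cd], so [h0] is multiplied by it. The remaining error
    increases path length, and five iterations exhaust it. *)
Lemma defect1_nilpotent x : nilp (iter_defect tens_table D2 idem1 (right_extend h1)
  (prev_homotopy tens_table D1 cd (right_extend h0)) cd 5 x).
Proof. by move: x; apply: arrow_posP; vm_compute. Qed.

(** Both homotopies carry the factor [cd] here, whence the scalar [c1] in front of [h1]. *)
Lemma defect2_nilpotent x : nilp (iter_defect tens_table D3 idem1 (right_extend h2)
  (prev_homotopy tens_table D2 c1 (right_extend h1)) cd 5 x).
Proof. by move: x; apply: arrow_posP; vm_compute. Qed.

(** * The resolution of A and the cohomology dimensions *)

Section Resolution.
Variables (K : fieldType) (char2 : 2%N \in [pchar K]) (lam : K).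
Hypotheses (lam_neq0 : lam != 0) (lam_neq1 : lam != 1).
Variables (A : algType K) (b : module_basis A lambda_bas).
Hypotheses (mtE : mult_table lam b lambda_table) (bas_one : b a0 + b b0 = 1).

Local Notation R := (enveloping A).
Local Notation tb := (tensor_basis b).
Local Notation ent := (row_entry lam tb).
Local Notation M := (bimod A).

Let tE : mult_table lam tb tens_table := tmtE char2 mtE.

Lemma idem0_idem v : tb (idem0 v) * tb (idem0 v) = tb (idem0 v).
Proof.
transitivity (lev lam tb (lone (idem0 v))); last exact: lev_one.
apply: etrans (tE _ _) _; apply: (lev_eq char2).
by case: v.
Qed.

Lemma idem1_idem a : tb (idem1 a) * tb (idem1 a) = tb (idem1 a).
Proof.
transitivity (lev lam tb (lone (idem1 a))); last exact: lev_one.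
apply: etrans (tE _ _) _; apply: (lev_eq char2).
by case: a.
Qed.

Local Notation P0 := (summand (fun v => tb (idem0 v))).
Local Notation P1 := (summand (fun a => tb (idem1 a))).

Definition d0 : {linear P1 -> P0} := basis_map char2 tE D1_fixed.
Definition d1 : {linear P1 -> P1} := basis_map char2 tE D2_fixed.
Definition d2 : {linear P0 -> P1} := basis_map char2 tE D3_fixed.

Lemma cd_neq0 : cev lam cd != 0.
Proof.
rewrite /= !(mulr0, addr0, add0r, mulr1) mulf_neq0 //.
(* In characteristic 2 the factor 1 + lambda is 1 - lambda. *)
rewrite -(oppr_pchar2 char2 lam) subr_eq0 eq_sym //.
Qed.

Lemma c1_neq0 : cev lam c1 != 0.
Proof. by rewrite /= mulr0 addr0 oner_neq0. Qed.

Lemma cl_neq0 : cev lam cl != 0.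
Proof. by rewrite cev_cl. Qed.

Lemma exact1 x : d0 x = 0 <-> exists y, d1 y = x.
Proof.
exact: (exact_step char2 tE D1_fixed D2_fixed idem1_idem D1D2 cd_neq0 defect1_nilpotent).
Qed.

Lemma exact2 x : d1 x = 0 <-> exists y, d2 y = x.
Proof.
exact: (exact_step char2 tE D2_fixed D3_fixed idem0_idem D2D3 cd_neq0 defect2_nilpotent).
Qed.

(** The tuple of the e_v, which makes the augmentation the multiplication map. *)
Definition unit_cochain : {ffun lambda_vertex -> A} := [ffun v => b (bas_vertex v)].

Definition aug : {linear P0 -> M} := hom_of b idem0 unit_cochain.

Lemma sum_vertex (F : lambda_vertex -> A) : \sum_v F v = F vtx1 + F vtx2.
Proof. by rewrite (bigD1 vtx1) //= (bigD1 vtx2) //= big1 ?addr0 //; case. Qed.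

Lemma cob_unit : cob lam b D1 unit_cochain = 0.
Proof.
have -> : unit_cochain = lev lam (row_bas b) (lone (vtx1, a0) ++ lone (vtx2, b0)).
  by rewrite lev_pair; apply/ffunP => -[]; rewrite !ffunE /= ?addr0 ?add0r.
by rewrite (cob_lev char2 mtE _ _ arrows_uniq mem_arrows) lev_nilp.
Qed.

Lemma aug_surj m : exists x, aug x = m.
Proof.
(* The sum of the m e_v (x) e_v is mapped to m (e_1 + e_2) = m. *)
pose v : {ffun lambda_vertex -> R^o} := [ffun t => tensor 1 m * tb (idem0 t)].
have ve t : v t * tb (idem0 t) = v t by rewrite ffunE -mulrA idem0_idem.
exists (to_summand ve); rewrite /aug hom_ofE.
have vm t : act (v t) (unit_cochain t) = m * b (bas_vertex t).
  rewrite !ffunE actE -scalerA -!actE act_tensor mulr1; congr (_ * _).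
  rewrite (act_bas char2 mtE) (@lev_eq _ char2 _ _ _ _ _ (lone (bas_vertex t))) ?lev_one //.
  by case: t.
rewrite (eq_bigr _ (fun t _ => vm t)) -mulr_sumr sum_vertex bas_one.
exact: mulr1.
Qed.

Definition augR (v : {ffun lambda_vertex -> R}) : A := \sum_t act (v t) (unit_cochain t).

Lemma augR_is_linear : linear augR.
Proof.
move=> c v w; rewrite /augR scaler_sumr -big_split; apply: eq_bigr => t _.
by rewrite !ffunE act_linl.
Qed.

HB.instance Definition _ := GRing.isLinear.Build K {ffun lambda_vertex -> R} A *:%R
  augR augR_is_linear.

Lemma augR_bas x : augR (row_bas tb x) =
  lev lam b (lbind (lambda_table^~ x.2.2) (lambda_table x.2.1 (bas_vertex x.1))).
Proof.
case: x => v [i j]; rewrite /augR (bigD1 v) //= big1 ?addr0 => [|t tv].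
  by rewrite !ffunE eqxx (act_bas char2 mtE).
rewrite ffunE (negPf tv) -[LHS]/(act_by (unit_cochain t) 0); exact: linear0.
Qed.

Lemma augR_map w : augR (rowmulK (ent D1) w) = 0.
Proof.
rewrite /augR row_act_map cob_unit; apply: big1 => t _.
by rewrite ffunE linear0.
Qed.

Lemma aug_homotopyE (v : {ffun lambda_vertex -> R}) : augR v = 0 ->
  lop lam (row_bas tb) aug_homotopy (row_coord tb v) = 0.
Proof.
pose s i := lone (bas_src i, (bas_vertex (bas_src i), i)).
pose f : {linear {ffun lambda_vertex -> R} -> {ffun lambda_vertex -> R}} :=
  lop lam (row_bas tb) aug_homotopy \o row_coord tb.
pose sA : {linear A -> {ffun lambda_vertex -> R}} := lop lam (row_bas tb) s \o bcoord b.
pose g : {linear {ffun lambda_vertex -> R} -> {ffun lambda_vertex -> R}} := sA \o augR.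
have fg : forall v, f v = g v.
  apply: (eq_linear_bas (b := row_basis lambda_vertex tb)) => x.
  apply: etrans (lop_bas lam (row_basis lambda_vertex tb) _ _ x) _.
  transitivity (sA (augR (row_bas tb x))); last by [].
  rewrite augR_bas (lev_linear lam sA).
  apply: etrans (lev_bind char2 _ _ _ _) _; apply: eq_lev => i.
  exact/esym/(lop_bas lam b).
by move=> v0; rewrite -[LHS]/(f v) fg -[LHS]/(sA (augR v)) v0 linear0.
Qed.

Lemma aug_augR (x : P0) : aug x = augR (val x).
Proof. by rewrite /aug hom_ofE. Qed.

Lemma exact0 x : aug x = 0 <-> exists y, d0 y = x.
Proof.
split=> [x0|[y <-]]; last by rewrite aug_augR; exact: augR_map.
apply: (basis_exact char2 tE D1_fixed (Z := fun v => augR v = 0) (c := c1)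
  _ _ idem1_idem c1_neq0 defect0_nilpotent).
- by move=> a v w v0; rewrite linearP /= v0 scaler0 add0r augR_map.
- exact: aug_homotopyE.
- by rewrite -aug_augR.
Qed.

Definition lambda_resolution : proj_resolution M :=
  extended_resolution (summand_projective idem0_idem) (summand_projective idem1_idem)
    (summand_projective idem1_idem) (summand_projective idem0_idem) aug_surj exact0 exact1 exact2.

Lemma Ext_dim_resolution n d : cohomology_dim lambda_resolution M n d -> HH_dim A n d.
Proof. by move=> Pd P; exact: cohomology_dim_indep Pd. Qed.

Lemma HH0_dim : HH_dim A 0 6.
Proof.
apply: Ext_dim_resolution; exists (class_hom lam b idem0 (B := HH0_classes)).
have certH x : homotopy_certificate lambda_table vertices arrows D0 D1 idem0 k0 k1 cl
    HH0_classes HH0_coord x by move: x; apply: vertex_basP; vm_compute.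
have certB : cohomology_certificate lambda_table arrows D1 idem0 cl HH0_classes HH0_coord.
  by vm_compute.
have certD x : nilp (lnorm (lbind HH0_coord (cob_op lambda_table vertices D0 x))) by case: x.1.
(* The sum over the empty type is zero, in agreement with the convention for coboundaries in degree
   0. *)
have cob0 y : cob lam b D0 y = 0.
  by apply/ffunP => t; rewrite !ffunE; apply: big1; case.
split=> [i|f fZ|a aB].
- exact: (class_hom_cocycle char2 mtE arrows_uniq mem_arrows idem0_idem idem1_idem D1_fixed certB).
- have [a [y ay]] := class_hom_span (char2 := char2) (mtE := mtE) (D1e := D1_fixed)
    vertices_uniq mem_vertices arrows_uniq mem_arrows
    idem0_idem idem1_idem cl_neq0 certB certH fZ.
  exists a => x; rewrite -[LHS]/((f \- lincomb a (class_hom lam b idem0 (B := HH0_classes))) x).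
  rewrite (hom_cochain idem0_idem) ay cob0 hom_ofE big1 // => t _.
  by rewrite ffunE linear0.
- have ay : cochain idem0_idem (lincomb a (class_hom lam b idem0 (B := HH0_classes))) =
      cob lam b D0 0.
    by apply/ffunP => t; rewrite cob0 ffunE [RHS]ffunE; exact: aB.
  exact: (class_hom_indep char2 mtE vertices_uniq mem_vertices cl_neq0 certB certD ay).
Qed.

Lemma HH1_dim : HH_dim A 1 4.
Proof.
apply: Ext_dim_resolution; exists (class_hom lam b idem1 (B := HH1_classes)).
have certH x : homotopy_certificate lambda_table arrows arrows D1 D2 idem1 k1 k2 cl
    HH1_classes HH1_coord x by move: x; apply: arrow_basP; vm_compute.
have certB : cohomology_certificate lambda_table arrows D2 idem1 cl HH1_classes HH1_coord.
  by vm_compute.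
have certD x : nilp (lnorm (lbind HH1_coord (cob_op lambda_table arrows D1 x))).
  by move: x; apply: vertex_basP; vm_compute.
split=> [i|f fZ|a aB].
- exact: (class_hom_cocycle char2 mtE arrows_uniq mem_arrows idem1_idem idem1_idem D2_fixed certB).
- have [a ay] := class_hom_span (char2 := char2) (mtE := mtE) (D1e := D2_fixed)
    arrows_uniq mem_arrows arrows_uniq mem_arrows
    idem1_idem idem1_idem cl_neq0 certB certH fZ.
  exists a; exact: ((coboundary_cochain char2 mtE idem0_idem idem1_idem D1_fixed _).2 ay).
- have [y ay] := (coboundary_cochain char2 mtE idem0_idem idem1_idem D1_fixed
    (lincomb a (class_hom lam b idem1 (B := HH1_classes)))).1 aB.
  exact: (class_hom_indep char2 mtE arrows_uniq mem_arrows cl_neq0 certB certD ay).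
Qed.

Lemma HH2_dim : HH_dim A 2 4.
Proof.
apply: Ext_dim_resolution; exists (class_hom lam b idem1 (B := HH2_classes)).
have certH x : homotopy_certificate lambda_table arrows vertices D2 D3 idem1 k2 k3 cl
    HH2_classes HH2_coord x by move: x; apply: arrow_basP; vm_compute.
have certB : cohomology_certificate lambda_table vertices D3 idem1 cl HH2_classes HH2_coord.
  by vm_compute.
have certD x : nilp (lnorm (lbind HH2_coord (cob_op lambda_table arrows D2 x))).
  by move: x; apply: arrow_basP; vm_compute.
split=> [i|f fZ|a aB].
- exact: (class_hom_cocycle char2 mtE vertices_uniq mem_vertices
    idem1_idem idem0_idem D3_fixed certB).
- have [a ay] := class_hom_span (char2 := char2) (mtE := mtE) (D1e := D3_fixed)
    arrows_uniq mem_arrows vertices_uniq mem_vertices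
    idem1_idem idem0_idem cl_neq0 certB certH fZ.
  exists a; exact: ((coboundary_cochain char2 mtE idem1_idem idem1_idem D2_fixed _).2 ay).
- have [y ay] := (coboundary_cochain char2 mtE idem1_idem idem1_idem D2_fixed
    (lincomb a (class_hom lam b idem1 (B := HH2_classes)))).1 aB.
  exact: (class_hom_indep char2 mtE arrows_uniq mem_arrows cl_neq0 certB certD ay).
Qed.

End Resolution.

Theorem proposition5p2 (K : closedFieldType) (hchar : 2%N \in [pchar K])
    (lam : K) (lam_neq0 : lam != 0) (lam_neq1 : lam != 1) :
  [/\ HH_dim (Lambda3 lam) 0 6,
      HH_dim (Lambda3 lam) 1 4 &
      HH_dim (Lambda3 lam) 2 4].
Proof.
pose b := lambda_basis hchar lam_neq0 lam_neq1.
have mtE := lambda_tableP hchar lam_neq0 lam_neq1.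
have b1E : b a0 + b b0 = 1 by exact: lambda_elt_one.
split.
- exact: (HH0_dim hchar lam_neq0 lam_neq1 mtE b1E).
- exact: (HH1_dim hchar lam_neq0 lam_neq1 mtE b1E).
- exact: (HH2_dim hchar lam_neq0 lam_neq1 mtE b1E).
Qed.
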